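(* Let $n \ge 1$ and $t \ge 1$ be integers and $\theta \in [0,1)$. Then: (1) $\Theta(3,\theta,n) = (2n)^{1-\theta}$, and a measure $\nu \in \mathcal M^c_3(S^{n-1})$ satisfies $\|\nu\|_\theta = (2n)^{1-\theta}$ if and only if there is an orthogonal basis $u_1,\dots,u_n$ of $\mathbb R^n$ consisting of unit vectors such that $\nu$ is the uniform probability measure on $\{\pm u_i\}_{i=1}^n$. (2) For every $t$ there exist constants $c, C > 0$ (depending only on $t$) such that for all $n$ and all $\theta \in [0,1)$, $$(c\, n^{\lfloor t/2\rfloor})^{1-\theta} \le \Theta(t,\theta,n) \le (C\, n^{2\lfloor t/2\rfloor - 1})^{1-\theta}.$$ (3) For every $n$ there exist constants $c, C > 0$ (depending only on $n$) such that for all $t$ and all $\theta \in [0,1)$, $$(c\, t^{n-1})^{1-\theta} \le \Theta(t,\theta,n) \le (C\, t^{n-1})^{1-\theta}.$$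
   Context: $S^{n-1}$ is the unit sphere in $\mathbb R^n$ and $\sigma$ is the rotation-invariant probability measure on $S^{n-1}$. For $t \in \mathbb N$, $\mathcal M^c_t(S^{n-1})$ denotes the set of discrete probability measures $\nu$ on $S^{n-1}$ (probability measures supported on countably many points) such that $\int p\,d\nu = \int p\,d\sigma$ for every polynomial $p$ on $\mathbb R^n$ of degree at most $t$ (cubature measures of strength $t$). For a discrete probability measure $\nu = \sum_i \nu_i \delta_{\xi_i}$ with distinct points $\xi_i$ and weights $\nu_i > 0$, and $\theta \in [0,1)$, set $\|\nu\|_\theta = \sum_i \nu_i^\theta$ (possibly $+\infty$; for $\theta = 0$ this is the cardinality of the support). Define $\Theta(t,\theta,n) = \inf\{\|\nu\|_\theta : \nu \in \mathcal M^c_t(S^{n-1})\}$.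
   Formalization: In (2), for t = 1 the printed exponent 2⌊t/2⌋−1 = −1 makes the upper bound false (Θ(1,0,n) = 2 for all n, while C/n → 0); the formal statement uses exponent 0 when t = 1 and the printed exponent for all t ≥ 2. *)

(* Defs.v *)
From mathcomp Require Import all_boot all_order all_algebra finmap.
(* The notations of mpoly clash with those of the analysis library. *)
From mathcomp Require Import (canonicals, coercions) mpoly.
From mathcomp Require Import all_classical all_reals all_analysis.

Set Implicit Arguments.
Unset Strict Implicit.
Unset Printing Implicit Defensive.

Import Order.TTheory GRing.Theory Num.Theory.
Import numFieldNormedType.Exports.

Local Open Scope classical_set_scope.
Local Open Scope ring_scope.

(* R^n as row vectors, with its Borel sigma-algebra. *)
Definition borelRn (R : realType) (n : nat) :
    measurableType (sigma_display (@open 'rV[R]_n)) :=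
  g_sigma_algebraType (@open 'rV[R]_n).

Section Definitions.
Context {R : realType} {n : nat}.

Local Notation vec := (borelRn R n).

Definition dot (x y : 'rV[R]_n) : R := \sum_(i < n) x ord0 i * y ord0 i.

Definition sphere : set vec := [set x | dot x x = 1].

(* Rotations are taken in the full orthogonal group O(n): for n >= 2 the
   subgroup SO(n) gives the same measure, but on S^0 = {-1, 1} invariance
   under SO(1) would be void. *)
Definition rotation_invariant (sigma : probability vec R) : Prop :=
  forall Q : 'M[R]_n, Q *m Q^T = 1%:M ->
  forall A : set vec, measurable A ->
    sigma [set x : vec | A (x *m Q)] = sigma A.

Definition invariant_sphere_probability (sigma : probability vec R) : Prop :=
  sigma sphere = 1%E /\ rotation_invariant sigma.

(* Countable sets are Borel, hence nu D is meaningful. *)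
Definition discrete_on_sphere (nu : probability vec R) : Prop :=
  exists D : set vec, [/\ countable D, D `<=` sphere & nu D = 1%E].

Definition peval (p : mpoly.mpoly n R) (x : vec) : R :=
  mpoly.meval (fun i : 'I_n => (x : 'rV[R]_n) ord0 i) p.

(* mpoly.msize p is 1 + the total degree of p, and 0 for p = 0. *)
Definition cubature (sigma : probability vec R) (t : nat) :
    set (probability vec R) :=
  [set nu | discrete_on_sphere nu /\
     forall p : mpoly.mpoly n R, (mpoly.msize p <= t.+1)%N ->
       (\int[nu]_(x in sphere) (peval p x)%:E =
        \int[sigma]_(x in sphere) (peval p x)%:E)%E].

(* The sum runs over the atoms only, since the convention is 0 `^ 0 = 1. *)
Definition theta_norm (theta : R) (nu : probability vec R) : \bar R :=
  (\esum_(x in [set x : vec | 0 < nu [set x]]) (nu [set x] `^ theta))%E.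

Definition Theta (sigma : probability vec R) (t : nat) (theta : R) : \bar R :=
  ereal_inf [set theta_norm theta nu | nu in cubature sigma t].

Definition orthogonal_unit_basis (u : 'I_n -> 'rV[R]_n) : Prop :=
  [/\ basis_of fullv [seq u i | i <- enum 'I_n],
      forall i j : 'I_n, i != j -> dot (u i) (u j) = 0 &
      forall i : 'I_n, dot (u i) (u i) = 1].

Definition plus_minus (u : 'I_n -> 'rV[R]_n) : set vec :=
  [set x : vec | exists i : 'I_n, x = u i \/ x = - u i].

Definition uniform_on (F : set vec) (nu : probability vec R) : Prop :=
  forall A : set vec, measurable A ->
    nu A = ((#|` fset_set (A `&` F)|)%:R / (#|` fset_set F|)%:R)%:E.

End Definitions.

(* Main.v *)
(* An atom of a cubature measure nu at xi satisfies nu {xi} q(xi) <= E q for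
   every polynomial q >= 0 on the sphere of degree at most the strength, where
   E is the mean over the sphere; and if all atoms are at most 1/B then
   ||nu||_theta >= B^(1 - theta), since x^theta >= B^(1 - theta) x on [0, 1/B].
   Conversely N points give ||nu||_theta <= N^(1 - theta) by concavity.  With
   s = <xi, x>, the test polynomials are s^2 (1 + s) / 2 for strength 3,
   s^(2k) for fixed t, k = t./2, and K(x0, x)^2 for fixed n, where K is the
   reproducing kernel of a space of polynomials of degree at most k.

   Upper bound for fixed t: if sum_u <a, y_u>^(2k) = c |a|^(2k) for all a, the
   points +- y_u / |y_u| with weights proportional to |y_u|^(2k) form a
   cubature rule of strength 2k + 1.  Such y_u are vectors of 2k-wise
   independent coordinates with Gaussian moments: the coordinates are
   t(<u, h_i>), u in F_p^m, where any 2k of the h_i are linearly independent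
   (Gilbert-Varshamov) and the p values of t have Gaussian moments up to order
   2k.  For fixed n the upper bound is Tchakaloff's theorem. *)
Require Import Defs.
From mathcomp Require Import all_boot all_order all_algebra.
From mathcomp Require Import (canonicals, coercions) finmap mpoly.
From mathcomp Require Import all_classical all_reals all_analysis.
From mathcomp Require Import measurable_realfun complex ring lra zify.

Set Implicit Arguments.
Unset Strict Implicit.
Unset Printing Implicit Defensive.

Import Order.TTheory GRing.Theory Num.Theory.
Import numFieldNormedType.Exports.

Local Open Scope classical_set_scope.
Local Open Scope ring_scope.

(** * Equal-weight quadrature for the Gaussian moments *)

(** For fixed t the obstacle is that each element of F_p must count equally, whereas Gauss
    quadrature has arbitrary real weights. The weights are rounded to multiples of 1/p, and the
    nodes are displaced until the moments are exact again; this works for every large p, in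
    particular for a prime depending on k alone. The greedy choice of the h_i must avoid the
    combinations of 2k - 1 earlier vectors, at most (p n)^(2k - 1) of them, so p^m and with it the
    number of points is of order n^(2k - 1). The identity in degree 2k implies those of lower even
    degree because |x|^2 = 1 on the sphere; antipodes settle the odd degrees. No spherical integral
    is evaluated: averaging the design over the sphere expresses the mean of s^(2k) through sum
    |y_u|^(2k), so the lower bound for fixed t comes from the same design. For fixed n, the
    polynomials of degree at most t on R^n form a space larger by a factor t than allowed; the
    relation x_0^2 = 1 - (the other squares) brings the count of monomials down to order t^(n -
    1). *)

Section ContinuityToolkit.
Variables (R : realType) (T : topologicalType).

Lemma continuous_sum (I : Type) (r : seq I) (P : pred I) (F : I -> T -> R) :
  (forall i, P i -> continuous (F i)) ->
  continuous (fun x => \sum_(i <- r | P i) F i x).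
Proof. by apply: continuous_big => -[x y]; exact: add_continuous. Qed.

Lemma continuous_prod (I : Type) (r : seq I) (P : pred I) (F : I -> T -> R) :
  (forall i, P i -> continuous (F i)) ->
  continuous (fun x => \prod_(i <- r | P i) F i x).
Proof. by apply: continuous_big => -[x y]; exact: mul_continuous. Qed.

Lemma continuous_mul (f g : T -> R) :
  continuous f -> continuous g -> continuous (fun x => f x * g x).
Proof. by move=> cf cg x; apply: cvgM; [exact: cf|exact: cg]. Qed.

Lemma continuous_add (f g : T -> R) :
  continuous f -> continuous g -> continuous (fun x => f x + g x).
Proof. by move=> cf cg x; apply: cvgD; [exact: cf|exact: cg]. Qed.

Lemma continuous_const (c : R) : continuous (fun _ : T => c).
Proof. by move=> x; exact: cvg_cst. Qed.

Lemma continuous_expr (f : T -> R) m :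
  continuous f -> continuous (fun x => f x ^+ m).
Proof.
move=> cf; elim: m => [|m IH].
  by under eq_fun do rewrite expr0; exact: continuous_const.
by under eq_fun do rewrite exprS; exact: continuous_mul.
Qed.

Lemma continuous_det n (A : T -> 'M[R]_n) :
  (forall i j, continuous (fun x => A x i j)) ->
  continuous (fun x => \det (A x)).
Proof.
move=> cA; apply: continuous_sum => s _.
by apply: continuous_mul; [exact: continuous_const|exact: continuous_prod].
Qed.

End ContinuityToolkit.

(* Moments of a standard Gaussian variable: (m - 1)!! for even m. *)
Fixpoint gmom (m : nat) : nat :=
  match m with 0 => 1 | 1 => 0 | (m'.+1 as m1).+1 => (m1 * gmom m')%N end.

Lemma gmomSS m : gmom m.+2 = (m.+1 * gmom m)%N. Proof. by []. Qed.

Section Jacobi.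
Variables (R : realType) (N : nat).

(* The Jacobi matrix of the Hermite polynomials; its spectral measure at the
   first basis vector is the Gauss quadrature rule. *)
Definition jacobi : 'M[R]_N.+1 :=
  \matrix_(i, j) ((if i.+1 == j :> nat then Num.sqrt j%:R else 0) +
                  (if j.+1 == i :> nat then Num.sqrt i%:R else 0)).

(** The coefficient of x^r on the orthonormal Hermite polynomial He_i / sqrt(i!), since x^r = sum_i
    C(r, i) gmom(r - i) He_i. *)
Let jrow (r i : nat) : R := ('C(r, i) * gmom (r - i))%:R * Num.sqrt (i`!%:R).

Lemma jrowS r i : jrow r.+1 i =
  (if i is i'.+1 then jrow r i' * Num.sqrt i%:R else 0) +
  jrow r i.+1 * Num.sqrt i.+1%:R.
Proof.
have sq (m : nat) : Num.sqrt m%:R * Num.sqrt m%:R = m%:R :> R.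
  by rewrite -expr2 sqr_sqrtr.
have fS (m : nat) : Num.sqrt (m.+1)`!%:R = Num.sqrt m.+1%:R * Num.sqrt m`!%:R :> R.
  by rewrite factS (natrM R) sqrtrM.
have H1 : jrow r i.+1 * Num.sqrt i.+1%:R =
    ('C(r, i) * gmom (r.+1 - i))%:R * Num.sqrt i`!%:R.
  rewrite /jrow fS.
  have -> : ('C(r, i) * gmom (r.+1 - i) = 'C(r, i.+1) * gmom (r - i.+1) * i.+1)%N.
  case: (ltnP i r) => ir; last first.
      rewrite ['C(r, i.+1)]bin_small ?mul0n //.
      move: ir; rewrite leq_eqVlt => /orP[/eqP->|ir]; last by rewrite bin_small.
      by rewrite subSnn muln0.
    have -> : (r.+1 - i = (r - i.+1).+2)%N by lia.
    rewrite gmomSS -subSn // subSS [in RHS]mulnAC mulnA; congr (_ * _)%N.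
    by rewrite mulnC -mul_bin_left mulnC.
  rewrite (natrM R ('C(r, i.+1) * _)%N) -[i.+1%:R in RHS]sq.
  by rewrite -!mulrA; congr (_ * _); rewrite mulrCA [in RHS]mulrC -mulrA [in RHS]mulrCA.
rewrite H1; case: i H1 => [|i] _.
  by rewrite add0r /jrow !bin0.
rewrite {1 2}/jrow fS subSS.
rewrite -!mulrA [Num.sqrt i`!%:R * _]mulrC -mulrDl -(natrD R) -mulnDl.
by rewrite binS addnC.
Qed.

(** The entry sums over walks of length r from 0 to i. A walk that reaches N + 1 and returns to i
    has length at least 2 N + 2 - i, so for r + i <= 2 N + 1 the truncation of the matrix is not
    felt. *)
Lemma jacobi_row r (i : 'I_N.+1) : (r + i <= N.*2.+1)%N ->
  (jacobi ^+ r) ord0 i = jrow r i.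
Proof.
elim: r i => [|r IH] i ri.
  rewrite expr0 mxE /jrow; case: i ri => [[|i] Hi] _ /=.
    by rewrite fact0 sqrtr1 mulr1.
  by rewrite bin0n mul0n mul0r.
rewrite exprSr mxE jrowS.
under eq_bigr do rewrite [X in _ * X]mxE mulrDr.
rewrite big_split /=; congr (_ + _).
- case: i ri => [[|i] Hi] /= ri.
    by rewrite big1 // => j _; rewrite mulr0.
  have Hi' : (i < N.+1)%N by lia.
  rewrite (bigD1 (Ordinal Hi')) //= eqxx big1 ?addr0 => [|j jn].
    by rewrite IH //=; lia.
  case: eqP => [[ji]|]; last by rewrite mulr0.
  by case/eqP: jn; apply: val_inj.
- case: (ltnP i.+1 N.+1) => Hi.
    rewrite (bigD1 (Ordinal Hi)) //= eqxx big1 ?addr0 => [|j jn].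
      by rewrite IH //=; lia.
    case: eqP => [ji|]; last by rewrite mulr0.
    by case/eqP: jn; apply: val_inj.
  (* Here i = N: the neighbour N + 1 lies outside the matrix, but r <= N makes [jrow r N.+1]
     vanish. *)
  rewrite big1 => [|j _].
    have e : nat_of_ord i = N by have := ltn_ord i; lia.
    rewrite /jrow bin_small ?mul0n ?mul0r //; lia.
  case: eqP => [ji|]; last by rewrite mulr0.
  by have := ltn_ord j; lia.
Qed.

Lemma jacobi_mom r : (r <= N.*2.+1)%N -> (jacobi ^+ r) ord0 ord0 = (gmom r)%:R.
Proof.
move=> rN; rewrite jacobi_row /= ?addn0 //.
by rewrite /jrow bin0 mul1n subn0 fact0 sqrtr1 mulr1.
Qed.

(** [A] is diagonalised as a Hermitian matrix over the complex numbers. The eigenvalues and the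
    squared moduli of the first coordinates of the eigenvectors are real, so the decomposition
    descends to [R]. *)
Lemma symmetric_spectral_moments (A : 'M[R]_N.+1) : A^T = A ->
  exists w x : 'I_N.+1 -> R, (forall a, 0 <= w a) /\
    forall r, (A ^+ r) ord0 ord0 = \sum_a w a * x a ^+ r.
Proof.
move=> AT; pose C := complex R.
pose f : {rmorphism R -> C} := real_complex R.
pose B := map_mx f A.
have Bh : B \is hermsymmx.
  apply: realsym_hermsym.
    by apply/is_hermitianmxP; rewrite expr0 scale1r map_mx_id // map_trmx AT.
  by apply/mxOverP => i j; rewrite mxE complex_real.
have Bn := hermitian_normalmx Bh.
set P := spectralmx B; set d := spectral_diag B.
have PU : P \is unitarymx := spectral_unitarymx B.
have EB : B = invmx P *m diag_mx d *m P by apply/orthomx_spectralP.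
have dreal : d \is a realmx by exact: hermitian_spectral_diag_real.
have dr a : (complex.Re (d ord0 a))%:C%C = d ord0 a.
  by apply: RRe_real; move/mxOverP: dreal; apply.
have wr a : (complex.Re (P a ord0 * (P a ord0)^*))%:C%C = P a ord0 * (P a ord0)^*.
  by apply: RRe_real; rewrite ger0_real // mul_conjC_ge0.
exists (fun a => complex.Re (P a ord0 * (P a ord0)^*)), (fun a => complex.Re (d ord0 a)).
split=> [a|r].
  by rewrite -lecR wr mul_conjC_ge0.
apply: (fmorph_inj f); rewrite rmorph_sum /=.
have -> : f ((A ^+ r) ord0 ord0) = (B ^+ r) ord0 ord0.
  by rewrite -[B ^+ r]rmorphXn /= mxE.
have -> : B ^+ r = invmx P *m diag_mx (\row_a d ord0 a ^+ r) *m P.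
  have PK : P *m invmx P = 1%:M by rewrite mulmxV // unitarymx_unit.
  elim: r => [|r IH].
    rewrite expr0; have -> : \row_a d ord0 a ^+ 0 = const_mx 1.
      by apply/rowP => a; rewrite !mxE expr0.
    by rewrite diag_const_mx mulmx1 mulVmx // unitarymx_unit.
  rewrite exprSr IH {1}EB -[LHS]/(_ *m _) -!mulmxA; congr (_ *m _).
  rewrite [P *m _]mulmxA PK mul1mx mulmxA mulmx_diag; congr (_ *m _).
  by congr diag_mx; apply/rowP => a; rewrite !mxE exprSr.
rewrite mul_mx_diag invmx_unitary // mxE; apply: eq_bigr => a _.
rewrite !mxE rmorphM rmorphXn /= wr dr mulrAC; congr (_ * _).
by rewrite mulrC.
Qed.
End Jacobi.

(* The nodes carrying positive weight number at least K: otherwise the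
   polynomial q vanishing on them would be orthogonal to the Hermite
   polynomial of the same degree d, whereas that pairing is d!. *)
Section GaussQuadrature.
Variables (R : realType) (K : nat) (w x : 'I_K.+1 -> R).
Hypothesis w_ge0 : forall a, 0 <= w a.
Hypothesis wx_mom : forall r, (r <= K.*2.+1)%N ->
  \sum_a w a * x a ^+ r = (gmom r)%:R.

Let L (f : {poly R}) : R := \sum_a w a * f.[x a].

Let LB f g : L (f - g) = L f - L g.
Proof.
by rewrite /L -sumrB; apply: eq_bigr => a _; rewrite hornerD hornerN mulrBr.
Qed.

Let L_coef n (f : {poly R}) : (size f <= n)%N -> (n <= K.*2.+2)%N ->
  L f = \sum_(i < n) f`_i * (gmom i)%:R.
Proof.
move=> sf nK; rewrite /L.
under eq_bigr do rewrite (horner_coef_wide _ sf) mulr_sumr.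
rewrite exchange_big; apply: eq_bigr => i _ /=.
rewrite -wx_mom; last by have := ltn_ord i; lia.
by rewrite mulr_sumr; apply: eq_bigr => a _; rewrite mulrCA.
Qed.

(** Integration by parts for the Gaussian, E[X f(X)] = E[f'(X)], which on monomials is the recursion
    [gmomSS]. The size hypothesis keeps X f within the degrees where the quadrature is exact. *)
Let L_mulX (f : {poly R}) : (size f <= K.*2.+1)%N -> L ('X * f) = L f^`().
Proof.
move=> sf; rewrite (@L_coef K.*2.+2) //; last first.
  by rewrite (leq_trans (size_polyMleq _ _)) // size_polyX /=.
rewrite (@L_coef K.*2.+1) //; last first.
  by rewrite (leq_trans (size_poly _ _)) // (leq_trans (leq_pred _)).
rewrite big_ord_recl coefXM eqxx mul0r add0r.
rewrite big_ord_recl coefXM /= mulr0 add0r.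
rewrite [RHS]big_ord_recr /= coef_deriv nth_default ?mul0rn ?mul0r ?addr0 //.
apply: eq_bigr => i _; rewrite coefXM coef_deriv -[X in X%:R]/(i.+1 * gmom i)%N.
by rewrite -[X in X * _]/(f`_i.+1) (natrM R) mulrA -[X in _ = X * _]mulr_natr.
Qed.

Fixpoint hermite (j : nat) : {poly R} :=
  if j is j'.+1 then 'X * hermite j' - (hermite j')^`() else 1.

Let size_hermite j : (size (hermite j) <= j.+1)%N.
Proof.
elim: j => [|j IH] /=; first by rewrite size_poly1.
rewrite (leq_trans (size_polyD _ _)) // geq_max size_polyN; apply/andP; split.
  by rewrite (leq_trans (size_polyMleq _ _)) // size_polyX.
by rewrite (leq_trans (size_poly _ _)) // (leq_trans (leq_pred _)) // ltnW.
Qed.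

Let L_hermite j (q : {poly R}) : (size q + j <= K.*2.+1)%N ->
  L (q * hermite j) = L (q^`(j)).
Proof.
elim: j q => [|j IH] q sq /=; first by rewrite mulr1.
rewrite mulrBr LB mulrCA L_mulX; last first.
  rewrite (leq_trans (size_polyMleq _ _)) //.
  by have := size_hermite j; move: sq; lia.
rewrite derivM -LB addrK IH -?derivnS ?derivSn //.
have : (size q^`() <= (size q).-1)%N by exact: size_poly.
by move: sq; case: (size q) => [|m]; lia.
Qed.

Lemma merge_nodes : exists M (x' w' : 'I_M -> R),
  [/\ (K <= M)%N, injective x', forall a, 0 < w' a &
   forall r, (r <= M)%N -> \sum_a w' a * x' a ^+ r = (gmom r)%:R].
Proof.
(* Nodes are merged by value and zero weights dropped: [perturb_nodes] requires distinct nodes and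
   positive weights. *)
pose S := undup [seq x a | a <- enum 'I_K.+1 & 0 < w a].
have uS : uniq S by exact: undup_uniq.
have memS a : 0 < w a -> x a \in S.
  by move=> wa; rewrite mem_undup; apply/map_f; rewrite mem_filter wa mem_enum.
have sSK : (size S <= K.+1)%N.
  rewrite (leq_trans (size_undup _)) // size_map size_filter.
  by rewrite (leq_trans (count_size _ _)) // size_enum_ord.
exists (size S), (fun i => S`_i), (fun i => \sum_(a | x a == S`_i) w a).
split.
- rewrite leqNgt; apply/negP => SK.
  pose q := \prod_(s <- S) ('X - s%:P).
  have mq : q \is monic by exact: monic_prod_XsubC.
  have sq : size q = (size S).+1 by rewrite size_prod_XsubC.
  have : L (q * hermite (size S)) = 0.
    rewrite /L big1 // => a _.
    have := w_ge0 a; rewrite le_eqVlt => /orP[/eqP<-|wa]; first by rewrite mul0r.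
    have /rootP qx : root q (x a) by rewrite root_prod_XsubC memS.
    by rewrite hornerM qx mul0r mulr0.
  rewrite L_hermite; last by rewrite sq; lia.
  have -> : q^`(size S) = ((size S)`!)%:R%:P.
    apply/polyP => i; rewrite coef_derivn coefC; case: i => [|i].
      rewrite addn0 /= ffactnn; move/monicP: mq.
      by rewrite lead_coefE sq /= => ->.
    by rewrite nth_default ?mul0rn // sq; lia.
  rewrite (@L_coef 1) ?big_ord1 ?coefC /= ?mulr1 //; last first.
    by rewrite size_polyC; case: (_ == _).
  by move/eqP; rewrite pnatr_eq0 => /eqP f0; have := fact_gt0 (size S); rewrite f0.
- by move=> i j /eqP; rewrite nth_uniq // => /eqP/val_inj.
- move=> i; have := mem_nth 0 (ltn_ord i).
  rewrite mem_undup => /mapP[a]; rewrite mem_filter => /andP[wa _] Sa.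
  rewrite (bigD1 a) /=; last by rewrite Sa.
  by rewrite ltr_wpDr // sumr_ge0.
- move=> r rM; rewrite -wx_mom; last by lia.
  under eq_bigr do rewrite mulr_suml.
  rewrite (exchange_big_dep xpredT) //=; apply: eq_bigr => a _.
  have := w_ge0 a; rewrite le_eqVlt => /orP[/eqP<-|wa].
    by rewrite mul0r big1 // => i _; rewrite mul0r.
  have := memS a wa; rewrite -index_mem => ia.
  rewrite (bigD1 (Ordinal ia)) /=; last by rewrite nth_index // memS.
  rewrite nth_index ?memS // big1 ?addr0 // => i /andP[/eqP xi].
  by rewrite -val_eqE /= xi index_uniq // eqxx.
Qed.

End GaussQuadrature.

Lemma gauss_quadrature (R : realType) (K : nat) : exists M (x w : 'I_M -> R),
  [/\ (K <= M)%N, injective x, forall a, 0 < w a &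
   forall r, (r <= M)%N -> \sum_a w a * x a ^+ r = (gmom r)%:R].
Proof.
have [|w [x [w0 wx]]] := @symmetric_spectral_moments R K (jacobi R K).
  by apply/matrixP => i j; rewrite !mxE addrC.
by apply: (@merge_nodes R K w x w0) => r rK; rewrite -wx jacobi_mom.
Qed.

Section PerturbNodes.
Variable R : realType.

Lemma derivative_Vandermonde_unit M (y : 'I_M -> R) : injective y ->
  \matrix_(a, r) (y a ^+ r *+ r.+1) \in unitmx.
Proof.
move=> yI; rewrite -unitmx_tr -row_free_unit; apply: inj_row_free => u uA.
pose p := \poly_(r < M) (if insub r is Some i then u ord0 i *+ r.+1 else 0).
have pc (i : 'I_M) : p`_i = u ord0 i *+ i.+1.
  by rewrite coef_poly ltn_ord valK.
have p0 : p = 0.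
  apply: (@roots_geq_poly_eq0 _ _ [seq y a | a <- enum 'I_M]).
  - apply/allP => _ /mapP[a _ ->]; apply/rootP.
    rewrite (horner_coef_wide _ (size_poly _ _)).
    transitivity ((u *m (\matrix_(a, r) (y a ^+ r *+ r.+1))^T) ord0 a).
      by rewrite mxE; apply: eq_bigr => r _; rewrite !mxE pc mulrnAr mulrnAl.
    by rewrite uA mxE.
  - by rewrite map_inj_uniq ?enum_uniq.
  - by rewrite size_map size_enum_ord size_poly.
apply/rowP => i; have /eqP := pc i; rewrite p0 coef0 eq_sym mulrn_eq0 /= => /eqP ->.
by rewrite mxE.
Qed.

(** Used on coordinate lines, where the objective of [perturb_nodes] is a polynomial. Writing p =
    p(0) + X q, the derivative at 0 is q(0), and a nonzero q(0) makes X q negative on one side of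
    0. *)
Lemma poly_local_min (p : {poly R}) (e : R) : 0 < e ->
  (forall s, `|s| < e -> p.[0] <= p.[s]) -> p^`().[0] = 0.
Proof.
move=> e0 pmin.
pose q := \poly_(i < size p) p`_i.+1.
have pq : p = p.[0]%:P + 'X * q.
  apply/polyP => i; rewrite coefD coefC coefXM coef_poly horner_coef0.
  case: i => [|i] /=; first by rewrite addr0.
  rewrite add0r; case: ltnP => // ip.
  by rewrite nth_default // (leq_trans ip).
have ps s : p.[s] = p.[0] + s * q.[s].
  by rewrite {1}pq !hornerE.
rewrite pq derivD derivC add0r derivM derivX mul1r !hornerE.
have cq : continuous (fun s : R => q.[s]).
  under eq_fun do rewrite horner_coef.
  apply: continuous_sum => i _; apply: continuous_mul; first exact: continuous_const.
  by apply: continuous_expr => x; exact: cvg_id.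
apply/eqP; case: ltgtP => // q0; exfalso.
- have [d /= d0 dq] := @cvgr_lt _ _ _ _ _ _ (cq 0) _ q0.
  pose s := Num.min d e / 2.
  have de0 : 0 < Num.min d e by rewrite lt_min d0.
  have s0 : 0 < s by rewrite divr_gt0.
  have smin : s < Num.min d e by rewrite ltr_pdivrMr // ltr_pMr // ltr1n.
  move: smin; rewrite lt_min => /andP[sd se].
  have := pmin s; rewrite gtr0_norm // => /(_ se); rewrite (ps s) lerDl pmulr_rge0 //.
  rewrite leNgt => /negP; apply; apply: dq => /=.
  by rewrite sub0r normrN gtr0_norm.
- have [d /= d0 dq] := @cvgr_gt _ _ _ _ _ _ (cq 0) _ q0.
  pose s := Num.min d e / 2.
  have de0 : 0 < Num.min d e by rewrite lt_min d0.
  have s0 : 0 < s by rewrite divr_gt0.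
  have smin : s < Num.min d e by rewrite ltr_pdivrMr // ltr_pMr // ltr1n.
  move: smin; rewrite lt_min => /andP[sd se].
  have := pmin (- s); rewrite normrN gtr0_norm // => /(_ se).
  rewrite (ps (- s)) lerDl mulNr oppr_ge0 pmulr_rle0 //.
  rewrite leNgt => /negP; apply; apply: dq => /=.
  by rewrite sub0r normrN normrN gtr0_norm.
Qed.

Lemma compact_le_norm n (rho : R) : compact [set d : 'rV[R]_n | `|d| <= rho].
Proof.
apply: bounded_closed_compact.
  exists rho; split; first exact: num_real.
  by move=> M' rM' d /= dr; rewrite (le_trans dr) // ltW.
rewrite (_ : mkset _ = (fun d : 'rV[R]_n => `|d|) @^-1` [set x | x <= rho]) //.
apply: closed_comp; last exact: closed_le.
by move=> d _; exact: norm_continuous.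
Qed.

Lemma compact_eq_norm n (rho : R) : compact [set d : 'rV[R]_n | `|d| = rho].
Proof.
apply: (subclosed_compact _ (@compact_le_norm n rho)).
  rewrite (_ : mkset _ = (fun d : 'rV[R]_n => `|d|) @^-1` [set x | x = rho]) //.
  apply: closed_comp; last exact: closed_eq.
  by move=> d _; exact: norm_continuous.
by move=> d /= ->.
Qed.

Lemma coord_le_norm n (d : 'rV[R]_n) a : `|d ord0 a| <= `|d|.
Proof.
have /mapP[j Hj ->] : `|d ord0 a| \in [seq `|d x.1 x.2| | x : 'I_1 * 'I_n].
  by apply/mapP; exists (ord0, a) => //=; rewrite mem_enum.
by rewrite [leRHS]/Num.norm /= mx_normrE; apply/bigmax_geP; right => /=; exists j.
Qed.

Section Perturb.
Variables (M : nat) (x w : 'I_M.+1 -> R).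
Hypothesis xI : injective x.
Hypothesis w0 : forall a, 0 < w a.

Let nd (d : 'rV[R]_M.+1) a := x a + d ord0 a.
(** Exponents start at 1: the moment of order 0 is the total weight, which displacing nodes leaves
    alone. By divided differences, F w d - F w 0 is the row of the w_a d_a times [B1 d]; [B2 d]
    holds the derivatives of the powers. The two matrices agree at d = 0. *)
Let F (u : 'I_M.+1 -> R) d (r : 'I_M.+1) := \sum_a u a * nd d a ^+ r.+1.
Let mu r := F w 0 r.
Let B1 d := \matrix_(a, r < M.+1) \sum_(s < r.+1) nd d a ^+ (r - s) * x a ^+ s.
Let B2 d := \matrix_(a, r < M.+1) (nd d a ^+ r *+ r.+1).

Let nd0 a : nd 0 a = x a. Proof. by rewrite /nd mxE addr0. Qed.

Let cnd a : continuous (fun d => nd d a).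
Proof.
by apply: continuous_add; [exact: continuous_const|exact: coord_continuous].
Qed.

Let cF u r : continuous (fun d => F u d r).
Proof.
apply: continuous_sum => a _; apply: continuous_mul; first exact: continuous_const.
exact/continuous_expr/cnd.
Qed.

Let D_near : exists2 rho, 0 < rho &
  forall d : 'rV_M.+1, `|d| <= rho -> \det (B1 d) != 0 /\ \det (B2 d) != 0.
Proof.
have B120 : B1 0 = B2 0.
  apply/matrixP => a r; rewrite !mxE nd0.
  rewrite (eq_bigr (fun _ => x a ^+ r)) ?sumr_const ?card_ord //.
  by move=> s _; rewrite -exprD subnK // -ltnS.
have B20 : \det (B2 0) != 0.
  rewrite -unitfE -[_ \is a _]/(B2 0 \in unitmx).
  have -> : B2 0 = \matrix_(a, r) (x a ^+ r *+ r.+1).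
    by apply/matrixP => a r; rewrite !mxE nd0.
  exact: derivative_Vandermonde_unit.
have cD : continuous (fun d => \det (B1 d) * \det (B2 d)).
  apply: continuous_mul; apply: continuous_det => a r.
    under eq_fun do rewrite mxE.
    apply: continuous_sum => s _; apply: continuous_mul; last exact: continuous_const.
    exact/continuous_expr/cnd.
  under eq_fun do rewrite mxE -mulr_natr.
  apply: continuous_mul; last exact: continuous_const.
  exact/continuous_expr/cnd.
have D0 : \det (B1 0) * \det (B2 0) != 0 by rewrite B120 mulf_neq0.
have Dnear : \forall d \near (0 : 'rV[R]_M.+1), \det (B1 d) * \det (B2 d) != 0.
  by have := cvgr_neq0 _ (cD 0) D0; exact.
move/nbhs_norm0P : Dnear => [e /= e0 eD].
exists (e / 2); first by rewrite divr_gt0.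
move=> d de; have := eD d; rewrite mulf_eq0 negb_or => /(_ _)/andP; apply.
by rewrite /= (le_lt_trans de) // ltr_pdivrMr // ltr_pMr // ltr1n.
Qed.

(* The distance of the moments to the target is minimised over small
   displacements of the nodes; a minimiser is interior, and there the
   derivative, a Vandermonde matrix up to row and column scaling, is
   invertible, so the minimum is zero. *)
Lemma perturb_nodes : exists2 eta, 0 < eta &
  forall u : 'I_M.+1 -> R, (forall a, `|u a - w a| <= eta) ->
  exists y : 'I_M.+1 -> R, forall r : 'I_M.+1,
    \sum_a u a * y a ^+ r.+1 = \sum_a w a * x a ^+ r.+1.
Proof.
have [rho rho0 Drho] := D_near.
have inj0 d : `|d| <= rho -> (forall r, F w d r = mu r) -> d = 0.
  move=> dr Fd; have [D1 _] := Drho d dr.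
  pose v := \row_a (w a * d ord0 a).
  have vB : v *m B1 d = 0.
    apply/rowP => r; rewrite !mxE -[RHS](subrr (mu r)) -{1}(Fd r) -sumrB.
    apply: eq_bigr => a _; rewrite !mxE nd0 -mulrBr subrXX -!mulrA; congr (_ * _).
    by rewrite /nd addrAC subrr add0r.
  have v0 : v = 0.
    by rewrite -[v](@mulmxK _ _ _ (B1 d)) ?vB ?mul0mx // unitmxE unitfE.
  apply/rowP => a; have /eqP := congr1 (fun A : 'rV_M.+1 => A ord0 a) v0.
  by rewrite !mxE mulf_eq0 gt_eqF //= => /eqP.
pose f u d := \sum_r (F u d r - mu r) ^+ 2.
have cf u : continuous (f u).
  apply: continuous_sum => r _; apply: continuous_expr.
  by apply: continuous_add; [exact: cF|exact: continuous_const].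
(* By [inj0] the objective for the weights [w] vanishes on the ball only at 0, so it has a positive
   minimum m on the boundary. *)
have [m m0 fm] : exists2 m, 0 < m & forall d, `|d| = rho -> m <= f w d.
  have [Sne|Se] := pselect ([set d : 'rV[R]_M.+1 | `|d| = rho] !=set0); last first.
    by exists 1 => // d dr; exfalso; apply: Se; exists d.
  have [|c] := @compact_EVT_min _ _ (f w) _ Sne (@compact_eq_norm _ rho).
    by apply: continuous_subspaceT => d; exact: cf.
  rewrite inE /= => cr cmin; exists (f w c); last first.
    by move=> d dr; apply: cmin; rewrite inE.
  have : 0 <= f w c by apply: sumr_ge0 => r _; rewrite sqr_ge0.
  rewrite le_eqVlt => /orP[/eqP fc0|//]; exfalso.
  have c0 : c = 0.
    apply: inj0; first by rewrite cr.
    move=> r; apply/eqP; rewrite -subr_eq0 -sqrf_eq0; apply/eqP.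
    apply: (psumr_eq0P _ (esym fc0)) => // i _; exact: sqr_ge0.
  by move: cr; rewrite c0 normr0 => /esym/eqP; rewrite gt_eqF.
pose c := Num.sqrt (m / M.+1%:R).
have mM0 : 0 < m / M.+1%:R by rewrite divr_gt0.
have c0 : 0 < c by rewrite sqrtr_gt0.
have cE : c ^+ 2 * M.+1%:R = m by rewrite sqr_sqrtr ?ltW // divfK // pnatr_eq0.
have fc d : `|d| = rho -> exists r, c <= `|F w d r - mu r|.
  move=> dr; apply: contrapT => /forallNP Hc.
  have := fm d dr; rewrite leNgt => /negP; apply.
  have -> : m = \sum_(r < M.+1) c ^+ 2 by rewrite sumr_const card_ord -mulr_natr cE.
  have Hr r : (F w d r - mu r) ^+ 2 < c ^+ 2.
    rewrite -real_normK ?num_real // ltrXn2r ?nnegrE ?normr_ge0 ?(ltW c0) //.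
    by rewrite ltNge; apply/negP; exact: Hc.
  by apply: ltr_sum => //; apply/hasP; exists ord0; rewrite ?mem_index_enum.
(* Changing the weights moves each moment by at most eps, so the objective is at most (M + 1) eps^2
   at 0 and at least (c - eps)^2 on the boundary. The factor 3 (M + 1) makes the former smaller, so
   the minimiser is interior. *)
pose eps := c / (3 * M.+1%:R).
have M1 : 1 <= M.+1%:R :> R by rewrite ler1n.
have eps0 : 0 < eps by rewrite divr_gt0 // mulr_gt0.
have epsE : eps * (3 * M.+1%:R) = c by rewrite divfK // mulf_neq0 // pnatr_eq0.
pose T := 1 + rho + \sum_a `|x a|.
have T1 : 1 <= T.
  by rewrite /T -addrA lerDl addr_ge0 ?(ltW rho0) // sumr_ge0.
have ndT d a : `|d| <= rho -> `|nd d a| <= T.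
  move=> dr; rewrite (le_trans (ler_normD _ _)) // addrC /T; apply: lerD.
    by rewrite (le_trans (coord_le_norm d a)) // (le_trans dr) // lerDr.
  by rewrite (bigD1 a) //= lerDl sumr_ge0.
pose eta1 := eps / (M.+1%:R * T ^+ M.+1).
have T0 : 0 < T by rewrite (lt_le_trans _ T1).
have eta10 : 0 < eta1 by rewrite divr_gt0 // mulr_gt0 // exprn_gt0.
(* The inverse of sum 1 / w_a is at most every w_a; half of it keeps all [u a] positive, and the
   gradient argument cancels [u a]. *)
pose eta2 := (\sum_a (w a)^-1)^-1 / 2.
have sw0 : 0 < \sum_a (w a)^-1.
  by rewrite (bigD1 ord0) //= ltr_pwDl ?invr_gt0 // sumr_ge0 // => a _; rewrite invr_ge0 ltW.
have eta20 : 0 < eta2 by rewrite divr_gt0 // invr_gt0.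
have eta2w a : eta2 < w a.
  rewrite /eta2 ltr_pdivrMr // (@le_lt_trans _ _ (w a)) ?ltr_pMr ?ltr1n //.
  rewrite -[leRHS]invrK lef_pV2 ?posrE ?invr_gt0 // (bigD1 a) //= lerDl.
  by rewrite sumr_ge0 // => b _; rewrite invr_ge0 ltW.
exists (Num.min eta1 eta2); first by rewrite lt_min eta10.
move=> u uw.
have u0 a : 0 < u a.
  have := uw a; rewrite le_min => /andP[_ /(le_lt_trans)/(_ (eta2w a))].
  by rewrite ltr_norml => /andP[+ _]; rewrite ltrBrDr addrC subrr.
have Fu d r : `|d| <= rho -> `|F u d r - F w d r| <= eps.
  move=> dr; rewrite -sumrB (le_trans (ler_norm_sum _ _ _)) //.
  have -> : eps = \sum_(a < M.+1) eta1 * T ^+ M.+1.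
    rewrite sumr_const card_ord -mulr_natl mulrCA divfK //.
    by rewrite mulf_neq0 ?pnatr_eq0 // expf_neq0 // gt_eqF.
  apply: ler_sum => a _; rewrite -mulrBl normrM normrX ler_pM //.
    by have := uw a; rewrite le_min => /andP[].
  rewrite (@le_trans _ _ (T ^+ r.+1)) ?lerXn2r ?nnegrE ?ndT ?(ltW T0) //.
  by rewrite ler_weXn2l.
have [||d] := @compact_EVT_min _ _ (f u) _ _ (@compact_le_norm M.+1 rho).
- by exists 0 => /=; rewrite normr0 ltW.
- by apply: continuous_subspaceT => d; exact: cf.
rewrite inE /= => dr dmin.
have dlt : `|d| < rho.
  rewrite lt_neqAle dr andbT; apply/eqP => drE.
  have [r cr] := fc d drE.
  have := dmin 0; rewrite inE /= normr0 => /(_ (ltW rho0)); apply/negP; rewrite -ltNge.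
  have f0 : f u 0 <= M.+1%:R * eps ^+ 2.
    have -> : M.+1%:R * eps ^+ 2 = \sum_(r < M.+1) eps ^+ 2.
      by rewrite sumr_const card_ord mulr_natl.
    apply: ler_sum => s _.
    rewrite -real_normK ?num_real // lerXn2r ?nnegrE ?(ltW eps0) //.
    by apply: Fu; rewrite normr0 ltW.
  have fd : (c - eps) ^+ 2 <= f u d.
    rewrite /f (bigD1 r) //= ler_wpDr ?sumr_ge0 // => [s _|]; first exact: sqr_ge0.
    rewrite -[leRHS]real_normK ?num_real // lerXn2r ?nnegrE //.
      rewrite subr_ge0 -epsE ler_peMr ?ltW //.
      by move: M1; move: (M.+1%:R : R) => k k1; lra.
    rewrite lerBlDr (le_trans cr) //.
    have -> : F w d r - mu r = (F u d r - mu r) - (F u d r - F w d r) by ring.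
    by rewrite (le_trans (ler_normB _ _)) // lerD2l Fu.
  apply: (le_lt_trans f0); apply: (lt_le_trans _ fd).
  rewrite -epsE; have -> : eps * (3 * M.+1%:R) - eps = eps * (3 * M.+1%:R - 1) by ring.
  suff H : M.+1%:R < (3 * M.+1%:R - 1) ^+ 2 :> R.
    have -> : (eps * (3 * M.+1%:R - 1)) ^+ 2 = (3 * M.+1%:R - 1) ^+ 2 * eps ^+ 2 by ring.
    by rewrite ltr_pM2r ?exprn_gt0.
  move: M1; move: (M.+1%:R : R) => k k1.
  have k2 : 0 <= (k - 1) * k by rewrite mulr_ge0 ?subr_ge0 // (le_trans _ k1).
  rewrite expr2; lra.
have grad a : \sum_r (F u d r - mu r) * (nd d a ^+ r *+ r.+1) = 0.
  pose P (b : 'I_M.+1) : {poly R} := (nd d b)%:P + (if b == a then 'X else 0).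
  pose G (r : 'I_M.+1) : {poly R} := \sum_(b < M.+1) (u b)%:P * P b ^+ r.+1 - (mu r)%:P.
  pose p : {poly R} := \sum_(r < M.+1) G r ^+ 2.
  have GE r s : (G r).[s] = F u (d + s *: delta_mx ord0 a) r - mu r.
    rewrite hornerD hornerN hornerC horner_sum; congr (_ - _).
    apply: eq_bigr => b _; rewrite hornerM hornerC horner_exp; congr (_ * _ ^+ _).
    rewrite /P hornerD hornerC /nd !mxE eqxx /= -addrA; congr (_ + (_ + _)).
    by case: (b == a); rewrite ?hornerX ?horner0 ?mulr1 ?mulr0.
  have pE s : p.[s] = f u (d + s *: delta_mx ord0 a).
    by rewrite horner_sum; apply: eq_bigr => r _; rewrite horner_exp GE.
  have G1 r : (G r)^`().[0] = u a * (nd d a ^+ r *+ r.+1).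
    rewrite derivB derivC subr0 linear_sum (bigD1 a) //= big1 => [|b ba].
      rewrite addr0 derivM derivC mul0r add0r deriv_exp /P eqxx derivD derivC.
      rewrite derivX add0r mul1r hornerM hornerC hornerMn horner_exp.
      by rewrite hornerD hornerC hornerX addr0.
    rewrite /P (negPf ba) addr0 derivM derivC mul0r add0r.
    by rewrite deriv_exp derivC mul0r mul0rn mulr0.
  have : p^`().[0] = 0.
    apply: (@poly_local_min _ (rho - `|d|)); first by rewrite subr_gt0.
    move=> s sr; rewrite !pE scale0r addr0; apply: dmin; rewrite inE /=.
    rewrite (le_trans (ler_normD _ _)) // -lerBrDl normrZ.
    rewrite (le_trans _ (ltW sr)) // ler_piMr //.
    rewrite /Num.norm /= mx_normrE; apply/bigmax_leP; split => // i _.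
    by rewrite mxE; case: (_ && _); rewrite ?normr1 ?normr0.
  have -> : p^`().[0] = 2 * u a * \sum_r (F u d r - mu r) * (nd d a ^+ r *+ r.+1).
    rewrite linear_sum horner_sum mulr_sumr; apply: eq_bigr => r _.
    rewrite /= deriv_exp /= expr1 hornerMn hornerM GE G1 scale0r addr0 -mulr_natr.
    by ring.
  by move/eqP; rewrite mulf_eq0 mulf_eq0 pnatr_eq0 /= gt_eqF //= => /eqP.
have [_ D2] := Drho d dr.
pose g := \col_r (F u d r - mu r).
have Bg : B2 d *m g = 0.
  apply/colP => a; rewrite !mxE -[RHS](grad a); apply: eq_bigr => r _.
  by rewrite !mxE mulrC.
have g0 : g = 0.
  by rewrite -[g](@mulKmx _ _ _ (B2 d)) ?Bg ?mulmx0 // unitmxE unitfE.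
exists (nd d) => r; apply/eqP; rewrite -subr_eq0; apply/eqP.
transitivity (g r ord0); last by rewrite g0 mxE.
by rewrite mxE; congr (_ - _); apply: eq_bigr => a _; rewrite nd0.
Qed.
End Perturb.

End PerturbNodes.

(** The Gauss weights are rounded to multiples n_a / Q, the nodes are moved by [perturb_nodes] to
    restore the moments, and the node y_a is listed n_a times. All large Q are covered because Q is
    later taken prime. *)
Lemma equal_weight_nodes (R : realType) (K : nat) : exists Q0 : nat,
  forall Q, (Q0 <= Q)%N -> exists2 s : seq R, size s = Q &
    forall r, (r <= K)%N -> \sum_(y <- s) y ^+ r = Q%:R * (gmom r)%:R.
Proof.
have [M [x [w [KM xI w0 wx]]]] := gauss_quadrature R K.
case: M x w KM xI w0 wx => [|M] x w KM xI w0 wx.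
  by have /eqP := wx 0 isT; rewrite big_ord0 eq_sym oner_eq0.
have [eta eta0 pert] := perturb_nodes xI w0.
exists (Num.truncn (M.+2%:R / eta)).+1 => Q QQ.
have Qeta : M.+2%:R <= eta * Q%:R.
  rewrite mulrC -ler_pdivrMr //.
  have /andP[_ /ltW le1] := truncn_itv (divr_ge0 (ler0n R M.+2) (ltW eta0)).
  by rewrite (le_trans le1) // ler_nat.
have Q0 : 0 < Q%:R :> R by rewrite ltr0n (leq_trans _ QQ).
have sumw : \sum_a w a = 1.
  by rewrite -[RHS]/((gmom 0)%:R) -wx //; apply: eq_bigr => a _; rewrite expr0 mulr1.
pose N a := Num.truncn (Q%:R * w a).
have Nle a : (N a)%:R <= Q%:R * w a < (N a).+1%:R.
  by apply: truncn_itv; rewrite mulr_ge0 // ltW.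
have sumQw : \sum_a Q%:R * w a = Q%:R by rewrite -mulr_sumr sumw mulr1.
have sN1 : (\sum_a N a <= Q)%N.
  rewrite -(ler_nat R) natr_sum -[leRHS]sumQw; apply: ler_sum => a _.
  by have /andP[] := Nle a.
have sN2 : (Q - \sum_a N a <= M.+1)%N.
  rewrite leq_subLR -(ler_nat R) natrD natr_sum -[leLHS]sumQw.
  have -> : M.+1%:R = \sum_(a < M.+1) 1 :> R by rewrite sumr_const card_ord.
  rewrite -big_split; apply: ler_sum => a _ /=.
  by have /andP[_ /ltW] := Nle a; rewrite -natr1.
(* Rounding down loses at most M + 1 units, all given to the node [ord0]; each weight then errs by
   at most (M + 2) / Q <= eta. *)
pose n a := (N a + (if a == ord0 then Q - \sum_a N a else 0))%N.
have sn : (\sum_a n a)%N = Q.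
  by rewrite big_split /= -big_mkcond /= big_pred1_eq subnKC.
have un a : `|(n a)%:R / Q%:R - w a| <= eta.
  have -> : (n a)%:R / Q%:R - w a = ((n a)%:R - Q%:R * w a) / Q%:R.
    by rewrite mulrBl [Q%:R * _]mulrC mulfK // gt_eqF.
  rewrite normrM normfV [`|Q%:R|]gtr0_norm // ler_pdivrMr //.
  apply: le_trans Qeta; have /andP[N1 N2] := Nle a.
  have n2 : (n a)%:R <= (N a)%:R + M.+1%:R :> R.
    by rewrite /n -natrD ler_nat leq_add2l; case: ifP.
  have n1 : (N a)%:R <= (n a)%:R :> R by rewrite ler_nat leq_addr.
  rewrite -natr1 in N2; have M0 : (0 : R) <= M.+1%:R by [].
  rewrite -[M.+2%:R]natr1 ler_norml; apply/andP; split; lra.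
have [y yE] := pert _ un.
exists (flatten [seq nseq (n a) (y a) | a <- enum 'I_M.+1]).
  rewrite size_flatten /shape -map_comp sumnE big_map big_enum /= -[RHS]sn.
  by apply: eq_bigr => a _; rewrite /= size_nseq.
move=> r rK; rewrite big_flatten big_map big_enum /=.
under eq_bigr do rewrite big_nseq iter_addr_0 -mulr_natl.
have -> : \sum_a (n a)%:R * y a ^+ r = Q%:R * \sum_a (n a)%:R / Q%:R * y a ^+ r.
  rewrite mulr_sumr; apply: eq_bigr => a _.
  by rewrite mulrA mulrCA divff ?mulr1 // gt_eqF.
congr (_ * _); case: r rK => [|r] rK.
  under eq_bigr do rewrite expr0 mulr1.
  by rewrite -mulr_suml -natr_sum sn divff // gt_eqF.
have rM : (r < M.+1)%N by apply: leq_trans KM.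
rewrite -wx; last by apply: leq_trans KM.
exact: (yE (Ordinal rM)).
Qed.

(** * Designs with independent Gaussian-like coordinates *)

Section GilbertVarshamov.
Local Close Scope classical_set_scope.
Variables (p : nat) (p_pr : prime p) (m : nat).
Local Notation F := 'F_p.
Local Notation V := 'rV[F]_m.
Implicit Types (X : {set V}) (c : {ffun V -> F}).

Let supp X c : {set V} := [set v in X | c v != 0].

Definition sparse_free (K : nat) X := forall c, (#|supp X c| <= K)%N ->
  \sum_(v in X) c v *: v = 0 -> forall v, v \in X -> c v = 0.

(** Contains every combination of X with at most r nonzero coefficients; building it term by term
    makes the cardinality bound a product. *)
Fixpoint sparse_span (r : nat) X : {set V} :=
  if r is r'.+1 then
    [set b + q.1 *: q.2 | b in sparse_span r' X, q in finset.setX [set: F] (0 |: X)]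
  else [set 0].

Lemma sparse_span0 r X : 0 \in sparse_span r X.
Proof.
elim: r => [|r IH] /=; first by rewrite inE.
apply/imset2P; exists 0 (0, 0) => //; last by rewrite scaler0 addr0.
by rewrite !inE eqxx.
Qed.

Lemma sparse_spanP r X c : (#|supp X c| <= r)%N ->
  \sum_(v in X) c v *: v \in sparse_span r X.
Proof.
elim: r c => [|r IH] c sc.
  rewrite big1 ?sparse_span0 // => v vX.
  move: sc; rewrite leqn0 cards_eq0 => /eqP/setP/(_ v).
  by rewrite !inE vX /= => /negbFE/eqP ->; rewrite scale0r.
have [s0|[v0 v0s]] := set_0Vmem (supp X c).
  rewrite big1 ?sparse_span0 // => v vX.
  move/setP/(_ v): s0; rewrite !inE vX /= => /negbFE/eqP ->.
  by rewrite scale0r.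
have v0X : v0 \in X by move: v0s; rewrite inE => /andP[].
pose c' : {ffun V -> F} := [ffun v => if v == v0 then 0 else c v].
have sc' : (#|supp X c'| <= r)%N.
  rewrite -ltnS; apply: leq_trans sc.
  rewrite (cardsD1 v0 (supp X c)) v0s ltnS; apply: subset_leq_card.
  apply/fintype.subsetP => v; rewrite !inE ffunE.
  by case: (v == v0); rewrite ?eqxx ?andbF.
apply/imset2P; exists (\sum_(v in X) c' v *: v) (c v0, v0).
- exact: IH.
- by rewrite !inE v0X orbT.
- rewrite (bigD1 v0) //= addrC; congr (_ + _).
  rewrite [in RHS](bigD1 v0) //= ffunE eqxx scale0r add0r.
  by apply: eq_bigr => v /andP[_ vv]; rewrite ffunE (negPf vv).
Qed.

Lemma card_sparse_span r X : (#|sparse_span r X| <= (p * #|X|.+1) ^ r)%N.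
Proof.
elim: r => [|r IH] /=; first by rewrite cards1.
rewrite curry_imset2X (leq_trans (leq_imset_card _ _)) // !cardsX cardsT card_Fp //.
rewrite expnSr leq_mul // leq_mul2l.
by apply/orP; right; rewrite cardsU1 -[X in (_ <= X)%N]add1n leq_add2r leq_b1.
Qed.

(** A vector v outside the (K + 1)-sparse combinations of X cannot enter a dependence with at most K
    + 2 terms, since it could be solved for in terms of the others. *)
Lemma sparse_free_extend K X : sparse_free K.+2 X ->
  (#|sparse_span K.+1 X| < p ^ m)%N ->
  exists v, v \notin X /\ sparse_free K.+2 (v |: X).
Proof.
move=> fX sX.
have [v vn] : exists v : V, v \notin sparse_span K.+1 X.
  apply/existsP; rewrite -[[exists _, _]]negbK negb_exists; apply/negP => /forallP H.
  move: sX; rewrite ltnNge => /negP; apply.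
  have -> : (p ^ m)%N = #|{: V}| by rewrite card_mx card_Fp // mul1n.
  by apply/subset_leq_card/fintype.subsetP => v _; have := H v; rewrite negbK.
have vX : v \notin X.
  apply: contra vn => vX; apply/imset2P; exists 0 (1, v).
  - exact: sparse_span0.
  - by rewrite !inE vX orbT.
  - by rewrite scale1r add0r.
exists v; split => // c; rewrite big_setU1 //= => sc cv.
have [c0|c0] := eqVneq (c v) 0.
  move: cv; rewrite c0 scale0r add0r => cv w; rewrite !inE => /orP[/eqP->//|wX].
  apply: (fX c) => //; apply: leq_trans sc; apply/subset_leq_card.
  by apply/fintype.subsetP => u; rewrite !inE => /andP[-> ->]; rewrite orbT.
case/negP: vn.
pose c' : {ffun V -> F} := [ffun u => - (c v)^-1 * c u].
have -> : v = \sum_(u in X) c' u *: u.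
  under eq_bigr do rewrite ffunE -scalerA.
  rewrite -scaler_sumr scaleNr; move/eqP: cv; rewrite addr_eq0 => /eqP cv.
  by rewrite -scalerN -cv scalerA mulVf // scale1r.
apply: sparse_spanP; rewrite -ltnS; apply: leq_trans sc.
rewrite (cardsD1 v (supp (v |: X) c)) !inE eqxx c0 /= ltnS.
apply/subset_leq_card/fintype.subsetP => u; rewrite !inE ffunE mulf_eq0 oppr_eq0.
rewrite invr_eq0 (negPf c0) /= => /andP[uX ->]; rewrite uX orbT !andbT.
by apply: contraNneq vX => <-.
Qed.

Lemma gilbert_varshamov K n : ((p * n) ^ K.+1 < p ^ m)%N ->
  exists2 X : {set V}, #|X| = n & sparse_free K.+2 X.
Proof.
elim: n => [|n IH] pn.
  by exists finset.set0; rewrite ?cards0 // => c _ _ v; rewrite inE.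
have [|X Xn fX] := IH.
  by apply: leq_ltn_trans pn; rewrite leq_exp2r // leq_mul2l leqnSn orbT.
have [|v [vX fvX]] := sparse_free_extend fX.
  by apply: leq_ltn_trans pn; rewrite -Xn card_sparse_span.
by exists (v |: X) => //; rewrite cardsU1 vX Xn.
Qed.

Let bra (x z : V) : F := (x *m z^T) ord0 ord0.

(** Independence puts x0 outside the row space of [I], so some column of the cokernel of the matrix
    with rows [I] is nonzero on x0; rescaled, it is z. *)
Lemma sparse_free_dual K X (I : {set V}) x0 : sparse_free K.+1 X ->
  I \subset X -> x0 \in X -> x0 \notin I -> (#|I| <= K)%N ->
  exists z, bra x0 z = 1 /\ forall x, x \in I -> bra x z = 0.
Proof.
move=> fX /fintype.subsetP IX x0X x0I cI.
pose A : 'M[F]_(#|I|, m) := \matrix_(i < #|I|) enum_val i.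
have nA : ~~ (x0 <= A)%MS.
  apply/negP => /submxP[D x0E].
  pose c : {ffun V -> F} := [ffun v => if v == x0 then -1 else
    \sum_(i < #|I| | enum_val i == v) D ord0 i].
  have /eqP : c x0 = 0.
    apply: (fX c) => //.
      apply: (@leq_trans #|x0 |: I|); last first.
        by rewrite cardsU1 x0I.
      apply/subset_leq_card/fintype.subsetP => v; rewrite !inE ffunE.
      have [//|vx] := boolP (v == x0); move=> /andP[_ nz]; apply/negPn/negP => vI; case/eqP: nz.
      rewrite big1 // => i /eqP vi; case/negP: vI; rewrite -vi; exact: enum_valP.
    rewrite (bigD1 x0) //= {1}ffunE eqxx scaleN1r; apply/eqP.
    rewrite addrC subr_eq0 {2}x0E mulmx_sum_row; apply/eqP.
    transitivity (\sum_(v in I) c v *: v).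
      rewrite (bigID (mem I)) /= [X in _ + X]big1 ?addr0.
        apply: eq_bigl => v; rewrite andbC; case vI : (v \in I) => //=.
        by rewrite IX //=; apply: contraNneq x0I => <-.
      move=> v /andP[/andP[_ vx] vI]; rewrite ffunE (negPf vx) big1 ?scale0r //.
      by move=> i /eqP vi; case/negP: vI; rewrite -vi; exact: enum_valP.
    rewrite big_enum_val; apply: eq_bigr => i _; rewrite rowK; congr (_ *: _).
    rewrite ffunE; case: eqVneq => [ix|_].
      by case/negP: x0I; rewrite -ix; exact: enum_valP.
    by rewrite (big_pred1 i) // => j; apply/eqP/eqP => [/enum_val_inj|->].
  by rewrite ffunE eqxx oppr_eq0 oner_eq0.
have [j cj] : exists j, (x0 *m cokermx A) ord0 j != 0.
  move: nA; rewrite submxE => /rowV0Pn[v /submxP[D vE] v0].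
  apply/existsP; rewrite -[[exists _, _]]negbK negb_exists; apply/negP => /forallP H.
  case/eqP: v0; rewrite vE (_ : x0 *m _ = 0) ?mulmx0 //.
  by apply/rowP => k; have /negPn/eqP -> := H k; rewrite mxE.
pose z := ((x0 *m cokermx A) ord0 j)^-1 *: (col j (cokermx A))^T.
have braE x : bra x z = ((x0 *m cokermx A) ord0 j)^-1 * (x *m cokermx A) ord0 j.
  rewrite /bra /z linearZ /= trmxK -scalemxAr mxE; congr (_ * _).
  by rewrite !mxE; apply: eq_bigr => k _; rewrite mxE.
exists z; split; first by rewrite braE mulVf.
move=> x xI; rewrite braE.
have -> : x = row (enum_rank_in xI x) A by rewrite rowK enum_rankK_in.
by rewrite -row_mul mulmx_coker !mxE mulr0.
Qed.

End GilbertVarshamov.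

Section IndependentFamily.
Local Close Scope classical_set_scope.

Lemma gv_dual_family (p K n : nat) : prime p -> (0 < n)%N ->
  exists m (h : 'I_n -> 'rV['F_p]_m), (p ^ m <= p ^ K.+2 * n ^ K.+1)%N /\
    forall (I : {set 'I_n}) i0, i0 \notin I -> (#|I| <= K.+1)%N ->
    exists z : 'rV['F_p]_m, (h i0 *m z^T) ord0 ord0 = 1 /\
      forall i, i \in I -> (h i *m z^T) ord0 ord0 = 0.
Proof.
move=> p_pr n0; pose B := ((p * n) ^ K.+1)%N.
have B0 : (0 < B)%N by rewrite expn_gt0 muln_gt0 prime_gt0 // n0.
have /andP[lB uB] := trunc_log_bounds (prime_gt1 p_pr) B0.
have [X Xn fX] := gilbert_varshamov p_pr uB.
pose g (i : 'I_n) := enum_val (cast_ord (esym Xn) i).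
have gI : injective g by move=> i j /enum_val_inj/cast_ord_inj.
(* The least m with p^m > (p n)^(K + 1), so that p^m <= p (p n)^(K + 1). *)
exists (trunc_log p B).+1, g; split.
  rewrite expnS (expnS p) -mulnA leq_mul2l -expnMn; apply/orP; right; exact: lB.
move=> I i0 i0I cI.
have [||||z [z1 z0]] := sparse_free_dual (I := g @: I) (x0 := g i0) fX.
- by apply/fintype.subsetP => _ /imsetP[i _ ->]; exact: enum_valP.
- exact: enum_valP.
- by rewrite mem_imset.
- by rewrite card_imset.
- by exists z; split => // i iI; apply: z0; rewrite mem_imset.
Qed.

End IndependentFamily.

Lemma gmom_odd j : odd j -> gmom j = 0%N.
Proof.
elim/ltn_ind: j => -[|[|j]] // IH /=; rewrite negbK => oj.
by rewrite IH ?muln0.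
Qed.

Lemma gmom_double h : (gmom h.*2 * (2 ^ h * h`!) = (h.*2)`!)%N.
Proof.
elim: h => [|h IH] //.
rewrite doubleS gmomSS (factS h.*2.+1) (factS h.*2) -IH (factS h) expnS -mul2n; ring.
Qed.

Lemma gmom_bin h l : (l <= h)%N ->
  ('C(h.*2, l.*2) * (gmom (h.*2 - l.*2) * gmom l.*2) = gmom h.*2 * 'C(h, l))%N.
Proof.
move=> lh; rewrite -doubleB.
have pos i : (0 < 2 ^ i * i`!)%N by rewrite muln_gt0 expn_gt0 fact_gt0.
apply/eqP; rewrite -(eqn_pmul2r (pos l)) -(eqn_pmul2r (pos (h - l)%N)); apply/eqP.
have l2h : (l.*2 <= h.*2)%N by rewrite leq_double.
transitivity ((h.*2)`!).
  rewrite -(bin_fact l2h) -doubleB -(gmom_double l) -(gmom_double (h - l)); ring.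
have e2 : (2 ^ h = 2 ^ l * 2 ^ (h - l))%N by rewrite -expnD subnKC.
rewrite -(gmom_double h) -(bin_fact lh) e2; ring.
Qed.

Lemma gmom_gt0 h : (0 < gmom h.*2)%N.
Proof. by elim: h => [|h IH] //; rewrite doubleS gmomSS muln_gt0. Qed.

Lemma sum_even_terms (R : nmodType) (F : nat -> R) h :
  (forall i, odd i -> F i = 0) ->
  \sum_(i < h.*2.+1) F i = \sum_(l < h.+1) F l.*2.
Proof.
move=> F0; elim: h => [|h IH]; first by rewrite !big_ord1.
rewrite doubleS big_ord_recr big_ord_recr /= IH [in RHS]big_ord_recr /=.
by rewrite (F0 h.*2.+1) ?addr0 //= odd_double.
Qed.

(** Independent centred Gaussians add their variances: both sides are formally the j-th moment of a
    g + sqrt(s) g'. Where [i./2] truncates, i is odd and [gmom i] is 0. *)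
Lemma gmom_convolution (R : comNzRingType) (a s : R) j :
  \sum_(i < j.+1) (a ^+ (j - i) * (gmom (j - i))%:R) *
     ((gmom i)%:R * s ^+ i./2) *+ 'C(j, i) =
  (gmom j)%:R * (a ^+ 2 + s) ^+ j./2.
Proof.
have [oj|ej] := boolP (odd j).
  rewrite (gmom_odd oj) mul0r big1 // => i _.
  have [oi|ei] := boolP (odd i).
    by rewrite (gmom_odd oi) mul0r mulr0 mul0rn.
  rewrite (@gmom_odd (j - i)) ?mulr0 ?mul0r ?mul0rn // oddB ?oj ?(negPf ei) //.
  by rewrite -ltnS.
rewrite -(even_halfK ej); move: j./2 => h {ej}.
rewrite (@sum_even_terms _ (fun i => (a ^+ (h.*2 - i) * (gmom (h.*2 - i))%:R) *
     ((gmom i)%:R * s ^+ i./2) *+ 'C(h.*2, i))); last first.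
  by move=> i oi; rewrite (gmom_odd oi) mul0r mulr0 mul0rn.
rewrite doubleK exprDn mulr_sumr; apply: eq_bigr => l _.
have lh : (l <= h)%N by rewrite -ltnS.
have key : ('C(h.*2, l.*2))%:R * ((gmom (h.*2 - l.*2))%:R * (gmom l.*2)%:R) =
    (gmom h.*2)%:R * ('C(h, l))%:R :> R by rewrite -!natrM gmom_bin.
rewrite doubleK -[LHS]mulr_natr -[X in _ = _ * X]mulr_natr.
transitivity ((gmom h.*2)%:R * ('C(h, l))%:R * (a ^+ (h.*2 - l.*2) * s ^+ l)).
  by rewrite -key; ring.
by rewrite -[a ^+ 2 ^+ _]exprM mul2n doubleB; ring.
Qed.

Section Design.
Variables (R : realType) (p K m n : nat) (t : 'F_p -> R) (h : 'I_n -> 'rV['F_p]_m).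
Hypothesis p_pr : prime p.
Hypothesis t_mom : forall r, (r <= K)%N ->
  \sum_c t c ^+ r = p%:R * (gmom r)%:R.
Hypothesis h_dual : forall (I : {set 'I_n}) i0, i0 \notin I -> (#|I| < K)%N ->
  exists z : 'rV['F_p]_m, (h i0 *m z^T) ord0 ord0 = 1 /\
    forall i, i \in I -> (h i *m z^T) ord0 ord0 = 0.

Let V := 'rV['F_p]_m.
Let bra (u : V) (i : 'I_n) := (h i *m u^T) ord0 ord0.
Let y (u : V) (i : 'I_n) : R := t (bra u i).

Let braD u c z i : bra (u + c *: z) i = bra u i + c * bra z i.
Proof. by rewrite /bra linearD linearZ /= mulmxDr -scalemxAr !mxE. Qed.

(* Translating u along a vector dual to h i0 moves the symbol of i0 alone. *)
Let factor_one i0 (I : {set 'I_n}) l (G : V -> R) :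
  i0 \notin I -> (#|I| < K)%N -> (l <= K)%N ->
  (forall u v, (forall i, i \in I -> bra u i = bra v i) -> G u = G v) ->
  \sum_u y u i0 ^+ l * G u = (gmom l)%:R * \sum_u G u.
Proof.
move=> i0I cI lK GI; have [z [z1 z0]] := h_dual i0I cI.
have p0 : p%:R != 0 :> R by rewrite pnatr_eq0 -lt0n prime_gt0.
apply: (mulfI p0); rewrite mulrA -t_mom // big_distrlr /= exchange_big /=.
have -> : p%:R * \sum_u y u i0 ^+ l * G u =
    \sum_(c : 'F_p) \sum_u y u i0 ^+ l * G u.
  by rewrite sumr_const card_Fp // mulr_natl.
rewrite [RHS]exchange_big /=.
transitivity (\sum_(c : 'F_p) \sum_u t (bra u i0 + c) ^+ l * G u).
  apply: eq_bigr => c _; rewrite (reindex_inj (addIr (c *: z))) /=.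
  apply: eq_bigr => u _; rewrite /y braD /bra z1 mulr1; congr (_ * _).
  by apply: GI => i iI; rewrite braD /bra z0 // mulr0 addr0.
rewrite exchange_big [RHS]exchange_big /=; apply: eq_bigr => u _.
by rewrite [RHS](reindex_inj (addrI (bra u i0))).
Qed.

Let factor_sum i0 (A : {set 'I_n}) (a : 'I_n -> R) l j :
  i0 \notin A -> (l + j <= K)%N ->
  \sum_u y u i0 ^+ l * (\sum_(i in A) a i * y u i) ^+ j =
  (gmom l)%:R * \sum_u (\sum_(i in A) a i * y u i) ^+ j.
Proof.
(* For l = 0 there is nothing to factor out; l >= 1 forces j < K, so the at most j indices of a
   monomial meet the bound of [h_dual]. *)
move=> i0A; case: l => [|l] ljK.
  by rewrite mul1r; apply: eq_bigr => u _; rewrite expr0 mul1r.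
have expand u : (\sum_(i in A) a i * y u i) ^+ j =
    \sum_(f in ffun_on (mem A)) \prod_(q < j) (a (f q) * y u (f q)).
  transitivity (\prod_(q < j) \sum_(i in A) a i * y u i).
    by rewrite prodr_const card_ord.
  exact: (bigA_distr_big (mem A) (fun _ i => a i * y u i)).
under eq_bigr do rewrite expand mulr_sumr.
under [in RHS]eq_bigr do rewrite expand.
rewrite exchange_big [in RHS]exchange_big mulr_sumr /=.
apply: eq_bigr => f /ffun_onP fA.
apply: (factor_one (I := [set f q | q in 'I_j])%SET).
- by apply/negP => /imsetP[q _ i0q]; move: i0A; rewrite i0q fA.
- rewrite (leq_ltn_trans (leq_imset_card _ _)) // card_ord; lia.
- lia.
- move=> u v uv; apply: eq_bigr => q _; congr (_ * t _).
  by apply: uv; apply/imsetP; exists q.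
Qed.

(** Up to order K the coordinates of y behave as independent standard Gaussians, so <a, y> has the
    moments of a Gaussian of variance |a|^2. Coordinates are split off one by one through
    [gmom_convolution]. *)
Lemma linear_form_moments (A : {set 'I_n}) (a : 'I_n -> R) j : (j <= K)%N ->
  \sum_u (\sum_(i in A) a i * y u i) ^+ j =
  (p ^ m)%:R * ((gmom j)%:R * (\sum_(i in A) a i ^+ 2) ^+ j./2).
Proof.
have [k] := ubnP #|A|; elim: k A j => // k IH A j Ak jK.
have cV : #|{: V}| = (p ^ m)%N by rewrite card_mx card_Fp // mul1n.
have [->|[i0 i0A]] := set_0Vmem A.
  under eq_bigr do rewrite big_set0.
  rewrite big_set0 sumr_const cV -[LHS]mulr_natl; congr (_ * _).
  case: j jK => [|[|j]] _; rewrite ?expr0 ?mulr1 ?mul0r ?expr0n //=.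
  by rewrite mulr0.
pose B := (A :\ i0)%SET.
have Bk : (#|B| < k)%N by move: Ak; rewrite (cardsD1 i0 A) i0A.
have i0B : i0 \notin B by rewrite !inE eqxx.
under eq_bigr do rewrite (big_setD1 i0) //= exprDn.
rewrite exchange_big (big_setD1 i0) //= -gmom_convolution mulr_sumr.
apply: eq_bigr => i _; have ij : (i <= j)%N by rewrite -ltnS.
rewrite sumrMnl [RHS]mulrnAr; congr (_ *+ _).
transitivity (a i0 ^+ (j - i) *
    \sum_u y u i0 ^+ (j - i) * (\sum_(i1 in B) a i1 * y u i1) ^+ i).
  by rewrite mulr_sumr; apply: eq_bigr => u _; rewrite exprMn mulrA.
rewrite factor_sum //; last by rewrite subnK.
rewrite IH //; last exact: leq_trans ij jK.
by rewrite -/B; ring.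
Qed.

End Design.

(** The identity of degree 2 is recorded as well: it gives sum |y_u|^2 = n #|Om|, from which the
    growth of sum |y_u|^(2k) is derived. *)
Lemma gaussian_design (R : realType) (k : nat) : (0 < k)%N ->
  exists2 C : nat, (0 < C)%N & forall n, (0 < n)%N ->
  exists (Om : finType) (y : Om -> 'rV[R]_n),
    [/\ (0 < #|Om| <= C * n ^ (k.*2.-1))%N,
     forall a : 'rV[R]_n, \sum_u dot a (y u) ^+ 2 = #|Om|%:R * dot a a &
     forall a : 'rV[R]_n, \sum_u dot a (y u) ^+ k.*2 =
       #|Om|%:R * ((gmom k.*2)%:R * dot a a ^+ k)].
Proof.
case: k => // k _; rewrite doubleS.
have [Q0 HQ] := equal_weight_nodes R k.*2.+2.
(* The prime depends on k only, hence so does the constant chosen below. *)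
have [p pQ p_pr] := prime_above Q0.
have [s sp sE] := HQ p (ltnW pQ).
pose t (c : 'F_p) := s`_(enum_rank c).
have t_mom r : (r <= k.*2.+2)%N -> \sum_c t c ^+ r = p%:R * (gmom r)%:R.
  move=> rk; rewrite -sE // [RHS](big_nth 0) sp big_mkord.
  have cF : #|{: 'F_p}| = p by rewrite card_Fp.
  rewrite (reindex (fun i : 'I_p => enum_val (cast_ord (esym cF) i))) /=; last first.
    exists (fun c => cast_ord cF (enum_rank c)) => i _.
      by rewrite enum_valK cast_ordKV.
    by rewrite cast_ordK enum_rankK.
  by apply: eq_bigr => i _; rewrite /t enum_valK.
exists (p ^ k.*2.+2)%N; first by rewrite expn_gt0 prime_gt0.
move=> n n0; have [m [h [pm hd]]] := gv_dual_family k.*2 p_pr n0.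
exists 'rV['F_p]_m, (fun u => \row_i t ((h i *m u^T) ord0 ord0)).
have cV : #|{: 'rV['F_p]_m}| = (p ^ m)%N by rewrite card_mx card_Fp // mul1n.
have dE (a : 'rV[R]_n) : dot a a = \sum_(i in [set: 'I_n]%SET) a ord0 i ^+ 2.
  by apply: eq_big => i; rewrite ?inE // expr2.
have lfm (a : 'rV[R]_n) := linear_form_moments p_pr t_mom hd [set: 'I_n]%SET (a ord0).
have dot_y (a : 'rV[R]_n) (u : 'rV['F_p]_m) :
    dot a (\row_i t ((h i *m u^T) ord0 ord0)) =
    \sum_(i in [set: 'I_n]%SET) a ord0 i * t ((h i *m u^T) ord0 ord0).
  by apply: eq_big => i; rewrite ?inE // mxE.
split=> [|a|a].
- by rewrite cV expn_gt0 prime_gt0 //= pm.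
- rewrite cV dE; under eq_bigr do rewrite dot_y.
  by rewrite lfm //= mul1r.
rewrite cV dE; under eq_bigr do rewrite dot_y.
by rewrite lfm // -doubleS doubleK.
Qed.
(** * Polynomial functions and spherical means *)

Section Polarization.
Local Close Scope classical_set_scope.
Variables (R : comNzRingType) (d : nat) (l : 'I_d -> R).

(** Inclusion-exclusion: the sum expands the product over i of 1 - [i is not a value of f], which is
    1 if f is onto, equivalently injective, and 0 otherwise. *)
Let signed_supersets (f : {ffun 'I_d -> 'I_d}) :
  \sum_(S : {set 'I_d} | f \in ffun_on (mem S)) (-1) ^+ #|~: S| =
  (if injectiveb f then 1 else 0) :> R.
Proof.
have -> : (if injectiveb f then 1 else 0) =
    \prod_(i : 'I_d) (1 + (if i \in f @: [set: 'I_d] then 0 else -1)) :> R.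
  case: ifPn => [/injectiveP fI|fNI].
    rewrite big1 // => i _; rewrite ifT ?addr0 //.
    have /eqP -> : f @: [set: 'I_d] == [set: 'I_d].
      by rewrite eqEcard finset.subsetT card_imset //= leqnn.
    by rewrite inE.
  have : f @: [set: 'I_d] != [set: 'I_d].
    apply: contra fNI => /eqP fT; apply/injectiveP.
    have /imset_injP fI : #|f @: [set: 'I_d]| == #|[set: 'I_d]| by rewrite fT.
    by move=> i j; apply: fI; rewrite inE.
  rewrite -finset.subTset => /subsetPn[i _ ifi].
  by rewrite (bigD1 i) //= (negPf ifi) addrN mul0r.
rewrite bigA_distr big_mkcond; apply: eq_bigr => S _.
case: ifPn => [fS|fnS].
  rewrite (bigID (mem S)) /= big1 => [|i -> //]; rewrite mul1r.
  rewrite (eq_bigr (fun=> -1)) => [|i iS]; last first.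
    rewrite (negPf iS) ifF //; apply/negP => /imsetP[j _ ij].
    by move/ffun_onP/(_ j): fS; rewrite /= -ij (negPf iS).
  by rewrite prodr_const; congr (_ ^+ _); apply: eq_card => i; rewrite !inE.
have /existsP[i fi] : [exists i, f i \notin S].
  rewrite -negb_forall; apply: contra fnS => /forallP fS.
  by apply/ffun_onP => i; exact: fS.
by rewrite (bigD1 (f i)) //= (negPf fi) imset_f ?inE // mul0r.
Qed.

(** Expanding the powers over maps f of the index set to itself, the signs leave only the d!
    permutations. *)
Lemma polarization :
  \sum_(S : {set 'I_d}) (-1) ^+ #|~: S| * (\sum_(j in S) l j) ^+ d =
  d`!%:R * \prod_j l j.
Proof.
have expand (S : {set 'I_d}) : (\sum_(j in S) l j) ^+ d =
    \sum_(f in ffun_on (mem S)) \prod_(q < d) l (f q).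
  transitivity (\prod_(q < d) \sum_(j in S) l j).
    by rewrite prodr_const card_ord.
  exact: (bigA_distr_big (mem S) (fun _ i => l i)).
under [LHS]eq_bigr do rewrite expand mulr_sumr.
rewrite (exchange_big_dep xpredT) //=.
under [LHS]eq_bigr do rewrite -mulr_suml signed_supersets.
rewrite (bigID (fun f : {ffun 'I_d -> 'I_d} => injectiveb f)) /=.
rewrite [X in _ + X]big1 ?addr0 => [|f /negPf ->]; last by rewrite mul0r.
rewrite (eq_bigr (fun=> \prod_j l j)) => [|f fI]; last first.
  rewrite fI mul1r; move/injectiveP: fI => fI.
  by rewrite [RHS](reindex_inj fI).
rewrite sumr_const -[LHS]mulr_natl; congr (_%:R * _).
have := card_inj_ffuns 'I_d 'I_d; rewrite card_ord ffactnn => <-.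
by apply: eq_card => f; rewrite !inE.
Qed.

End Polarization.

Section ListMonomials.
Variables (R : realType) (n : nat).
Local Notation vec := (borelRn R n).

(** Monomials as lists of indices: the degree is the length, multiplication by x_i^2 adds two heads,
    and polarization applies to the factors as they stand. *)
Definition lmono (s : seq 'I_n) (x : 'rV[R]_n) : R := \prod_(i <- s) x ord0 i.

Definition polyfun (d : nat) (f : 'rV[R]_n -> R) : Prop :=
  exists2 p : mpoly.mpoly n R, (mpoly.msize p <= d.+1)%N &
    forall x : 'rV[R]_n, f x = peval p (x : vec).

Lemma polyfun_ext d f g : f =1 g -> polyfun d f -> polyfun d g.
Proof. by move=> fg [p pd pE]; exists p => // x; rewrite -fg. Qed.

Lemma polyfun_leq d e f : (d <= e)%N -> polyfun d f -> polyfun e f.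
Proof. by move=> de [p pd pE]; exists p => //; apply: leq_trans pd _. Qed.

Lemma polyfun_const d c : polyfun d (fun _ => c).
Proof.
exists (mpoly.mpolyC n c); last by move=> x; rewrite /peval mpoly.mevalC.
have := mpoly.msizeZ_le (1 : mpoly.mpoly n R) c.
rewrite mpoly.msize1 -mpoly.mul_mpolyC mulr1 => h.
exact: leq_trans h _.
Qed.

Lemma polyfun_coord i : polyfun 1 (fun x => x ord0 i).
Proof.
exists (mpoly.mpolyX R (mpoly.mnm1 i)); first by rewrite mpoly.msizeX mpoly.mdeg1.
by move=> x; rewrite /peval mpoly.mevalXU.
Qed.

Lemma polyfun_mul d e f g : polyfun d f -> polyfun e g ->
  polyfun (d + e) (fun x => f x * g x).
Proof.
move=> [p pd pE] [q qe qE]; exists (p * q); last first.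
  by move=> x; rewrite /peval mpoly.mevalM pE qE.
have [->|p0] := eqVneq p 0; first by rewrite mul0r mpoly.msize0.
have [->|q0] := eqVneq q 0; first by rewrite mulr0 mpoly.msize0.
rewrite mpoly.msizeM //; move: (mpoly.mmeasure _ p) (mpoly.mmeasure _ q) pd qe.
by move=> a b; lia.
Qed.

Lemma polyfun_add d f g : polyfun d f -> polyfun d g ->
  polyfun d (fun x => f x + g x).
Proof.
move=> [p pd pE] [q qd qE]; exists (p + q); last first.
  by move=> x; rewrite /peval mpoly.mevalD pE qE.
by apply: leq_trans (mpoly.msizeD_le p q) _; rewrite geq_max pd qd.
Qed.

Lemma polyfun_scale d c f : polyfun d f -> polyfun d (fun x => c * f x).
Proof.
move=> pf; have := polyfun_mul (polyfun_const 0 c) pf.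
by rewrite add0n.
Qed.

Lemma polyfun_sum (I : Type) (r : seq I) (P : pred I) d (F : I -> 'rV[R]_n -> R) :
  (forall i, P i -> polyfun d (F i)) ->
  polyfun d (fun x => \sum_(i <- r | P i) F i x).
Proof.
move=> PF; elim: r => [|i r IH].
  by apply: polyfun_ext (polyfun_const d 0) => x; rewrite big_nil.
case Pi : (P i); last by apply: polyfun_ext IH => x; rewrite big_cons Pi.
by apply: polyfun_ext (polyfun_add (PF i Pi) IH) => x; rewrite big_cons Pi.
Qed.

Lemma polyfun_prod (I : Type) (r : seq I) d (F : I -> 'rV[R]_n -> R) :
  (forall i, polyfun d (F i)) ->
  polyfun (size r * d) (fun x => \prod_(i <- r) F i x).
Proof.
move=> PF; elim: r => [|i r IH].
  by apply: polyfun_ext (polyfun_const _ 1) => x; rewrite big_nil.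
by apply: polyfun_ext (polyfun_mul (PF i) IH) => x; rewrite big_cons.
Qed.

Lemma polyfun_exp d f m : polyfun d f -> polyfun (m * d) (fun x => f x ^+ m).
Proof.
move=> pf; have := polyfun_prod (iota 0 m) (fun _ => pf).
rewrite size_iota; apply: polyfun_ext => x.
by rewrite big_const_seq count_predT size_iota iter_mulr_1.
Qed.

Lemma polyfun_lmono s : polyfun (size s) (lmono s).
Proof. by have := polyfun_prod s (fun i => polyfun_coord i); rewrite muln1. Qed.

Lemma polyfun_lmono_decomp d f : polyfun d f ->
  exists r : seq (R * seq 'I_n), all (fun q => size q.2 <= d)%N r /\
    forall x, f x = \sum_(q <- r) q.1 * lmono q.2 x.
Proof.
move=> [p pd pE].
pose sq (m : mpoly.multinom n) : seq 'I_n :=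
  flatten [seq nseq (m i) i | i <- enum 'I_n].
exists [seq (mpoly.mcoeff m p, sq m) | m <- mpoly.msupp p]; split.
  apply/allP => _ /mapP[m mp ->] /=.
  have := leq_trans (mpoly.msize_mdeg_lt mp) pd; rewrite ltnS.
  rewrite mpoly.mdegE; apply: leq_trans.
  rewrite size_flatten /shape -map_comp sumnE big_map big_enum /=.
  by apply: leq_sum => i _; rewrite size_nseq.
move=> x; rewrite pE /peval mpoly.mevalE [RHS]big_map; apply: eq_bigr => m _ /=.
congr (_ * _); rewrite /lmono big_flatten big_map big_enum /=.
by apply: eq_bigr => i _; rewrite big_nseq iter_mulr_1.
Qed.

Lemma polyfun_mulmx d f (Q : 'M[R]_n) : polyfun d f -> polyfun d (fun x => f (x *m Q)).
Proof.
move=> /polyfun_lmono_decomp[r [/allP rd fE]].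
apply: polyfun_ext (fun x => \sum_(q <- r) q.1 * lmono q.2 (x *m Q)) _ _ _.
  by move=> x; rewrite fE.
rewrite [X in polyfun _ X](_ : _ = fun x =>
  \sum_(q <- r | q \in r) q.1 * lmono q.2 (x *m Q)); last first.
  by apply/funext => x; rewrite big_seq.
apply: polyfun_sum => q /rd qd; apply: polyfun_scale; apply: polyfun_leq qd _.
rewrite -[size q.2]muln1; apply: polyfun_prod => i.
apply: polyfun_ext (polyfun_sum (index_enum 'I_n) (P := xpredT)
  (F := fun j x => Q j i * x ord0 j) _).
  by move=> x; rewrite mxE; apply: eq_bigr => j _; rewrite mulrC.
by move=> j _; apply: polyfun_scale; exact: polyfun_coord.
Qed.

Lemma polyfun_dot (a : 'rV[R]_n) : polyfun 1 (fun x => dot a x).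
Proof. by apply: polyfun_sum => i _; apply: polyfun_scale; exact: polyfun_coord. Qed.

Lemma continuous_polyfun d f : polyfun d f -> continuous f.
Proof.
move=> /polyfun_lmono_decomp[r [_ fE]]; rewrite (funext fE).
apply: continuous_sum => q _; apply: continuous_mul; first exact: continuous_const.
by apply: continuous_prod => i _; exact: coord_continuous.
Qed.

End ListMonomials.

Section SphereIntegral.
Variables (R : realType) (n : nat).
Local Notation vec := (borelRn R n).
Implicit Types (nu : probability vec R) (f g : 'rV[R]_n -> R).

Lemma continuous_dot (T : topologicalType) (u v : T -> 'rV[R]_n) :
  (forall i, continuous (fun t => u t ord0 i)) ->
  (forall i, continuous (fun t => v t ord0 i)) ->
  continuous (fun t => dot (u t) (v t)).
Proof. by move=> cu cv; apply: continuous_sum => i _; exact: continuous_mul. Qed.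

Lemma closed_sphere : closed (sphere : set 'rV[R]_n).
Proof.
rewrite (_ : sphere = (fun x : 'rV[R]_n => dot x x) @^-1` [set r | r = 1]) //.
apply: closed_comp; last exact: closed_eq.
by move=> x _; apply: continuous_dot => i; exact: coord_continuous.
Qed.

Lemma compact_sphere : compact (sphere : set 'rV[R]_n).
Proof.
apply: (subclosed_compact closed_sphere (@compact_le_norm R n 1)) => x /= x1.
rewrite /Num.norm /= mx_normrE; apply/bigmax_leP; split => // -[i j] _ /=.
rewrite ord1 -(@expr_le1 _ 2) // real_normK ?num_real //.
rewrite -[leRHS]x1 /dot (bigD1 j) //= expr2 lerDl sumr_ge0 // => k _.
by rewrite -expr2 sqr_ge0.
Qed.

Lemma open_measurable_borelRn (A : set 'rV[R]_n) : open A -> measurable (A : set vec).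
Proof. by move=> oA; exact: sub_sigma_algebra. Qed.

Lemma closed_measurable_borelRn (A : set 'rV[R]_n) :
  closed A -> measurable (A : set vec).
Proof.
move=> cA; rewrite -[A]setCK; apply: measurableC.
by apply: open_measurable_borelRn; exact: closed_openC.
Qed.

Lemma measurable_sphere : measurable (sphere : set vec).
Proof. exact: closed_measurable_borelRn closed_sphere. Qed.

Lemma measurable_point (x : vec) : measurable [set x].
Proof.
apply: (closed_measurable_borelRn (A := [set (x : 'rV[R]_n)])).
by apply: accessible_closed_set1; exact/hausdorff_accessible/norm_hausdorff.
Qed.

Lemma continuous_measurable_borelRn f : continuous f ->
  measurable_fun [set: vec] (f : vec -> R).
Proof.
move=> /continuousP cf; apply: (measurability _ (RGenOpens.measurableE R)) => //.
move=> _ [_ [a [b ->]] <-]; rewrite setTI.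
by apply: open_measurable_borelRn; apply: cf; exact: interval_open.
Qed.

Lemma continuous_integrable_sphere nu f : continuous f ->
  nu.-integrable sphere (EFin \o (f : vec -> R)).
Proof.
move=> cf; apply: measurable_bounded_integrable.
- exact: measurable_sphere.
- by rewrite (le_lt_trans (probability_le1 nu measurable_sphere)) // ltry.
- exact: measurable_funTS (continuous_measurable_borelRn cf).
- have : compact (f @` (sphere : set 'rV[R]_n)).
    by apply: continuous_compact compact_sphere; exact: continuous_subspaceT.
  move=> /compact_bounded[M [Mr MP]]; exists M; split => // M' MM' x xS /=.
  by apply: (MP _ MM'); exists x.
Qed.

Definition smean nu f : R := Rintegral nu sphere (f : vec -> R).

Lemma smean_integral nu f : continuous f ->
  (\int[nu]_(x in sphere) (f x)%:E)%E = (smean nu f)%:E.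
Proof.
move=> cf; rewrite /smean /Rintegral fineK //.
by apply: integrable_fin_num; [exact: measurable_sphere|exact: continuous_integrable_sphere].
Qed.

Lemma smeanD nu f g : continuous f -> continuous g ->
  smean nu (fun x => f x + g x) = smean nu f + smean nu g.
Proof.
move=> cf cg; apply: RintegralD; first exact: measurable_sphere.
  exact: continuous_integrable_sphere.
exact: continuous_integrable_sphere.
Qed.

Lemma smeanZ nu c f : continuous f -> smean nu (fun x => c * f x) = c * smean nu f.
Proof.
move=> cf; apply: RintegralZl; first exact: measurable_sphere.
exact: continuous_integrable_sphere.
Qed.

Lemma smean_cst nu c : nu sphere = 1%E -> smean nu (fun=> c) = c.
Proof.
move=> n1; rewrite /smean (Rintegral_cst _ measurable_sphere) -[RHS]mulr1.
by congr (_ * _); exact: (congr1 fine n1).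
Qed.

Lemma smean0 nu : smean nu (fun=> 0) = 0.
Proof. by rewrite /smean (Rintegral_cst _ measurable_sphere) mul0r. Qed.

Lemma smean_sum nu (I : Type) (r : seq I) (F : I -> 'rV[R]_n -> R) :
  (forall i, continuous (F i)) ->
  smean nu (fun x => \sum_(i <- r) F i x) = \sum_(i <- r) smean nu (F i).
Proof.
move=> cF; elim: r => [|i r IH].
  by rewrite big_nil -[RHS](smean0 nu); congr smean; apply/funext => x; rewrite big_nil.
rewrite big_cons -IH -smeanD //; last by apply: continuous_sum.
by congr smean; apply/funext => x; rewrite big_cons.
Qed.

Lemma smean_ge0 nu f : (forall x, dot x x = 1 -> 0 <= f x) -> 0 <= smean nu f.
Proof. by move=> f0; apply: Rintegral_ge0 => x xS; exact: f0. Qed.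

Lemma smean_le nu f g : continuous f -> continuous g ->
  (forall x, dot x x = 1 -> f x <= g x) -> smean nu f <= smean nu g.
Proof.
move=> cf cg fg; apply: le_Rintegral => //; first exact: measurable_sphere.
- exact: continuous_integrable_sphere.
- exact: continuous_integrable_sphere.
Qed.

Lemma smean_eq nu f g : (forall x, dot x x = 1 -> f x = g x) -> smean nu f = smean nu g.
Proof. by move=> fg; apply: eq_Rintegral => x; rewrite inE => xS; exact: fg. Qed.

Lemma smean_atom nu f x : continuous f -> (forall x, dot x x = 1 -> 0 <= f x) ->
  dot x x = 1 -> fine (nu [set (x : vec)]) * f x <= smean nu f.
Proof.
move=> cf f0 x1.
have fx : (nu [set (x : vec)] \is a fin_num)%E by apply: fin_num_measure; exact: measurable_point.
rewrite -lee_fin -smean_integral // EFinM fineK //.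
have -> : (nu [set (x : vec)] * (f x)%:E)%E =
    (\int[nu]_(y in [set (x : vec)]) (f x)%:E)%E.
  by rewrite (integral_cst nu (measurable_point x)) muleC.
have -> : (\int[nu]_(y in [set (x : vec)]) (f x)%:E)%E =
    (\int[nu]_(y in [set (x : vec)]) (f y)%:E)%E.
  by apply: eq_integral => y; rewrite inE => ->.
apply: ge0_subset_integral => //.
- exact: measurable_point.
- exact: measurable_sphere.
- by apply/measurable_EFinP; exact: measurable_funTS (continuous_measurable_borelRn cf).
- by move=> y ->.
Qed.

Lemma continuous_mulmx (Q : 'M[R]_n) i : continuous (fun x : 'rV[R]_n => (x *m Q) ord0 i).
Proof.
rewrite (_ : (fun x => _) = (fun x : 'rV[R]_n => \sum_j x ord0 j * Q j i)).
  apply: continuous_sum => j _; apply: continuous_mul; first exact: coord_continuous.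
  exact: continuous_const.
by apply/funext => x; rewrite mxE.
Qed.

Lemma dotE (x y : 'rV[R]_n) : dot x y = (x *m y^T) ord0 ord0.
Proof. by rewrite mxE; apply: eq_bigr => i _; rewrite mxE. Qed.

Lemma dot_orthogonal (Q : 'M[R]_n) (x y : 'rV[R]_n) : Q *m Q^T = 1%:M ->
  dot (x *m Q) (y *m Q) = dot x y.
Proof. by move=> QQ; rewrite !dotE trmx_mul mulmxA -(mulmxA x) QQ mulmx1. Qed.

Lemma continuous_rV (T : topologicalType) (g : T -> 'rV[R]_n) :
  (forall i, continuous (fun t => g t ord0 i)) -> continuous g.
Proof.
move=> cg x; apply/cvgrPdist_lt => e e0.
have H : \forall t \near x, forall i, `|g x ord0 i - g t ord0 i| < e.
  by apply: filter_forall => i; have /cvgrPdist_lt := cg i x; apply.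
apply: filterS H => t Ht.
rewrite /Num.norm /= mx_normrE; apply/bigmax_ltP; split => // -[i j] _ /=.
by rewrite ord1 !mxE.
Qed.

Lemma orthogonal_preimage_sphere (Q : 'M[R]_n) : Q *m Q^T = 1%:M ->
  (fun x : vec => (x *m Q : vec)) @^-1` sphere = sphere.
Proof. by move=> QQ; apply/seteqP; split => x /=; rewrite /sphere /= dot_orthogonal. Qed.

Lemma smean_rotation (sigma : probability vec R) (Q : 'M[R]_n) f :
  rotation_invariant sigma -> Q *m Q^T = 1%:M -> continuous f ->
  smean sigma (fun x => f (x *m Q)) = smean sigma f.
Proof.
move=> inv QQ cf; pose phi (x : vec) : vec := x *m Q.
have cphi : continuous (phi : 'rV[R]_n -> 'rV[R]_n).
  by apply: continuous_rV => i; exact: continuous_mulmx.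
have mphi : measurable_fun [set: vec] phi.
  apply: (measurability _ (erefl : @measurable _ vec = <<s @open 'rV[R]_n >>)) => //.
  move=> _ [A oA <-]; rewrite setTI; apply: open_measurable_borelRn.
  exact: ((continuousP (phi : 'rV[R]_n -> 'rV[R]_n)).1 cphi _ oA).
apply: EFin_inj; rewrite -!smean_integral //; last first.
  by move=> x; apply: continuous_comp; [exact: cphi|exact: cf].
have mf : measurable_fun [set: vec] (EFin \o (f : vec -> R)).
  by apply/measurable_EFinP; exact: continuous_measurable_borelRn.
transitivity (\int[pushforward sigma phi]_(y in sphere) (EFin \o (f : vec -> R)) y)%E.
  rewrite (integral_pushforward mphi) //; last exact: measurable_sphere.
    by rewrite orthogonal_preimage_sphere.
  rewrite orthogonal_preimage_sphere //.
  apply: (@continuous_integrable_sphere sigma (f \o phi)).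
  by move=> x; apply: continuous_comp; [exact: cphi|exact: cf].
apply: eq_measure_integral => A mA _; exact: inv.
Qed.

End SphereIntegral.

(** * Moments of the invariant measure, and cubature rules from designs *)

Section InvariantMoments.
Variables (R : realType) (n : nat).
Implicit Types (x y a b : 'rV[R]_n).

Lemma dotC x y : dot x y = dot y x.
Proof. by apply: eq_bigr => i _; rewrite mulrC. Qed.

Lemma dotDr x y z : dot x (y + z) = dot x y + dot x z.
Proof. by rewrite /dot -big_split; apply: eq_bigr => i _; rewrite mxE mulrDr. Qed.

Lemma dotZr c x y : dot x (c *: y) = c * dot x y.
Proof. by rewrite /dot mulr_sumr; apply: eq_bigr => i _; rewrite mxE mulrCA. Qed.

Lemma dotNr x y : dot x (- y) = - dot x y.
Proof. by rewrite -scaleN1r dotZr mulN1r. Qed.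

Lemma dotDl x y z : dot (y + z) x = dot y x + dot z x.
Proof. by rewrite dotC dotDr !(dotC x). Qed.

Lemma dotZl c x y : dot (c *: y) x = c * dot y x.
Proof. by rewrite dotC dotZr dotC. Qed.

Lemma dotNl x y : dot (- y) x = - dot y x.
Proof. by rewrite dotC dotNr dotC. Qed.

Lemma dot_ge0 x : 0 <= dot x x.
Proof. by apply: sumr_ge0 => i _; rewrite -expr2 sqr_ge0. Qed.

Lemma dot_eq0 x : (dot x x == 0) = (x == 0).
Proof.
apply/eqP/eqP => [/psumr_eq0P x0|->]; last first.
  by rewrite /dot big1 // => i _; rewrite mxE mul0r.
apply/rowP => i; rewrite mxE; apply/eqP; rewrite -sqrf_eq0 expr2 x0 // => j _.
by rewrite -expr2 sqr_ge0.
Qed.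

Lemma dot_mulmx (Q : 'M[R]_n) x y : dot x (y *m Q) = dot (x *m Q^T) y.
Proof. by rewrite !dotE trmx_mul mulmxA. Qed.

Lemma dot_delta i x : dot (delta_mx ord0 i) x = x ord0 i.
Proof.
rewrite /dot (bigD1 i) //= mxE !eqxx mul1r big1 ?addr0 // => j ji.
by rewrite mxE (negPf ji) andbF mul0r.
Qed.

Lemma householder a b : dot a a = 1 -> dot b b = 1 ->
  exists Q : 'M[R]_n, Q *m Q^T = 1%:M /\ a *m Q = b.
Proof.
move=> a1 b1; have [<-|ab] := eqVneq a b.
  by exists 1%:M; rewrite trmx1 !mulmx1.
pose v := a - b; have v0 : dot v v != 0 by rewrite dot_eq0 subr_eq0.
pose H : 'M[R]_n := 1%:M - (2 / dot v v) *: (v^T *m v).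
have HE x : x *m H = x - (2 / dot v v * dot x v) *: v.
  rewrite mulmxBr mulmx1 -scalemxAr mulmxA [x *m v^T]mx11_scalar -dotE.
  by rewrite mul_scalar_mx scalerA.
exists H; split; last first.
  have vv : dot v v = 2 * dot a v.
    by rewrite /v !(dotDl, dotDr, dotNl, dotNr) a1 b1 (dotC b a); ring.
  rewrite HE; have -> : 2 / dot v v * dot a v = 1.
    by rewrite mulrAC -vv divff.
  by rewrite scale1r /v opprB addrC subrK.
have HT : H^T = H by rewrite linearB linearZ /= trmx1 trmx_mul trmxK.
rewrite HT; apply/row_matrixP => i; rewrite !rowE mulmxA !HE mulmx1.
rewrite dotDl dotNl dotZl; set e := delta_mx _ _.
have -> : 2 / dot v v * (dot e v - 2 / dot v v * dot e v * dot v v) =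
  - (2 / dot v v * dot e v) by field.
by rewrite scaleNr opprK subrK.
Qed.

Variable sigma : probability (borelRn R n) R.
Hypothesis sigma_inv : invariant_sphere_probability sigma.
Hypothesis n_gt0 : (0 < n)%N.

Lemma smean_odd f : continuous f -> (forall x, f (- x) = - f x) -> smean sigma f = 0.
Proof.
move=> cf fN; have Q1 : (-1)%:M *m ((-1)%:M : 'M[R]_n)^T = 1%:M.
  by rewrite tr_scalar_mx -scalar_mxM mulrNN mulr1.
have := smean_rotation sigma_inv.2 Q1 cf.
under eq_fun do rewrite mul_mx_scalar scaleN1r fN -mulN1r.
rewrite smeanZ // mulN1r => /eqP; rewrite eq_sym -subr_eq0 opprK -mulr2n.
by rewrite mulrn_eq0 /= => /eqP.
Qed.

Lemma continuous_dot_exp a m : continuous (fun x => dot a x ^+ m).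
Proof.
apply: continuous_expr; apply: continuous_dot => i; last exact: coord_continuous.
exact: continuous_const.
Qed.

(** Rotations carry a / |a| to a fixed unit vector, and the power is homogeneous. The constant m
    stays implicit; [design_mass] determines it from a design. *)
Lemma smean_linear_form k : exists m, forall a,
  smean sigma (fun x => dot a x ^+ k.*2) = m * dot a a ^+ k.
Proof.
pose i0 := Ordinal n_gt0; pose e0 : 'rV[R]_n := delta_mx ord0 i0.
have e01 : dot e0 e0 = 1 by rewrite dot_delta mxE !eqxx.
exists (smean sigma (fun x => dot e0 x ^+ k.*2)) => a.
have [->|a0] := eqVneq a 0.
  have d0 x : dot (0 : 'rV[R]_n) x = 0.
    by rewrite /dot big1 // => i _; rewrite mxE mul0r.
  under eq_fun do rewrite d0; rewrite d0.
  (* For a = 0 and k = 0 both sides involve 0 ^ 0 = 1. *)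
  case: k => [|k]; last by rewrite doubleS !expr0n /= mulr0; exact: smean0.
  by rewrite expr0 mulr1 /=; under [in RHS]eq_fun do rewrite expr0.
pose r := Num.sqrt (dot a a).
have r0 : 0 < r by rewrite sqrtr_gt0 lt_def dot_ge0 dot_eq0 a0.
have r2 : r ^+ 2 = dot a a by rewrite sqr_sqrtr // dot_ge0.
pose u := r^-1 *: a.
have u1 : dot u u = 1.
  by rewrite dotZl dotZr -r2; field; rewrite gt_eqF.
have [Q [QQ eQ]] := householder e01 u1.
have QTQ : Q^T *m Q^T^T = 1%:M by rewrite trmxK; exact: mulmx1C.
have aE x : dot a x = r * dot e0 (x *m Q^T).
  by rewrite dot_mulmx trmxK eQ /u dotZl mulrA divff ?mul1r // gt_eqF.
under eq_fun do rewrite aE exprMn.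
rewrite (smeanZ _ _ (f := fun x => dot e0 (x *m Q^T) ^+ k.*2)); last first.
  move=> x; apply: (continuous_comp (f := fun x => x *m Q^T) (g := fun x => dot e0 x ^+ k.*2)).
    by apply: continuous_rV => i; exact: continuous_mulmx.
  exact: continuous_dot_exp.
rewrite (smean_rotation (f := fun x => dot e0 x ^+ k.*2) sigma_inv.2 QTQ); last exact: continuous_dot_exp.
by rewrite mulrC -mul2n exprM r2.
Qed.

(* Linear functionals that agree on powers of linear forms agree on
   monomials, by polarization. *)
Lemma lmono_of_powers (T : finType) (w : T -> R) (y : T -> 'rV[R]_n) c1 c2 (s : seq 'I_n) :
  (forall a, c1 * \sum_u w u * dot a (y u) ^+ size s =
             c2 * smean sigma (fun x => dot a x ^+ size s)) ->
  c1 * \sum_u w u * lmono s (y u) = c2 * smean sigma (lmono s).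
Proof.
move=> Hpow; set d := size s in Hpow.
pose aS (S : {set 'I_d}) : 'rV[R]_n := \sum_(j in S) delta_mx ord0 (tnth (in_tuple s) j).
have dE S x : dot (aS S) x = \sum_(j in S) x ord0 (tnth (in_tuple s) j).
  rewrite /aS; elim/big_rec2: _ => [|j v z _ <-].
    by rewrite /dot big1 // => i _; rewrite mxE mul0r.
  by rewrite dotDl dot_delta.
have lE x : lmono s x = (d`!%:R)^-1 *
    \sum_(S : {set 'I_d}) (-1) ^+ #|(~: S)%SET| * dot (aS S) x ^+ d.
  under eq_bigr do rewrite dE.
  rewrite polarization mulrA mulVf ?mul1r; last first.
    by rewrite pnatr_eq0 -lt0n fact_gt0.
  by rewrite /lmono big_tnth.
have -> : smean sigma (lmono s) = (d`!%:R)^-1 *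
    \sum_(S : {set 'I_d}) (-1) ^+ #|(~: S)%SET| * smean sigma (fun x => dot (aS S) x ^+ d).
  rewrite (funext lE) smeanZ; last first.
    apply: continuous_sum => S _; apply: continuous_mul; first exact: continuous_const.
    exact: continuous_dot_exp.
  rewrite smean_sum => [|S]; last first.
    by apply: continuous_mul; [exact: continuous_const|exact: continuous_dot_exp].
  congr (_ * _); apply: eq_bigr => S _; rewrite smeanZ //; exact: continuous_dot_exp.
under eq_bigr do rewrite lE mulrCA mulr_sumr.
rewrite -mulr_sumr exchange_big /= mulrCA [RHS]mulrCA; congr (_ * _).
rewrite !mulr_sumr; apply: eq_bigr => S _.
rewrite [RHS]mulrCA -Hpow mulrCA; congr (_ * _); rewrite mulr_sumr.
by apply: eq_bigr => u _; rewrite mulrCA.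
Qed.

Lemma lmono_lift x s : dot x x = 1 -> lmono s x = \sum_i lmono [:: i, i & s] x.
Proof.
move=> x1; rewrite -[LHS]mul1r -x1 /dot mulr_suml; apply: eq_bigr => i _.
by rewrite /lmono !big_cons mulrA.
Qed.

Lemma lmonoZ c s x : lmono s (c *: x) = c ^+ size s * lmono s x.
Proof.
elim: s => [|i s IH]; first by rewrite /lmono !big_nil mulr1.
by rewrite /lmono !big_cons -!/(lmono _ _) IH mxE exprS; ring.
Qed.

Lemma continuous_lmono s : continuous (@lmono R n s).
Proof. exact: continuous_polyfun (polyfun_lmono R s). Qed.

Lemma smean_lmono_lift s : smean sigma (lmono s) = \sum_i smean sigma (lmono [:: i, i & s]).
Proof.
rewrite -smean_sum => [|i]; last exact: continuous_lmono.
by apply: smean_eq => x x1; exact: lmono_lift.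
Qed.

Section CubatureOfDesign.
Variables (T : finType) (y : T -> 'rV[R]_n) (k : nat) (c : R).
Hypothesis c_gt0 : 0 < c.
Hypothesis y_pow : forall a, \sum_u dot a (y u) ^+ k.*2 = c * dot a a ^+ k.

(** Averages sum_u <y_u, x>^(2k) over the sphere in two ways: term by term, and through [y_pow], by
    which the integrand is constantly c. *)
Lemma design_mass m : (forall a, smean sigma (fun x => dot a x ^+ k.*2) = m * dot a a ^+ k) ->
  m * \sum_u dot (y u) (y u) ^+ k = c.
Proof.
move=> mE; transitivity (\sum_u smean sigma (fun x => dot (y u) x ^+ k.*2)).
  by rewrite mulr_sumr; apply: eq_bigr => u _; rewrite mE.
rewrite -smean_sum => [|u]; last exact: continuous_dot_exp.
rewrite -[RHS](smean_cst c sigma_inv.1); apply: smean_eq => x x1.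
by under eq_bigr do rewrite dotC; rewrite y_pow x1 expr1n mulr1.
Qed.

Let i0 := Ordinal n_gt0.
Let r u := Num.sqrt (dot (y u) (y u)).
(** A zero [y u] is sent to an arbitrary unit vector: for k > 0 its weight [W u] is 0, and for k = 0
    any unit vector serves. *)
Let z u : 'rV[R]_n := if y u == 0 then delta_mx ord0 i0 else (r u)^-1 *: y u.
Let W u := dot (y u) (y u) ^+ k.

Let r2 u : r u ^+ 2 = dot (y u) (y u).
Proof. by rewrite sqr_sqrtr // dot_ge0. Qed.

Let z1 u : dot (z u) (z u) = 1.
Proof.
rewrite /z; case: eqVneq => [_|y0]; first by rewrite dot_delta mxE !eqxx.
have r0 : r u != 0 by rewrite gt_eqF // sqrtr_gt0 lt_def dot_ge0 dot_eq0 y0.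
by rewrite dotZl dotZr -r2; field.
Qed.

Let W_top s u : size s = k.*2 -> W u * lmono s (z u) = lmono s (y u).
Proof.
move=> sk; have yE : y u = r u *: z u.
  rewrite /z; case: eqVneq => [y0|y0].
    by rewrite /r y0 /dot big1 ?sqrtr0 ?scale0r // => i _; rewrite mxE mul0r.
  have r0 : r u != 0 by rewrite gt_eqF // sqrtr_gt0 lt_def dot_ge0 dot_eq0 y0.
  by rewrite scalerA divff // scale1r.
by rewrite [in RHS]yE lmonoZ sk -mul2n exprM r2.
Qed.

Lemma cubature_of_design : exists (xi : T * bool -> 'rV[R]_n) (w : T * bool -> R),
  [/\ forall q, dot (xi q) (xi q) = 1, forall q, 0 <= w q, \sum_q w q = 1 &
   forall d f, (d <= k.*2.+1)%N -> polyfun d f ->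
     \sum_q w q * f (xi q) = smean sigma f].
Proof.
have [m mE] := smean_linear_form k.
(* Induction down from degree 2k: on the sphere a monomial is the sum over i of its products with
   x_i^2, whose degree is higher by 2. *)
have even_moments j s : (j <= k)%N -> size s = (k - j).*2 ->
    m * \sum_u W u * lmono s (z u) = c * smean sigma (lmono s).
  elim: j s => [|j IH] s jk sj.
    rewrite subn0 in sj.
    transitivity (m * \sum_u 1 * lmono s (y u)).
      by congr (_ * _); apply: eq_bigr => u _; rewrite W_top // mul1r.
    apply: lmono_of_powers => a; rewrite sj mE.
    by under eq_bigr do rewrite mul1r; rewrite y_pow; ring.
  rewrite smean_lmono_lift.
  under eq_bigr do rewrite (lmono_lift _ (z1 _)) mulr_sumr.
  rewrite exchange_big /= !mulr_sumr; apply: eq_bigr => i _.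
  by apply: IH => /=; [exact: ltnW|rewrite sj -doubleS; congr _.*2; lia].
have smean1 : smean sigma (fun=> 1) = 1 by apply: smean_cst; exact: sigma_inv.1.
have mW : m * \sum_u W u = c by exact: design_mass mE.
have W0 u : 0 <= W u by rewrite exprn_ge0 // dot_ge0.
pose S := \sum_u W u; have S0 : 0 < S.
  have : 0 <= S by apply: sumr_ge0 => u _; exact: W0.
  rewrite le_eqVlt => /orP[/eqP/esym S0|//]; move: c_gt0.
  by rewrite -mW -/S S0 mulr0 ltxx.
have m0 : m != 0 by apply: contraTneq c_gt0 => m0; rewrite -mW m0 mul0r ltxx.
(* Each u yields two antipodal nodes, hence the division by 2 S. *)
exists (fun q => if q.2 then z q.1 else - z q.1), (fun q => W q.1 / (S *+ 2)).
have pairE (F : T * bool -> R) : \sum_q F q = \sum_u (F (u, true) + F (u, false)).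
  rewrite (eq_bigr (fun p : T * bool => F (p.1, p.2))) => [|[]] //.
  rewrite -(pair_bigA _ (fun (u : T) (b : bool) => F (u, b))) /=.
  by apply: eq_bigr => u _; rewrite big_bool.
have S2 : S *+ 2 != 0 by rewrite mulrn_eq0 /= gt_eqF.
split.
- by move=> [u b] /=; case: b; rewrite ?dotNl ?dotNr ?opprK z1.
- by move=> q; rewrite divr_ge0 ?W0 // mulrn_wge0 // ltW.
- rewrite pairE /=; under eq_bigr do rewrite -mulrDl -mulr2n.
  by rewrite -mulr_suml sumrMnl divff.
move=> d f dk /polyfun_lmono_decomp[l [/allP ld fE]].
have -> : smean sigma f = \sum_(q <- l) q.1 * smean sigma (lmono q.2).
  rewrite (funext fE) smean_sum => [|q].
    by apply: eq_bigr => q _; rewrite smeanZ //; exact: continuous_lmono.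
  by apply: continuous_mul; [exact: continuous_const|exact: continuous_lmono].
under eq_bigr do rewrite fE mulr_sumr.
rewrite exchange_big /= big_seq [RHS]big_seq; apply: eq_bigr => -[a s] /ld /= sd.
under eq_bigr do rewrite mulrCA; rewrite -mulr_sumr; congr (_ * _).
rewrite pairE /=.
have [os|es] := boolP (odd (size s)).
  rewrite big1 => [|u _]; last first.
    rewrite -scaleN1r lmonoZ -signr_odd os expr1; ring.
  rewrite smean_odd //; first exact: continuous_lmono.
  by move=> x; rewrite -scaleN1r lmonoZ -signr_odd os expr1 mulN1r.
have sk : ((size s)./2 <= k)%N.
  rewrite -leq_double even_halfK //; have := leq_trans sd dk.
  by rewrite leq_eqVlt => /orP[/eqP sE|//]; move: es; rewrite sE /= odd_double.
have := even_moments (k - (size s)./2)%N s (leq_subr _ _).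
rewrite subKn // even_halfK // => /(_ erefl) eq_s.
apply: (mulfI (lt0r_neq0 c_gt0)); rewrite -eq_s -mW -/S mulrAC -mulrA; congr (_ * _).
rewrite mulr_suml; apply: eq_bigr => u _.
rewrite -scaleN1r lmonoZ -signr_odd (negPf es) expr0 mul1r.
rewrite -mulr2n -mulrnAr -mulr_natr; field.
by rewrite gt_eqF.
Qed.

End CubatureOfDesign.

End InvariantMoments.

(** * Bounds on the theta-norm *)

Section DiscreteProbability.
Variables (R : realType) (n : nat).
Local Notation vec := (borelRn R n).

Lemma discrete_probability (T : finType) (xi : T -> vec) (w : T -> R) :
  (forall q, 0 <= w q) -> \sum_q w q = 1 ->
  exists nu : probability vec R,
    (forall A : set vec, measurable A -> nu A = (\sum_q w q * \1_A (xi q))%:E) /\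
    (forall f : 'rV[R]_n -> R, continuous f -> (forall q, dot (xi q) (xi q) = 1) ->
       smean nu f = \sum_q w q * f (xi q)).
Proof.
move=> w0 w1.
have [t0 _] : exists t0 : T, true.
  apply/existsP; rewrite -[[exists _, _]]negbK negb_exists; apply/negP => /forallP H.
  by move/eqP: w1; rewrite big1 ?(eq_sym 0) ?oner_eq0 // => q _; have := H q.
pose e i := nth t0 (enum T) i.
pose m i : {measure set vec -> \bar R} := mscale (NngNum (w0 (e i))) (dirac (xi (e i))).
pose mu : {measure set vec -> \bar R} := msum m #|T|.
have reidx (F : T -> R) : \sum_q F q = \sum_(i < #|T|) F (e i).
  by rewrite -big_enum (big_nth t0) big_mkord -cardE.
have muE (A : set vec) : mu A = (\sum_q w q * \1_A (xi q))%:E.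
  by rewrite reidx -sumEFin.
have mu1 : mu setT = 1%E.
  by rewrite muE -w1; congr EFin; apply: eq_bigr => q _; rewrite indicT mulr1.
(* The total mass is already 1; [mnormalize] supplies the probability structure, with a Dirac mass
   as its default for a degenerate total. *)
pose nu : probability vec R := mnormalize mu (dirac (xi t0)).
have nuE (A : set vec) : nu A = (\sum_q w q * \1_A (xi q))%:E.
  rewrite -muE /nu /= /mnormalize mu1 /= onee_eq0 /=.
  by rewrite invr1 mule1.
exists nu; split => [A mA|f cf xi1]; first exact: nuE.
have ge0_case (g : 'rV[R]_n -> R) : continuous g -> (forall x : 'rV[R]_n, dot x x = 1 -> 0 <= g x) ->
    smean nu g = \sum_q w q * g (xi q).
  move=> cg g0; apply: EFin_inj; rewrite -smean_integral //.
  have mg : measurable_fun sphere (fun x : vec => (g x)%:E).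
    by apply/measurable_EFinP; exact: measurable_funTS (continuous_measurable_borelRn cg).
  have g0' (x : vec) : sphere x -> (0 <= (g x)%:E)%E.
    by move=> xS; rewrite lee_fin g0.
  transitivity (\int[mu]_(x in sphere) (g x)%:E)%E.
    by apply: eq_measure_integral => A mA _; exact: (etrans (nuE A) (esym (muE A))).
  rewrite ge0_integral_measure_sum //; last exact: measurable_sphere.
  rewrite reidx -sumEFin; apply: eq_bigr => i _.
  rewrite ge0_integral_mscale //; last exact: measurable_sphere.
  rewrite integral_dirac //; last exact: measurable_sphere.
  rewrite /= EFinM; congr (_ * _)%E.
  rewrite -[RHS]mul1e; congr (_ * _)%E.
  by rewrite diracE mem_set //; exact: xi1.
(* For a general continuous f, its minimum on the sphere is subtracted to reach the nonnegative
   case. *)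
have [||c] := @compact_EVT_min _ R f (sphere : set 'rV[R]_n) _ (@compact_sphere R n).
- by exists (xi t0); exact: xi1.
- exact: continuous_subspaceT.
rewrite inE => cS cmin.
have := ge0_case (fun x => f x + - f c); rewrite smeanD //; last first.
  exact: continuous_const.
rewrite smean_cst; last first.
  rewrite nuE -w1; congr EFin; apply: eq_bigr => q _.
  by rewrite indicE mem_set ?mulr1 //; exact: xi1.
move=> H; apply: (addIr (- f c)); rewrite H.
- under eq_bigr do rewrite mulrDr.
  by rewrite big_split /= -mulr_suml w1 mul1r.
- by apply: continuous_add => //; exact: continuous_const.
- by move=> x x1; rewrite subr_ge0; apply: cmin; rewrite inE.
Qed.

(** Uses exp(s) >= 1 + s at s = (1 - theta) v and at s = - theta v, with v = ln z; in the
    combination with coefficients theta and 1 - theta the terms in v cancel. *)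
Lemma powR_tangent (theta z : R) : 0 <= theta -> theta <= 1 -> 0 < z ->
  z `^ theta <= 1 - theta + theta * z.
Proof.
move=> th0 th1 z0; rewrite /powR gt_eqF //; set v := ln z.
have -> : z = expR v by rewrite lnK ?posrE.
have e1 : expR (theta * v) * (1 + (1 - theta) * v) <= expR v.
  have -> : expR v = expR (theta * v) * expR ((1 - theta) * v).
    by rewrite -expRD; congr expR; ring.
  by rewrite ler_wpM2l ?expR_ge0 // expR_ge1Dx.
have e2 : expR (theta * v) * (1 - theta * v) <= 1.
  rewrite [leRHS](_ : 1 = expR (theta * v) * expR (- (theta * v))); last first.
    by rewrite -expRD subrr expR0.
  by rewrite ler_wpM2l ?expR_ge0 // expR_ge1Dx.
have -> : expR (theta * v) = theta * (expR (theta * v) * (1 + (1 - theta) * v)) +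
   (1 - theta) * (expR (theta * v) * (1 - theta * v)) by ring.
by rewrite addrC lerD // ?ler_wpM2l ?subr_ge0 // -[leRHS]mulr1 ler_wpM2l // subr_ge0.
Qed.

End DiscreteProbability.

Section ThetaBounds.
Variables (R : realType) (n : nat).
Local Notation vec := (borelRn R n).

Lemma countable_singletons (A : set vec) : countable A ->
  exists J : nat -> set vec, [/\ A = \bigcup_k J k, trivIset setT J &
    forall k, J k = set0 \/ exists2 x, A x & J k = [set x]].
Proof.
move=> /countable_injP[f fI].
exists (fun k => [set x | A x /\ f x = k]); split.
- apply/seteqP; split=> [x Ax|x [k _ [Ax _]] //].
  by exists (f x).
- by move=> i j _ _ [x [[_ <-] [_ <-]]].
- move=> k; have [Je|/set0P[x [Ax fx]]] := eqVneq [set x | A x /\ f x = k] set0.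
    by left.
  right; exists x => //; apply/seteqP; split=> [y [Ay fy]|y ->] //=.
  by apply: fI; rewrite ?inE // fy fx.
Qed.

Lemma measurable_singleton_or_empty (J : set vec) (A : set vec) :
  J = set0 \/ (exists2 x, A x & J = [set x]) -> measurable J.
Proof. by move=> [->|[x _ ->]]; [exact: measurable0|exact: measurable_point]. Qed.

Lemma countable_measurable_borelRn (A : set vec) : countable A -> measurable A.
Proof.
move=> /countable_singletons[J [-> _ JP]].
by apply: bigcup_measurable => k _; exact: measurable_singleton_or_empty (JP k).
Qed.

Lemma esum_points (nu : probability vec R) (A : set vec) : countable A ->
  \esum_(x in A) nu [set x] = nu A.
Proof.
move=> /countable_singletons[J [AE tJ JP]].
rewrite [in LHS]AE esum_bigcupT // [in RHS]AE measure_semi_bigcup //; last 2 first.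
- by move=> k; exact: measurable_singleton_or_empty (JP k).
- by apply: bigcup_measurable => k _; exact: measurable_singleton_or_empty (JP k).
rewrite nneseries_esumT //; apply: eq_esum => k _.
have [->|[x _ ->]] := JP k; first by rewrite esum_set0 measure0.
by rewrite esum_set1.
Qed.

Definition atoms (nu : probability vec R) : set vec := [set x | (0 < nu [set x])%E].

(** An atom outside the countable carrier D would raise the total mass above 1. *)
Lemma atoms_on_sphere (nu : probability vec R) x :
  discrete_on_sphere nu -> atoms nu x -> dot (x : 'rV[R]_n) x = 1.
Proof.
move=> [D [cD DS D1]] /= x0; apply: DS; apply: contrapT => Dx.
have mD := countable_measurable_borelRn cD.
have nuU : (nu (D `|` [set x]) = nu D + nu [set x])%E.
  rewrite measureU //; first exact: measurable_point.
  by apply/seteqP; split => y //= [Dy yx]; apply: Dx; rewrite -yx.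
have : (nu (D `|` [set x]) <= 1)%E.
  by apply: probability_le1; apply: measurableU => //; exact: measurable_point.
by rewrite nuU D1 leNgt => /negP; apply; rewrite lteDl.
Qed.

Lemma esum_atoms (nu : probability vec R) : discrete_on_sphere nu ->
  (1 <= \esum_(x in atoms nu) nu [set x])%E.
Proof.
move=> [D [cD DS D1]]; rewrite -D1 -(esum_points nu cD).
rewrite esum_mkcond [leRHS]esum_mkcond; apply: le_esum => x _.
case: ifPn => xD; case: ifPn => // xA.
rewrite leNgt; apply/negP => x0; move: xA; rewrite notin_setE; exact.
Qed.

Lemma esum_scale (I : set vec) (a : vec -> \bar R) (c : R) : 0 < c ->
  (forall x, 0 <= a x)%E ->
  (c%:E * (\esum_(x in I) a x) <= \esum_(x in I) (c%:E * a x))%E.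
Proof.
move=> c0 a0; rewrite -lee_pdivlMl //; apply: ge_ereal_sup => _ [X [finX XI] <-].
rewrite lee_pdivlMl // ge0_mule_fsumr //.
rewrite -esum_fset //; last by move=> x _; rewrite mule_ge0 // lee_fin ltW.
by apply: esum_ge; exists X => //; rewrite esum_fset // => x _; rewrite mule_ge0 // lee_fin ltW.
Qed.

Lemma powR_weight_ge (B u theta : R) : 0 < B -> 0 < u -> u <= B^-1 -> theta <= 1 ->
  B `^ (1 - theta) * u <= u `^ theta.
Proof.
move=> B0 u0 uB th1.
have -> : u `^ theta = u `^ (theta - 1) * u.
  rewrite -[X in _ * X](powRr1 (ltW u0)) -powRD ?subrK //.
  by rewrite (gt_eqF u0) implybT.
rewrite ler_wpM2r ?(ltW u0) //.
rewrite -[X in u `^ X]opprB powRN -[X in _ <= X]div1r ler_pdivlMr ?powR_gt0 //.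
rewrite -powRM ?(ltW u0) ?(ltW B0) //.
apply: (@le_trans _ _ (1 `^ (1 - theta))); last by rewrite powR1.
apply: ge0_ler_powR; rewrite ?subr_ge0 ?nnegrE ?mulr_ge0 ?ler01 ?(ltW B0) ?(ltW u0) //.
by rewrite mulrC -ler_pdivlMr // div1r.
Qed.

Lemma powR_weight_gt (B u theta : R) : 0 < B -> 0 < u -> u < B^-1 -> theta < 1 ->
  B `^ (1 - theta) * u < u `^ theta.
Proof.
move=> B0 u0 uB th1.
have -> : u `^ theta = u `^ (theta - 1) * u.
  rewrite -[X in _ * X](powRr1 (ltW u0)) -powRD ?subrK //.
  by rewrite (gt_eqF u0) implybT.
rewrite ltr_pM2r //.
rewrite -[X in u `^ X]opprB powRN -[X in _ < X]div1r ltr_pdivlMr ?powR_gt0 //.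
rewrite -powRM ?(ltW u0) ?(ltW B0) //.
apply: (@lt_le_trans _ _ (1 `^ (1 - theta))); last by rewrite powR1.
apply: gt0_ltr_powR; rewrite ?subr_gt0 ?nnegrE ?mulr_ge0 ?ler01 ?(ltW B0) ?(ltW u0) //.
by rewrite mulrC -ltr_pdivlMr // div1r.
Qed.

Lemma theta_norm_ge (nu : probability vec R) (B theta : R) : discrete_on_sphere nu ->
  0 < B -> theta <= 1 ->
  (forall x, atoms nu x -> (nu [set x] <= (B^-1)%:E)%E) ->
  ((B `^ (1 - theta))%:E <= theta_norm theta nu)%E.
Proof.
move=> dnu B0 th1 nuB.
have pB : 0 < B `^ (1 - theta) by exact: powR_gt0.
rewrite -[leLHS]mule1.
apply: (@le_trans _ _ ((B `^ (1 - theta))%:E * \esum_(x in atoms nu) nu [set x]))%E.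
  by rewrite lee_pmul2l // esum_atoms.
apply: (le_trans (esum_scale _ pB _)) => //; apply: le_esum => x /= x0.
have fx : (nu [set x] \is a fin_num)%E by apply: fin_num_measure; exact: measurable_point.
have := nuB x x0; move: x0 fx; rewrite /atoms /=; case: (nu [set x]) => // u u0 _ uB.
by rewrite poweR_EFin -EFinM lee_fin powR_weight_ge.
Qed.

(** For the equality case: the light atom x0 is split off and contributes strictly more than its
    share, the others at least theirs. *)
Lemma theta_norm_gt (nu : probability vec R) (B theta : R) x0 : discrete_on_sphere nu ->
  0 < B -> theta < 1 ->
  (forall x, atoms nu x -> (nu [set x] <= (B^-1)%:E)%E) ->
  atoms nu x0 -> (nu [set x0] < (B^-1)%:E)%E ->
  ((B `^ (1 - theta))%:E < theta_norm theta nu)%E.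
Proof.
move=> dnu B0 th1 nuB ax0 x0B.
have pB : 0 < B `^ (1 - theta) by exact: powR_gt0.
have fin x : (nu [set x] \is a fin_num)%E by apply: fin_num_measure; exact: measurable_point.
rewrite /theta_norm -/(atoms nu) (esumID [set x0]) //; last by move=> x _; exact: poweR_ge0.
have -> : atoms nu `&` [set x0] = [set x0] by apply/setIidr => x ->.
rewrite esum_set1 ?poweR_ge0 //.
have sum1 : (1 <= nu [set x0] + \esum_(x in atoms nu `&` ~` [set x0]) nu [set x])%E.
  have := esum_atoms dnu; rewrite (esumID [set x0]) //.
  have -> : atoms nu `&` [set x0] = [set x0] by apply/setIidr => x ->.
  by rewrite esum_set1.
apply: (@lt_le_trans _ _ (nu [set x0] `^ theta + (B `^ (1 - theta))%:E *
    (\esum_(x in atoms nu `&` ~` [set x0]) nu [set x])))%E; last first.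
  apply: leeD2l; apply: (le_trans (esum_scale _ pB _)) => //.
  apply: le_esum => x /= [xa _]; have := nuB x xa; move: xa (fin x); rewrite /atoms /=.
  case: (nu [set x]) => // u u0 _ uB.
  by rewrite poweR_EFin -EFinM lee_fin powR_weight_ge // ltW.
move: ax0 x0B (fin x0) sum1; rewrite /atoms /=; case: (nu [set x0]) => // u u0 uB _.
set S := (\esum_(x in _) _)%E => uS; have S0 : (0 <= S)%E by exact: esum_ge0.
move: uS S0; case: S => [S| |] //; last first.
  by rewrite mulry gtr0_sg // mul1e poweR_EFin => _ _; rewrite addeC addye // ltry.
rewrite poweR_EFin -EFinM -!EFinD !lee_fin lte_fin => uS S0.
have := @powR_weight_gt B u theta B0 u0 uB th1.
move=> uth; apply: (@le_lt_trans _ _ (B `^ (1 - theta) * (u + S))).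
  by rewrite ler_peMr // ltW.
by rewrite mulrDr ltrD2r.
Qed.

Lemma peval_polyfun t (p : mpoly.mpoly n R) : (mpoly.msize p <= t.+1)%N ->
  polyfun t (fun x : 'rV[R]_n => peval p (x : vec)).
Proof. by exists p. Qed.

Lemma cubature_smean (sigma nu : probability vec R) t f :
  cubature sigma t nu -> polyfun t f -> smean nu f = smean sigma f.
Proof.
move=> [_ cub] [p pt fE]; have cf : continuous f by apply: (continuous_polyfun (d := t)); exists p.
by apply: EFin_inj; rewrite -!smean_integral // (funext fE); exact: cub.
Qed.

Lemma Theta_le_card (sigma : probability vec R) t (T : finType)
    (xi : T -> 'rV[R]_n) (w : T -> R) theta :
  (forall q, dot (xi q) (xi q) = 1) -> (forall q, 0 <= w q) -> \sum_q w q = 1 ->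
  (forall f, polyfun t f -> \sum_q w q * f (xi q) = smean sigma f) ->
  0 <= theta -> theta < 1 ->
  (Theta sigma t theta <= ((#|T|%:R : R) `^ (1 - theta))%:E)%E.
Proof.
move=> xi1 w0 w1 wxi th0 th1.
have [nu [nuE nuI]] := discrete_probability (xi : T -> vec) w0 w1.
have finX : finite_set [set (xi q : vec) | q in [set: T]].
  by apply: finite_image; exact: finite_finset.
have mX : measurable [set (xi q : vec) | q in [set: T]].
  by apply: countable_measurable_borelRn; exact: finite_set_countable.
apply: (@le_trans _ _ (theta_norm theta nu)).
  apply: ereal_inf_lbound; exists nu => //; split.
    exists [set (xi q : vec) | q in [set: T]]; split.
    - exact: finite_set_countable.
    - by move=> _ [q _ <-]; exact: xi1.
    - rewrite nuE // -w1; congr EFin; apply: eq_bigr => q _.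
      by rewrite indicE mem_set ?mulr1 //; exists q.
  move=> p pt; have pf := peval_polyfun pt.
  rewrite !(smean_integral _ (continuous_polyfun pf)); congr EFin.
  by rewrite nuI ?wxi //; exact: continuous_polyfun pf.
(* The [xi q] may coincide and the weights may vanish, so [u] collects the weight of each point; at
   most #|T| atoms result. *)
pose u (x : vec) := \sum_q w q * (xi q == x :> 'rV[R]_n)%:R.
have uE x : nu [set x] = (u x)%:E.
  rewrite nuE; last exact: measurable_point.
  congr EFin; apply: eq_bigr => q _; congr (_ * _); rewrite indicE.
  by congr (_%:R); congr nat_of_bool; apply/idP/eqP; rewrite inE.
have aX : atoms nu `<=` [set (xi q : vec) | q in [set: T]].
  move=> x; rewrite /atoms /= uE lte_fin => ux; apply: contrapT => xX.
  move: ux; rewrite /u big1 ?ltxx // => q _; case: eqP => [qx|]; last by rewrite mulr0.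
  by case: xX; exists q.
have finA : finite_set (atoms nu) by exact: sub_finite_set finX.
have pos x : (0 <= nu [set x] `^ theta)%E by exact: poweR_ge0.
rewrite /theta_norm -/(atoms nu) esum_fset // fsbig_finite //=.
set s := fset_set _.
have sP x : x \in s -> 0 < u x.
  by rewrite in_fset_set // inE /atoms /= uE lte_fin.
under eq_big_seq => x xs do rewrite uE poweR_EFin.
rewrite sumEFin lee_fin.
pose N : R := #|T|%:R.
have T0 : (0 < #|T|)%N.
  rewrite lt0n; apply/eqP => T0; move/eqP: w1; rewrite big1 ?(eq_sym 0) ?oner_eq0 // => q _.
  by have := card0_eq T0 q; rewrite inE.
have N0 : 0 < N by rewrite ltr0n.
have us : uniq (finmap.enum_fset s) by exact: finmap.fset_uniq.
have sN : (size (finmap.enum_fset s) <= #|T|)%N.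
  rewrite -[leqRHS](size_image (fun q => xi q : vec)); apply: uniq_leq_size => // x.
  rewrite in_fset_set // inE => /aX[q _ <-]; apply/mapP; exists q; rewrite ?mem_enum //.
have su : \sum_(x <- s) u x <= 1.
  rewrite -w1 exchange_big; apply: ler_sum => q _.
  rewrite -mulr_sumr -[leRHS]mulr1 ler_wpM2l // -natr_sum.
  rewrite -[leRHS]/(1%:R) ler_nat.
  have -> : (\sum_(x <- s) (xi q == x :> 'rV[R]_n) = count_mem (xi q : vec) s)%N.
    rewrite -sum1_count [RHS]big_mkcond; apply: eq_bigr => x _ /=.
    by rewrite eq_sym; case: (x == _).
  by rewrite count_uniq_mem // leq_b1.
(* The tangent to x^theta at 1 / N, the value at equal weights. Summed over at most N points of
   total weight at most 1 it gives N^(1 - theta). *)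
have bound x : x \in s -> u x `^ theta <= N `^ (- theta) * (1 - theta + theta * (N * u x)).
  move=> /sP ux; have -> : u x `^ theta = N `^ (- theta) * (N * u x) `^ theta.
    rewrite powRM ?(ltW N0) ?(ltW ux) // mulrA -powRD ?addNr ?powRr0 ?mul1r //.
    by rewrite eqxx (gt_eqF N0).
  rewrite ler_wpM2l ?powR_ge0 // powR_tangent // ?(ltW th1) //.
  by rewrite mulr_gt0.
have -> : N `^ (1 - theta) = N `^ (- theta) * N.
  rewrite -[X in _ * X](powRr1 (ltW N0)) -powRD ?(addrC _ 1) //.
  by rewrite (gt_eqF N0) implybT.
rewrite big_seq (le_trans (ler_sum _ bound)) // -big_seq -mulr_sumr.
rewrite ler_wpM2l ?powR_ge0 // big_split /= -!mulr_sumr.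
rewrite big_const_seq count_predT iter_addr_0 -mulr_natr.
rewrite [leRHS](_ : N = (1 - theta) * N + theta * (N * 1)); last by ring.
apply: lerD; first by rewrite ler_wpM2l ?ler_nat // subr_ge0 ltW.
by rewrite ler_wpM2l // ler_wpM2l // ltW.
Qed.

End ThetaBounds.

(** * Growth in the dimension *)

Section GrowthInDimension.
Variable R : realType.

Lemma Theta_ge n (sigma : probability (borelRn R n) R) t (B theta : R) :
  0 < B -> theta <= 1 ->
  (forall xi : 'rV[R]_n, dot xi xi = 1 -> exists q : 'rV[R]_n -> R,
    [/\ polyfun t q, forall x, dot x x = 1 -> 0 <= q x, q xi = 1 &
        smean sigma q <= B^-1]) ->
  ((B `^ (1 - theta))%:E <= Theta sigma t theta)%E.
Proof.
move=> B0 th1 test; apply: le_ereal_inf_tmp => _ [nu cub <-].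
apply: theta_norm_ge => // [|x ax]; first exact: cub.1.
have [q [pq q0 q1 qB]] := test x (atoms_on_sphere cub.1 ax).
have := smean_atom nu (continuous_polyfun pq) q0 (atoms_on_sphere cub.1 ax).
rewrite q1 mulr1 (cubature_smean cub pq) => /le_trans/(_ qB).
by rewrite -lee_fin fineK // fin_num_measure //; exact: measurable_point.
Qed.

Lemma bernoulli_expr (x : R) k : 0 <= x -> 1 + k%:R * (x - 1) <= x ^+ k.
Proof.
move=> x0; elim: k => [|k IH]; first by rewrite mul0r addr0 expr0.
rewrite exprS; apply: le_trans (ler_wpM2l x0 IH).
rewrite -subr_ge0 -natr1 (_ : _ - _ = k%:R * (x - 1) ^+ 2); last by ring.
by rewrite mulr_ge0 ?ler0n // sqr_ge0.
Qed.

(** By Bernoulli's inequality x^k lies above its tangent at x = 1; with x = |y_u|^2 / n the linear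
    terms sum to zero, because sum |y_u|^2 = n #|Om|. *)
Lemma gaussian_design_growth k : exists2 C : nat, (0 < C)%N &
  forall n, (0 < n)%N -> exists (Om : finType) (y : Om -> 'rV[R]_n),
    [/\ (0 < #|Om| <= C * n ^ (k.*2.-1))%N,
      forall a, \sum_u dot a (y u) ^+ k.*2 = #|Om|%:R * (gmom k.*2)%:R * dot a a ^+ k &
      #|Om|%:R * n%:R ^+ k <= \sum_u dot (y u) (y u) ^+ k].
Proof.
(* Strength at most 1 gives k = 0: the exponent [k.*2.-1] truncates to 0, and the single vector 0
   serves because 0 ^ 0 = 1. *)
have [->|k0] := posnP k.
  exists 1%N => // n _; exists unit, (fun _ => 0); split.
  - by rewrite card_unit.
  - by move=> a; rewrite big_const card_unit /= !expr0 addr0 !mulr1.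
  - by rewrite big_const card_unit /= !expr0 addr0 mulr1.
have [C C0 design] := gaussian_design R k0; exists C => // n n0.
have [Om [y [Omn y2 yk]]] := design n n0; exists Om, y; split => //.
  by move=> a; rewrite yk mulrA.
have n0R : 0 < n%:R :> R by rewrite ltr0n.
have sumW : \sum_u dot (y u) (y u) = #|Om|%:R * n%:R.
  transitivity (\sum_u \sum_i dot (delta_mx ord0 i) (y u) ^+ 2).
    by apply: eq_bigr => u _; apply: eq_bigr => i _; rewrite dot_delta -expr2.
  rewrite exchange_big /=; under eq_bigr => i _ do rewrite y2 dot_delta mxE !eqxx mulr1.
  by rewrite sumr_const card_ord mulr_natr.
apply: (@le_trans _ _ (\sum_u n%:R ^+ k * (1 + k%:R * (dot (y u) (y u) / n%:R - 1)))).
  rewrite -mulr_sumr big_split /= -mulr_sumr sumrB -mulr_suml sumW.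
  by rewrite !sumr_const mulfK ?gt_eqF // subrr mulr0 addr0 mulrC.
apply: ler_sum => u _; rewrite -[leRHS](mulfVK (x := n%:R ^+ k)); last first.
  by rewrite expf_neq0 // gt_eqF.
rewrite mulrC ler_wpM2r ?exprn_ge0 ?ler0n // -exprVn -exprMn bernoulli_expr //.
by rewrite divr_ge0 ?dot_ge0 ?ler0n.
Qed.

Lemma Theta_growth_dimension t : exists c C : R, [/\ 0 < c, 0 < C &
  forall (n : nat) (sigma : probability (borelRn R n) R) (theta : R),
    (1 <= n)%N -> invariant_sphere_probability sigma ->
    0 <= theta -> theta < 1 ->
    (((c * n%:R ^+ t./2) `^ (1 - theta))%:E <= Theta sigma t theta)%E /\
    (Theta sigma t theta <= ((C * n%:R ^+ (2 * t./2 - 1)) `^ (1 - theta))%:E)%E].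
Proof.
set k := t./2; have [C C0 design] := gaussian_design_growth k.
have g0 : 0 < (gmom k.*2)%:R :> R by rewrite ltr0n gmom_gt0.
(* [design_mass] and the growth of sum |y_u|^(2k) bound the mean of s^(2k) by gmom(2k) / n^k, whence
   c; the factor 2 in the second constant counts antipodes. *)
exists (gmom k.*2)%:R^-1, (2 * C)%:R; split.
- by rewrite invr_gt0.
- by rewrite ltr0n muln_gt0.
move=> n sigma theta n0 inv th0 th1.
have n0R : 0 < n%:R :> R by rewrite ltr0n.
have [Om [y [/andP[Om0 OmC] yk yW]]] := design n n0.
have Om0R : 0 < #|Om|%:R :> R by rewrite ltr0n.
have c0 : 0 < #|Om|%:R * (gmom k.*2)%:R :> R by rewrite mulr_gt0.
have tk : (t <= k.*2.+1)%N.
  by rewrite -[leqLHS]odd_double_half -/k; case: (odd t); rewrite ?add1n ?add0n.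
have kt : (k.*2 <= t)%N by rewrite -[leqRHS]odd_double_half leq_addl.
split.
  have [m mE] := smean_linear_form inv n0 k.
  apply: Theta_ge => [||xi xi1]; [by rewrite mulr_gt0 ?invr_gt0 ?exprn_gt0|exact: ltW|].
  exists (fun x => dot xi x ^+ k.*2); split.
  - by apply: polyfun_leq kt _; rewrite -[X in polyfun X]muln1; apply: polyfun_exp; exact: polyfun_dot.
  - by move=> x _; rewrite -mul2n exprM exprn_ge0 // sqr_ge0.
  - by rewrite xi1 expr1n.
  rewrite mE xi1 expr1n mulr1 invfM invrK -ler_pdivrMr ?exprn_gt0 // ?invr_gt0 ?exprn_gt0 //.
  rewrite invrK; have mW := design_mass inv yk mE.
  have m0 : 0 <= m.
    have := mE xi; rewrite xi1 expr1n mulr1 => <-; apply: smean_ge0 => x _.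
    by rewrite -mul2n exprM exprn_ge0 // sqr_ge0.
  by rewrite -(ler_pM2l Om0R) -mW mulrCA ler_wpM2l.
have [xi [w [xi1 w0 w1 wxi]]] := cubature_of_design inv n0 c0 yk.
apply: le_trans (Theta_le_card xi1 w0 w1 (wxi _ ^~ tk) th0 th1) _.
rewrite lee_fin; apply: ge0_ler_powR; rewrite ?subr_ge0 ?nnegrE ?ler0n ?mulr_ge0 ?exprn_ge0 ?ler0n ?(ltW th1) //.
rewrite card_prod card_bool -natrX -natrM ler_nat mulnC -mulnA leq_mul2l /=.
by rewrite mul2n subn1.
Qed.

End GrowthInDimension.

(** * Strength three *)

Section UniformMeasures.
Variables (R : realType) (n : nat).
Local Notation vec := (borelRn R n).
Implicit Types (s : seq vec) (nu : probability vec R).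

Lemma fset_set_seq s : uniq s -> perm_eq (finmap.enum_fset (fset_set [set` s])) s.
Proof.
move=> us; apply: uniq_perm => // x.
by rewrite in_fset_set ?mem_setE //; exact: finite_seq.
Qed.

Lemma card_fset_set_seq s : uniq s -> size (finmap.enum_fset (fset_set [set` s])) = size s.
Proof. by move=> /fset_set_seq/perm_size. Qed.

Lemma uniform_on_count s nu : uniq s -> uniform_on [set` s] nu ->
  forall A : set vec, measurable A ->
  nu A = (\sum_(x <- s) (size s)%:R^-1 * \1_A x)%:E.
Proof.
move=> us unu A mA; rewrite unu // card_fset_set_seq //.
rewrite -mulr_sumr mulrC; congr (_ * _)%:E.
have -> : A `&` [set` s] = [set` [seq x <- s | x \in A]].
  apply/seteqP; split => x /=; rewrite mem_filter.
    by move=> [Ax xs]; rewrite mem_set.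
  by move=> /andP[xA xs]; split => //; rewrite -inE.
rewrite card_fset_set_seq ?filter_uniq // size_filter -sum1_count natr_sum.
by rewrite big_mkcond; apply: eq_bigr => x _; rewrite indicE; case: (x \in A).
Qed.

Lemma uniform_theta_norm s nu theta : (0 < size s)%N -> uniq s ->
  uniform_on [set` s] nu -> theta_norm theta nu = ((size s)%:R `^ (1 - theta))%:E.
Proof.
move=> s0 us unu; have N0 : 0 < (size s)%:R :> R by rewrite ltr0n.
have pt x : (nu [set x] = ((size s)%:R^-1 * (x \in s)%:R)%:E)%E.
  rewrite (uniform_on_count us unu (measurable_point _)) -mulr_sumr; congr (_ * _)%:E.
  rewrite -(count_uniq_mem _ us) -sum1_count natr_sum [RHS]big_mkcond.
  apply: eq_bigr => y _; rewrite indicE /=.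
  by case: eqP => [->|yx]; [rewrite mem_set|rewrite memNset].
have aE : [set x : vec | (0 < nu [set x])%E] = [set` s].
  apply/seteqP; split => x /=; rewrite pt lte_fin pmulr_rgt0 ?invr_gt0 // ltr0n.
    by case: (x \in s).
  by move=> ->.
rewrite /theta_norm aE esum_fset //; last 2 first.
- exact: finite_seq.
- by move=> x _; exact: poweR_ge0.
rewrite fsbig_finite /=; last exact: finite_seq.
rewrite (perm_big _ (fset_set_seq us)) /= (eq_big_seq (fun=> (((size s)%:R^-1) `^ theta)%:E)).
  rewrite sumEFin big_const_seq count_predT iter_addr_0; congr EFin.
  rewrite -powR_inv1 ?ler0n // -powRrM mulN1r powRD; last by rewrite (gt_eqF N0) implybT.
  by rewrite powRr1 ?ler0n // -[LHS]mulr_natl.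
by move=> x xs; rewrite pt xs mulr1.
Qed.

Lemma uniform_smean s nu f : (0 < size s)%N -> uniq s -> uniform_on [set` s] nu ->
  (forall x, x \in s -> dot (x : 'rV[R]_n) x = 1) -> continuous f ->
  smean nu f = (size s)%:R^-1 * \sum_(x <- s) f x.
Proof.
move=> s0 us unu s1 cf; pose xi (i : 'I_(size s)) : vec := nth (0 : 'rV[R]_n) s i.
have N0 : (size s)%:R != 0 :> R by rewrite pnatr_eq0 -lt0n.
have sE (g : vec -> R) : \sum_(x <- s) (size s)%:R^-1 * g x =
    \sum_i (size s)%:R^-1 * g (xi i) by rewrite (big_nth (0 : 'rV[R]_n)) big_mkord.
have w0 (i : 'I_(size s)) : 0 <= (size s)%:R^-1 :> R by rewrite invr_ge0 ler0n.
have w1 : \sum_(i < size s) (size s)%:R^-1 = 1 :> R.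
  by rewrite sumr_const card_ord -[LHS]mulr_natl mulfV.
have [nu' [nu'E nu'I]] := discrete_probability xi w0 w1.
rewrite mulr_sumr sE -nu'I //; last by move=> q; apply: s1; exact: mem_nth.
congr fine; apply: eq_measure_integral => A mA _ /=.
by rewrite (uniform_on_count us unu) // sE nu'E.
Qed.

(** Masses 1 / N allow at most N atoms in a probability measure. A discrete measure is carried by
    its atoms, so there are exactly N and the complement is null. *)
Lemma uniform_of_atoms nu (N : nat) : (0 < N)%N -> discrete_on_sphere nu ->
  (forall x, atoms nu x -> nu [set x] = (N%:R^-1)%:E) ->
  exists s : seq vec, [/\ size s = N, uniq s, atoms nu = [set` s] & uniform_on [set` s] nu].
Proof.
move=> N0 dnu nuN; have N0R : 0 < N%:R :> R by rewrite ltr0n.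
have sum_atoms s : uniq s -> [set` s] `<=` atoms nu ->
    nu [set` s] = ((size s)%:R / N%:R)%:E.
  move=> us sA; rewrite -esum_points; last exact: finite_set_countable (finite_seq _).
  rewrite esum_fset //; last exact: finite_seq.
  rewrite fsbig_finite /=; last exact: finite_seq.
  rewrite (perm_big _ (fset_set_seq us)) /= (eq_big_seq (fun=> (N%:R^-1)%:E)).
    by rewrite sumEFin big_const_seq count_predT iter_addr_0 mulr_natl.
  by move=> x xs; apply: nuN; exact: sA.
have small s : uniq s -> [set` s] `<=` atoms nu -> (size s <= N)%N.
  move=> us sA; have := probability_le1 nu (countable_measurable_borelRn
    (finite_set_countable (finite_seq s))).
  by rewrite (sum_atoms s us sA) lee_fin ler_pdivrMr // mul1r ler_nat.
have finA : finite_set (atoms nu).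
  apply: contrapT => /(infinite_set_fset N.+1)[X XA XN].
  by have := small (finmap.enum_fset X) (finmap.fset_uniq X) XA; rewrite leqNgt XN.
pose s := finmap.enum_fset (fset_set (atoms nu)).
have us : uniq s by exact: finmap.fset_uniq.
have sE : atoms nu = [set` s] by rewrite -[LHS](fset_setK finA).
have sN : size s = N.
  apply/eqP; rewrite eqn_leq small //=; last by rewrite sE.
  have := esum_atoms dnu; rewrite esum_points; last exact: finite_set_countable.
  by rewrite {1}sE sum_atoms -?sE // lee_fin ler_pdivlMr // mul1r ler_nat.
exists s; split => // A mA.
have mF := countable_measurable_borelRn (finite_set_countable (finite_seq s)).
have -> : (nu A = nu (A `&` [set` s]))%E.
  rewrite (measureDI nu mA mF) -[RHS]add0e; congr (_ + _)%E.
  apply/eqP; rewrite eq_le measure_ge0 andbT.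
  apply: (@le_trans _ _ (nu (~` [set` s]))).
    by apply: le_measure; rewrite ?inE; [exact: measurableD|exact: measurableC|move=> x []].
  by rewrite probability_setC // sum_atoms -?sE // sN divff ?gt_eqF // subee.
rewrite card_fset_set_seq // sN.
have -> : A `&` [set` s] = [set` [seq x <- s | x \in A]].
  apply/seteqP; split => x /=; rewrite mem_filter.
    by move=> [Ax xs]; rewrite mem_set.
  by move=> /andP[xA xs]; split => //; rewrite -inE.
rewrite card_fset_set_seq ?filter_uniq // sum_atoms ?filter_uniq //.
by move=> x /=; rewrite mem_filter sE => /andP[].
Qed.

End UniformMeasures.

Section CrossPolytope.
Variables (R : realType) (n : nat).
Local Notation vec := (borelRn R n).
Variable sigma : probability vec R.
Hypothesis sigma_inv : invariant_sphere_probability sigma.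
Hypothesis n_gt0 : (0 < n)%N.
Implicit Types (x xi : 'rV[R]_n) (nu : probability vec R).

(** The standard basis is a design for k = 1: it evaluates the second moments of sigma, and with
    antipodes adjoined it is an optimal rule of strength 3. *)
Lemma cross_polytope_design (a : 'rV[R]_n) :
  \sum_(i < n) dot a (delta_mx ord0 i) ^+ 1.*2 = 1 * dot a a ^+ 1.
Proof.
by rewrite mul1r expr1; apply: eq_bigr => i _; rewrite dotC dot_delta expr2.
Qed.

Lemma smean_dot_sqr (a : 'rV[R]_n) :
  smean sigma (fun x => dot a x ^+ 2) = n%:R^-1 * dot a a.
Proof.
have [m mE] := smean_linear_form sigma_inv n_gt0 1.
have := design_mass sigma_inv cross_polytope_design mE.
rewrite (eq_bigr (fun=> 1)) => [|i _]; last by rewrite dot_delta mxE !eqxx expr1n.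
rewrite sumr_const card_ord => mn; have := mE a; rewrite expr1 => ->.
congr (_ * _); apply: (mulIf (x := n%:R)); first by rewrite pnatr_eq0 -lt0n.
by rewrite mn mulVf // pnatr_eq0 -lt0n.
Qed.

(* On the sphere [q xi] vanishes exactly at [- xi] and on the orthogonal of
   [xi]. *)
Let q xi x := 2^-1 * (dot xi x ^+ 2 + dot xi x ^+ 3).

Lemma dot_ge_m1 xi x : dot xi xi = 1 -> dot x x = 1 -> -1 <= dot xi x.
Proof.
move=> xi1 x1; have := dot_ge0 (xi + x).
rewrite dotDl !dotDr xi1 x1 (dotC x xi); lra.
Qed.

Let q_poly xi : polyfun 3 (q xi).
Proof.
apply: polyfun_scale; apply: polyfun_add.
  by apply: (@polyfun_leq _ _ (2 * 1)) => //; apply: polyfun_exp; exact: polyfun_dot.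
by apply: (@polyfun_leq _ _ (3 * 1)) => //; apply: polyfun_exp; exact: polyfun_dot.
Qed.

Let q_factor xi x : q xi x = 2^-1 * (dot xi x ^+ 2 * (1 + dot xi x)).
Proof. by rewrite /q; ring. Qed.

Let q_ge0 xi x : dot xi xi = 1 -> dot x x = 1 -> 0 <= q xi x.
Proof.
move=> xi1 x1; rewrite q_factor mulr_ge0 ?invr_ge0 ?ler0n // mulr_ge0 ?sqr_ge0 //.
have := dot_ge_m1 xi1 x1; lra.
Qed.

Let q_self xi : dot xi xi = 1 -> q xi xi = 1.
Proof. by rewrite /q => ->; field. Qed.

Let smean_q xi : dot xi xi = 1 -> smean sigma (q xi) = (2 * n)%:R^-1.
Proof.
move=> xi1; have cd m := @continuous_dot_exp R n xi m.
rewrite /q smeanZ; last exact: continuous_add.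
rewrite smeanD // smean_dot_sqr xi1 mulr1 (@smean_odd _ _ _ _ (fun x => dot xi x ^+ 3)) //.
  by rewrite addr0 natrM invfM.
by move=> x; rewrite dotNr; ring.
Qed.

Lemma cross_polytope_lower theta : theta < 1 ->
  (((2 * n)%:R `^ (1 - theta))%:E <= Theta sigma 3 theta)%E.
Proof.
move=> th1; apply: Theta_ge; [by rewrite ltr0n muln_gt0|exact: ltW|move=> xi xi1].
exists (q xi); split; [exact: q_poly|by move=> x; exact: q_ge0|exact: q_self|].
by rewrite smean_q.
Qed.

Lemma cross_polytope_upper theta : 0 <= theta -> theta < 1 ->
  (Theta sigma 3 theta <= ((2 * n)%:R `^ (1 - theta))%:E)%E.
Proof.
move=> th0 th1.
have [xi [w [xi1 w0 w1 wxi]]] := cubature_of_design sigma_inv n_gt0 ltr01 cross_polytope_design.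
have := Theta_le_card xi1 w0 w1 (fun f => wxi 3 f isT) th0 th1.
by rewrite card_prod card_bool card_ord mulnC.
Qed.

Lemma cubature_atom_le nu x : cubature sigma 3 nu -> atoms nu x ->
  (nu [set (x : vec)] <= ((2 * n)%:R^-1)%:E)%E.
Proof.
move=> cub ax; have x1 := atoms_on_sphere cub.1 ax.
have := smean_atom nu (continuous_polyfun (q_poly x)) (fun y => q_ge0 x1 (x := y)) x1.
rewrite q_self // mulr1 (cubature_smean cub (q_poly x)) smean_q //.
by rewrite -lee_fin fineK // fin_num_measure //; exact: measurable_point.
Qed.

Lemma tight_atoms nu theta : theta < 1 -> cubature sigma 3 nu ->
  theta_norm theta nu = ((2 * n)%:R `^ (1 - theta))%:E ->
  forall x, atoms nu x -> nu [set (x : vec)] = ((2 * n)%:R^-1)%:E.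
Proof.
move=> th1 cub nuE x ax; apply/eqP; rewrite eq_le cubature_atom_le //= leNgt.
apply/negP => xlt; have N0 : 0 < (2 * n)%:R :> R by rewrite ltr0n muln_gt0.
have := theta_norm_gt cub.1 N0 th1 (fun y => cubature_atom_le cub (x := y)) ax xlt.
by rewrite nuE ltxx.
Qed.

(** The atom x attains equality in its own bound, so [q x] vanishes at all other atoms: each is
    orthogonal to x or equal to -x. *)
Lemma tight_inner_products nu (s : seq vec) : cubature sigma 3 nu ->
  size s = (2 * n)%N -> uniq s -> (forall x, x \in s -> dot (x : 'rV[R]_n) x = 1) ->
  uniform_on [set` s] nu ->
  forall x, x \in s -> (- (x : 'rV[R]_n) : vec) \in s /\
    forall y, y \in s -> y != x -> y != - (x : 'rV[R]_n) :> 'rV[R]_n ->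
      dot (x : 'rV[R]_n) y = 0.
Proof.
move=> cub sN us s1 unu x xs; have x1 := s1 x xs.
have s0 : (0 < size s)%N by rewrite sN muln_gt0.
have sum_poly f : polyfun 3 f -> \sum_(y <- s) f y = (2 * n)%:R * smean sigma f.
  move=> pf; rewrite -(cubature_smean cub pf) (uniform_smean s0 us unu s1 (continuous_polyfun pf)).
  by rewrite sN mulrA divff ?mul1r // pnatr_eq0 -lt0n muln_gt0.
have N0 : (2 * n)%:R != 0 :> R by rewrite pnatr_eq0 -lt0n muln_gt0.
have q_rem : \sum_(y <- rem x s) q x y = 0.
  have := sum_poly _ (q_poly x); rewrite (perm_big _ (perm_to_rem xs)) big_cons.
  by rewrite q_self // smean_q // divff // => /eqP; rewrite -subr_eq0 addrAC subrr add0r => /eqP.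
have xy y : y \in s -> y != x -> dot (x : 'rV[R]_n) y = 0 \/ y = - (x : 'rV[R]_n) :> 'rV[R]_n.
  move=> ys yx; have yr : y \in rem x s by rewrite mem_rem_uniq // inE yx.
  have : q x y = 0.
    apply/eqP; move/eqP: q_rem; rewrite big_seq psumr_eq0 => [/allP/(_ y yr)|z zr].
      by rewrite yr.
    by apply: q_ge0 => //; apply: s1; exact: mem_rem zr.
  rewrite q_factor => /eqP; rewrite mulf_eq0 invr_eq0 pnatr_eq0 /= mulf_eq0 sqrf_eq0.
  case/orP => [/eqP|/eqP xyE]; [by left|right].
  apply/eqP; rewrite -subr_eq0 opprK -dot_eq0 dotDl !dotDr x1 (s1 y ys) (dotC y x).
  by apply/eqP; move: xyE; lra.
split; last by move=> y ys yx yNx; case: (xy y ys yx) => // yE; rewrite yE eqxx in yNx.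
(* Without -x all other atoms would be orthogonal to x, and the sum of the <x, y> would be 1,
   whereas the first moment vanishes. *)
apply: contraT => xNs; have : \sum_(y <- s) dot (x : 'rV[R]_n) y = 0.
  rewrite (sum_poly (fun y => dot (x : 'rV[R]_n) y)); last first.
    by apply: (@polyfun_leq _ _ 1) => //; exact: polyfun_dot.
  rewrite smean_odd ?mulr0 // => [|y]; last exact: dotNr.
  exact: continuous_polyfun (polyfun_dot _).
rewrite (perm_big _ (perm_to_rem xs)) big_cons big_seq big1 => [|y yr].
  by rewrite /= addr0 x1 => /eqP; rewrite oner_eq0.
move: yr; rewrite mem_rem_uniq // inE => /andP[yx ys].
by case: (xy y ys yx) => // yE; rewrite -yE ys in xNs.
Qed.

End CrossPolytope.

(** From each antipodal pair the element that occurs first in s is chosen. *)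
Lemma half_system (V : zmodType) (s : seq V) : uniq s ->
  (forall x, x \in s -> - x \in s /\ x != - x) ->
  exists s', [/\ uniq s', forall x, x \in s' -> - x \notin s' &
    perm_eq s (s' ++ map -%R s')].
Proof.
move=> us sN; pose rep x := (index x s < index (- x) s)%N.
have repN x : x \in s -> rep (- x) = ~~ rep x.
  move=> xs; have [Nxs xNx] := sN x xs; rewrite /rep opprK -leqNgt ltn_neqAle.
  case: eqP => // ii; case/eqP: xNx.
  by rewrite -[LHS](nth_index 0 xs) -ii nth_index.
exists [seq x <- s | rep x]; split; first exact: filter_uniq.
  by move=> x; rewrite !mem_filter => /andP[rx xs]; rewrite repN // rx.
apply: uniq_perm => //.
  rewrite cat_uniq filter_uniq // (map_inj_uniq oppr_inj) filter_uniq //.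
  rewrite andbT /=; apply/hasPn => _ /mapP[x xs ->]; move: xs.
  by rewrite !mem_filter => /andP[rx xs]; rewrite /= repN // rx.
move=> x; rewrite mem_cat mem_filter; apply/idP/idP => [xs|/orP[/andP[]//|/mapP[y]]].
  rewrite xs andbT; case: (boolP (rep x)) => //= rx; apply/mapP; exists (- x).
    by rewrite mem_filter repN // rx (sN x xs).1.
  by rewrite opprK.
by rewrite mem_filter => /andP[_ ys] ->; exact: (sN y ys).1.
Qed.

Section OrthonormalSystems.
Variables (R : realType) (n : nat) (u : 'I_n -> 'rV[R]_n).
Local Notation vec := (borelRn R n).
Hypothesis u1 : forall i, dot (u i) (u i) = 1.
Hypothesis u0 : forall i j, i != j -> dot (u i) (u j) = 0.

Lemma orthonormal_basis : basis_of fullv [seq u i | i <- enum 'I_n].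
Proof.
have sz : size [seq u i | i <- enum 'I_n] = n by rewrite size_map size_enum_ord.
rewrite basisEfree subvf dimvf sz dim_matrix.
rewrite [(1%N * n)%R]mul1n leqnn !andbT.
pose X := Tuple (introT eqP sz); rewrite -[X in free X]/(tval X).
apply/freeP => k /(congr1 (fun v => dot v (u _))) => k0 i; move: k0 => /(_ i).
rewrite (_ : dot 0 _ = 0); last by rewrite /dot big1 // => j _; rewrite mxE mul0r.
have XE (j : 'I_n) : X`_j = u j.
  by rewrite (nth_map i) ?size_enum_ord // nth_ord_enum.
rewrite (eq_bigr (fun j => k j *: u j)) => [|j _]; last by rewrite XE.
have -> : dot (\sum_j k j *: u j) (u i) = \sum_j k j * dot (u j) (u i).
  elim/big_rec2: _ => [|j a b _ <-]; last by rewrite dotDl dotZl.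
  by rewrite /dot big1 // => j _; rewrite mxE mul0r.
rewrite (bigD1 i) //= u1 mulr1 big1 ?addr0 // => j ji.
by rewrite u0 ?mulr0.
Qed.

Lemma plus_minus_seq : exists s : seq vec,
  [/\ size s = (2 * n)%N, uniq s & plus_minus u = [set` s]].
Proof.
pose e := [seq u i | i <- enum 'I_n].
exists ((e ++ map -%R e) : seq 'rV[R]_n); split.
- by rewrite size_cat (size_map _ e) size_map size_enum_ord addnn mul2n.
- have ui : injective u.
    move=> i j uij; apply/eqP/negPn/negP => ij.
    by have := u0 ij; rewrite -uij u1 => /eqP; rewrite oner_eq0.
  rewrite cat_uniq (map_inj_uniq oppr_inj) (map_inj_uniq ui) enum_uniq.
  rewrite andbT /=; apply/hasPn => _ /mapP[_ /mapP[i _ ->] ->].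
  apply/mapP => -[j _ uij]; have := u1 j; rewrite -{1}uij dotNl.
  have [->|ij] := eqVneq i j; first by rewrite u1; lra.
  by rewrite u0 // oppr0 => /eqP; rewrite eq_sym oner_eq0.
- apply/seteqP; split => x /=.
    move=> [i [->|->]]; rewrite mem_cat.
      by rewrite map_f ?mem_enum.
    by rewrite orbC map_f // map_f ?mem_enum.
  rewrite mem_cat => /orP[/mapP[i _ ->]|/mapP[_ /mapP[i _ ->] ->]].
    by exists i; left.
  by exists i; right.
Qed.

End OrthonormalSystems.

Lemma tight_cubature_strength3 (R : realType) n (sigma : probability (borelRn R n) R)
    (theta : R) (nu : probability (borelRn R n) R) :
  (0 < n)%N -> invariant_sphere_probability sigma -> theta < 1 -> cubature sigma 3 nu ->
  (theta_norm theta nu = ((2 * n)%:R `^ (1 - theta))%:E <->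
   exists u : 'I_n -> 'rV[R]_n,
     orthogonal_unit_basis u /\ uniform_on (plus_minus u) nu).
Proof.
move=> n0 inv th1 cub; have N0 : (0 < 2 * n)%N by rewrite muln_gt0.
split => [nuE|[u [[_ u0 u1] unu]]]; last first.
  have [s [sN us sE]] := plus_minus_seq u1 u0.
  by rewrite (uniform_theta_norm theta _ us) ?sN // -sE.
have [s [sN us sE unu]] := uniform_of_atoms N0 cub.1 (tight_atoms inv n0 th1 cub nuE).
have s1 (x : borelRn R n) : x \in s -> dot (x : 'rV[R]_n) x = 1.
  by move=> xs; apply: (atoms_on_sphere cub.1); rewrite sE.
have tight := tight_inner_products inv n0 cub sN us s1 unu.
have [|s' [us' s'N ss']] := @half_system 'rV[R]_n s us.
  move=> x xs; split; first exact: (tight x xs).1.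
  apply/eqP => xNx; have := s1 x xs; rewrite {1}xNx dotNl (s1 x xs); lra.
have s'n : size s' = n.
  by have := perm_size ss'; rewrite sN size_cat size_map addnn -mul2n => /eqP; rewrite eqn_pmul2l // => /eqP.
pose u (i : 'I_n) := nth 0 s' i.
have us'i i : u i \in s' by rewrite mem_nth // s'n.
have s's x : x \in s' -> x \in s by move=> xs'; rewrite (perm_mem ss') mem_cat xs'.
have u1 i : dot (u i) (u i) = 1 by apply: s1; exact: s's.
have u0 i j : i != j -> dot (u i) (u j) = 0.
  move=> ij; apply: (tight _ (s's _ (us'i i))).2; first exact: s's.
    by rewrite nth_uniq ?s'n // eq_sym.
  by apply: contraNneq (s'N _ (us'i i)) => <-.
exists u; split; first by split => //; exact: orthonormal_basis.
rewrite (_ : plus_minus u = [set` s]) //; apply/seteqP; split => x /=.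
  move=> [i [->|->]]; rewrite (perm_mem ss') mem_cat ?us'i //.
  by rewrite orbC map_f.
have idx y : y \in s' -> exists i, y = u i.
  move=> ys; have yn : (index y s' < n)%N by rewrite -[X in (_ < X)%N]s'n index_mem.
  by exists (Ordinal yn); rewrite /u nth_index.
rewrite (perm_mem ss') mem_cat => /orP[/idx[i ->]|/mapP[y /idx[i ->] ->]].
  by exists i; left.
by exists i; right.
Qed.
(** * Growth in the degree *)

Section Caratheodory.
Variables (R : realFieldType) (J : finType) (N : nat) (a : 'I_N -> J -> R).
Hypothesis JN : (#|J| + 1 < N)%N.

(** More than #|J| + 1 vectors (1, a i) are dependent; the coefficients sum to 0 and are not all 0,
    so one is positive. *)
Lemma affine_dependence : exists c : 'I_N -> R,
  [/\ \sum_i c i = 0, forall j, \sum_i c i * a i j = 0 & exists i, 0 < c i].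
Proof.
pose M : 'M[R]_(N, 1 + #|J|) :=
  row_mx (const_mx 1) (\matrix_(i, q) a i (enum_val q)).
have : kermx M != 0.
  rewrite -mxrank_eq0 mxrank_ker subn_eq0 -ltnNge.
  by apply: leq_ltn_trans (rank_leq_col M) _; rewrite addnC.
case/rowV0Pn => c /sub_kermxP; rewrite mul_mx_row => /eqP.
rewrite -[0]row_mx0 => /eqP/eq_row_mx[c1 ca] c0.
have sum0 : \sum_i c 0 i = 0.
  have /matrixP/(_ 0 0) := c1; rewrite !mxE => H; rewrite -[RHS]H.
  by apply: eq_bigr => i _; rewrite mxE mulr1.
exists (c 0); split => // [j|].
  have /matrixP/(_ 0 (enum_rank j)) := ca; rewrite !mxE => H; rewrite -[RHS]H.
  by apply: eq_bigr => i _; rewrite mxE enum_rankK.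
apply/existsP; apply: contraNT c0 => /existsPn cle.
apply/eqP/rowP => i; rewrite mxE; apply/eqP; rewrite -oppr_eq0; move: i.
have cN i : 0 <= - c 0 i by rewrite oppr_ge0 leNgt.
have : \sum_i - c 0 i == 0 by rewrite sumrN sum0 oppr0.
by rewrite psumr_eq0 // => /allP H i; apply: H; rewrite mem_index_enum.
Qed.

Lemma caratheodory_weights (w : 'I_N -> R) :
  (forall i, 0 <= w i) -> \sum_i w i = 1 ->
  exists w' : 'I_N -> R, [/\ forall i, 0 <= w' i, \sum_i w' i = 1,
    forall j, \sum_i w' i * a i j = \sum_i w i * a i j & exists i, w' i = 0].
Proof.
move=> w0 w1; have [c [c1 ca [i1 ci1]]] := affine_dependence.
(* The weights w - tau c stay nonnegative up to the smallest ratio w_i / c_i with c_i > 0, where one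
   of them reaches 0. *)
case: (arg_minP (fun i => w i / c i) (P := fun i => 0 < c i) ci1) => i0 ci0 imin.
pose tau := w i0 / c i0; have tau0 : 0 <= tau by rewrite divr_ge0 // ltW.
exists (fun i => w i - tau * c i); split.
- move=> i; rewrite subr_ge0; have [ci|ci] := ltP 0 (c i).
    by rewrite -ler_pdivlMr // imin.
  by apply: le_trans (w0 i); rewrite mulr_ge0_le0.
- by rewrite sumrB -mulr_sumr c1 mulr0 subr0.
- move=> j; under eq_bigr do rewrite mulrBl -mulrA.
  by rewrite sumrB -mulr_sumr ca mulr0 subr0.
- by exists i0; rewrite /tau divfK ?subrr // gt_eqF.
Qed.

End Caratheodory.

Section Configurations.
Variables (R : realType) (n N : nat).

(** Nodes and weights are packed into one row vector, so that compactness of closed bounded sets of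
    vectors yields an optimal configuration. *)
Let pt (v : 'rV[R]_(N * n + N)) (i : 'I_N) : 'rV[R]_n :=
  \row_j v ord0 (lshift N (mxvec_index i j)).
Let wt (v : 'rV[R]_(N * n + N)) (i : 'I_N) : R := v ord0 (rshift (N * n) i).

Definition configuration (xi : 'I_N -> 'rV[R]_n) (w : 'I_N -> R) : Prop :=
  [/\ forall i, dot (xi i) (xi i) = 1, forall i, 0 <= w i & \sum_i w i = 1].

Let K : set 'rV[R]_(N * n + N) := [set v | configuration (pt v) (wt v)].

Let continuous_pt i j : continuous (fun v => pt v i ord0 j).
Proof.
rewrite (_ : (fun v => _) = fun v : 'rV[R]_(N * n + N) =>
  v ord0 (lshift N (mxvec_index i j))); first exact: coord_continuous.
by apply/funext => v; rewrite mxE.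
Qed.

Let continuous_wt i : continuous (wt^~ i).
Proof. exact: coord_continuous. Qed.

Let compactK : compact K.
Proof.
have closedK : closed K.
  rewrite (_ : K = (\bigcap_i [set v | dot (pt v i) (pt v i) = 1]) `&`
    ((\bigcap_i [set v | 0 <= wt v i]) `&` [set v | \sum_i wt v i = 1])); last first.
    apply/seteqP; split => v /= => [[p1 w0 w1]|[p1 [w0 w1]]].
      by split => [i _|]; [exact: p1|split => // i _; exact: w0].
    by split => // i; [exact: p1|exact: w0].
  apply: closedI.
    apply: closed_bigI => i _.
    apply: (@closed_comp _ _ (fun v => dot (pt v i) (pt v i)) [set r | r = 1]); last exact: closed_eq.
    by move=> v _; apply: continuous_dot => j; exact: continuous_pt.
  apply: closedI.
    apply: closed_bigI => i _.
    apply: (@closed_comp _ _ (wt^~ i) [set r | 0 <= r]); last exact: closed_ge.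
    by move=> v _; exact: continuous_wt.
  apply: (@closed_comp _ _ (fun v => \sum_i wt v i) [set r | r = 1]); last exact: closed_eq.
  by move=> v _; apply: continuous_sum => i _; exact: continuous_wt.
apply: (subclosed_compact closedK (@compact_le_norm R _ 1)) => v /= [p1 w0 w1].
rewrite /Num.norm /= mx_normrE; apply/bigmax_leP; split => // -[i j] _ /=.
rewrite ord1; case: (split_ordP j) => [{}j ->|{}j ->].
  case/mxvec_indexP: j => p j; have <- : pt v p ord0 j = v ord0 (lshift N (mxvec_index p j)).
    by rewrite mxE.
  rewrite -(@expr_le1 _ 2) // real_normK ?num_real //.
  rewrite -[leRHS](p1 p) /dot (bigD1 j) //= expr2 lerDl sumr_ge0 // => k _.
  by rewrite -expr2 sqr_ge0.
rewrite -/(wt v j) ger0_norm // -w1 (bigD1 j) //= lerDl sumr_ge0 // => k _.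
Qed.

(** Continuity of F is asked along every continuous family, which avoids choosing a topology on
    configurations. *)
Lemma optimal_configuration (F : ('I_N -> 'rV[R]_n) -> ('I_N -> R) -> R) xi0 w0 :
  configuration xi0 w0 ->
  (forall (T : topologicalType) (xi : T -> 'I_N -> 'rV[R]_n) (w : T -> 'I_N -> R),
    (forall i j, continuous (fun t => xi t i ord0 j)) -> (forall i, continuous (w^~ i)) ->
    continuous (fun t => F (xi t) (w t))) ->
  exists xi w, configuration xi w /\
    forall xi' w', configuration xi' w' -> F xi w <= F xi' w'.
Proof.
move=> conf0 cF.
have build xi w : exists v, pt v = xi /\ wt v = w.
  exists (row_mx (mxvec (\matrix_i xi i)) (\row_i w i)); split; apply/funext => i.
    by apply/rowP => j; rewrite mxE row_mxEl mxvecE mxE.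
  by rewrite /wt row_mxEr mxE.
have [v0 [v0x v0w]] := build xi0 w0.
have [||v] := @compact_EVT_min _ R (fun v => F (pt v) (wt v)) K _ compactK.
- by exists v0; rewrite /K /= v0x v0w.
- by apply: continuous_subspaceT; apply: cF; [exact: continuous_pt|exact: continuous_wt].
rewrite inE => Kv vmin; exists (pt v), (wt v); split => // xi' w' conf'.
have [v' [v'x v'w]] := build xi' w'; rewrite -v'x -v'w.
by apply: vmin; rewrite inE /K /= v'x v'w.
Qed.

End Configurations.

(** First-order optimality: after mass e is moved, the squared distance to the target changes by - 2
    e p + e^2 s, so a minimum at e = 0 forces p <= 0. *)
Lemma nonpos_of_quadratic (R : realFieldType) (p s : R) : 0 <= s ->
  (forall e, 0 < e -> e <= 1 -> 2 * e * p <= e ^+ 2 * s) -> p <= 0.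
Proof.
move=> s0 H; rewrite leNgt; apply/negP => p0.
have ps0 : 0 < p + s by rewrite ltr_pwDl.
pose e := p / (p + s); have e0 : 0 < e by rewrite divr_gt0.
have e1 : e <= 1 by rewrite ler_pdivrMr // mul1r lerDl.
have eE : e * s = p - e * p by rewrite /e; field; rewrite gt_eqF.
have := H e e0 e1; rewrite expr2 -(mulrA e e s) eE leNgt => /negP; apply.
rewrite -subr_gt0 (_ : _ - _ = e * p * (1 + e)); last by ring.
by apply: mulr_gt0; [exact: mulr_gt0|exact: addr_gt0].
Qed.

Section Tchakaloff.
Variables (R : realType) (n : nat) (sigma : probability (borelRn R n) R).
Hypothesis sigma_sphere : sigma sphere = 1%E.
Hypothesis n_gt0 : (0 < n)%N.
Variables (J : finType) (g : J -> 'rV[R]_n -> R).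
Hypothesis g_cont : forall j, continuous (g j).

Let mu j := smean sigma (g j).
Let N := #|J|.+2.
Let F (xi : 'I_N -> 'rV[R]_n) (w : 'I_N -> R) :=
  \sum_j (mu j - \sum_i w i * g j (xi i)) ^+ 2.

(* The configuration of [#|J| + 2] weighted points whose moments are closest
   to the target is exact: by Caratheodory one of the weights may be taken
   to be zero, so mass can be moved to an arbitrary point of the sphere. *)
Lemma tchakaloff : exists (xi : 'I_N -> 'rV[R]_n) (w : 'I_N -> R),
  configuration xi w /\ forall j, \sum_i w i * g j (xi i) = smean sigma (g j).
Proof.
have e1 : dot (delta_mx ord0 (Ordinal n_gt0) : 'rV[R]_n) (delta_mx ord0 (Ordinal n_gt0)) = 1.
  by rewrite dot_delta mxE !eqxx.
have [||xi [w0 [[xi1 w0_ge0 w0_sum] opt]]] :=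
    @optimal_configuration R n N F (fun=> delta_mx ord0 (Ordinal n_gt0)) (fun=> N%:R^-1).
- split => //; rewrite ?invr_ge0 ?ler0n //.
  by rewrite sumr_const card_ord -[LHS]mulr_natl mulfV ?pnatr_eq0.
- move=> T xi w cxi cw; apply: continuous_sum => j _; apply: continuous_expr.
  apply: continuous_add; first exact: continuous_const.
  rewrite (_ : (fun t => _) = (fun t => (-1) * \sum_i w t i * g j (xi t i))); last first.
    by apply/funext => t; rewrite mulN1r.
  apply: continuous_mul; first exact: continuous_const.
  apply: continuous_sum => i _; apply: continuous_mul; first exact: cw.
  move=> t; apply: (continuous_comp (f := fun t => xi t i) (g := g j)); last exact: g_cont.
  by apply: continuous_rV => k; exact: cxi.
have [|w [w_ge0 w_sum wE [i0 wi0]]] :=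
    @caratheodory_weights R J N (fun i j => g j (xi i)) _ w0 w0_ge0 w0_sum.
  by rewrite addn1.
pose A j := \sum_i w i * g j (xi i); pose v j := mu j - A j.
have Fmin xi' w' : configuration xi' w' -> \sum_j v j ^+ 2 <= F xi' w'.
  move=> conf; apply: le_trans (opt _ _ conf); rewrite /F.
  by apply: ler_sum => j _; rewrite -wE.
(* [f x] pairs the residual v with the moments of the point x relative to A. Minimality gives f <= 0
   on the sphere, while the mean of f is |v|^2. *)
pose f x := \sum_j v j * (g j x - A j).
have f_le0 x : dot x x = 1 -> f x <= 0.
  move=> x1; pose s := \sum_j (g j x - A j) ^+ 2.
  apply: (@nonpos_of_quadratic _ _ s); first by apply: sumr_ge0 => j _; exact: sqr_ge0.
  move=> e e0 e_le1.
  pose xi' i := if i == i0 then x else xi i.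
  pose w' i := (1 - e) * w i + (if i == i0 then e else 0).
  have conf : configuration xi' w'.
    split => [i|i|]; first by rewrite /xi'; case: ifP.
      rewrite addr_ge0 ?mulr_ge0 ?subr_ge0 //; case: ifP => _ //; exact: ltW.
    by rewrite big_split /= -mulr_sumr w_sum -big_mkcond big_pred1_eq; ring.
  have momE j : \sum_i w' i * g j (xi' i) = (1 - e) * A j + e * g j x.
    rewrite (bigD1 i0) //= /w' /xi' !eqxx wi0 mulr0 add0r addrC; congr (_ + _).
    rewrite /A [in RHS](bigD1 i0) //= wi0 mul0r add0r mulr_sumr.
    by apply: eq_bigr => i /negPf ->; rewrite addr0 mulrA.
  have := Fmin _ _ conf; rewrite /F.
  have -> : \sum_j (mu j - \sum_i w' i * g j (xi' i)) ^+ 2 =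
      \sum_j v j ^+ 2 - 2 * e * f x + e ^+ 2 * s.
    rewrite /f /s !mulr_sumr -sumrB -big_split; apply: eq_bigr => j _ /=.
    by rewrite momE /v; ring.
  by rewrite -subr_ge0 => h; lra.
have f_cont : continuous f.
  apply: continuous_sum => j _; apply: continuous_mul; first exact: continuous_const.
  by apply: continuous_add; [exact: g_cont|exact: continuous_const].
have : smean sigma f <= 0.
  rewrite -(smean0 sigma); apply: smean_le => //; exact: continuous_const.
rewrite /f smean_sum => [|j]; last first.
  apply: continuous_mul; first exact: continuous_const.
  by apply: continuous_add; [exact: g_cont|exact: continuous_const].
have -> : \sum_j smean sigma (fun x => v j * (g j x - A j)) = \sum_j v j ^+ 2.
  apply: eq_bigr => j _; rewrite smeanZ; last first.
    by apply: continuous_add; [exact: g_cont|exact: continuous_const].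
  rewrite (@smeanD _ _ _ (g j) (fun=> - A j)) ?smean_cst //.
  exact: continuous_const.
move=> v_le0; have v0 : \sum_j v j ^+ 2 == 0.
  by rewrite eq_le v_le0 sumr_ge0 // => j _; exact: sqr_ge0.
exists xi, w; split => // j; apply/eqP; rewrite eq_sym -subr_eq0 -sqrf_eq0.
move: v0; rewrite psumr_eq0 => [/allP/(_ j)|k _]; last exact: sqr_ge0.
by apply; rewrite mem_index_enum.
Qed.

End Tchakaloff.

Section SphereMonomials.
Variables (R : realType) (n : nat).

Lemma lmono_count (s : seq 'I_n) (x : 'rV[R]_n) :
  lmono s x = \prod_j x ord0 j ^+ count_mem j s.
Proof.
elim: s => [|i s IH]; first by rewrite /lmono big_nil big1.
rewrite /lmono big_cons -/(lmono s x) IH (bigD1 i) //= [RHS](bigD1 i) //= eqxx exprS mulrA.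
by congr (_ * _); apply: eq_bigr => j /negPf ji; rewrite eq_sym ji.
Qed.

(** Bounding exponents coordinatewise is coarser than total degree, but the (d + 1)^n exponents have
    the right order in d and form a plain finite type. *)
Lemma polyfun_box d (f : 'rV[R]_n -> R) : polyfun d f ->
  exists c : {ffun 'I_n -> 'I_d.+1} -> R,
    forall x, f x = \sum_al c al * \prod_j x ord0 j ^+ al j.
Proof.
move=> /polyfun_lmono_decomp[r [/allP rd fE]].
pose al (s : seq 'I_n) : {ffun 'I_n -> 'I_d.+1} := [ffun j => inord (count_mem j s)].
exists (fun b => \sum_(q <- r | b == al q.2) q.1) => x; rewrite fE.
rewrite (eq_bigr (fun b => \sum_(q <- r) if b == al q.2 then q.1 * \prod_j x ord0 j ^+ b j else 0)); last first.
  by move=> b _; rewrite mulr_suml big_mkcond; apply: eq_bigr => q _; case: ifP.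
rewrite exchange_big /= big_seq [RHS]big_seq; apply: eq_bigr => q /rd qd.
rewrite -big_mkcond big_pred1_eq lmono_count; congr (_ * _); apply: eq_bigr => j _.
by rewrite ffunE inordK // ltnS (leq_trans (count_size _ _)).
Qed.

Definition row_tail (x : 'rV[R]_n.+1) : 'rV[R]_n := \row_j x ord0 (lift ord0 j).

Lemma dot_row_tail (x : 'rV[R]_n.+1) :
  dot x x = x ord0 ord0 ^+ 2 + dot (row_tail x) (row_tail x).
Proof.
rewrite /dot big_ord_recl expr2; congr (_ + _).
by apply: eq_bigr => j _; rewrite !mxE.
Qed.

(** On the sphere x_0^2 = 1 - |tail|^2 lowers the power of x_0 to at most 1, which saves one
    dimension in the count. Each index of s raises the tail degree by at most 2, whence the doubled
    bound. *)
Lemma lmono_sphere_split (s : seq 'I_n.+1) : exists f0 f1 : 'rV[R]_n -> R,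
  [/\ polyfun (size s).*2 f0, polyfun (size s).*2 f1 & forall x, dot x x = 1 ->
    lmono s x = f0 (row_tail x) + x ord0 ord0 * f1 (row_tail x)].
Proof.
elim: s => [|i s [f0 [f1 [p0 p1 sE]]]].
  exists (fun=> 1), (fun=> 0); split; [exact: polyfun_const|exact: polyfun_const|move=> x _].
  by rewrite /lmono big_nil mulr0 addr0.
have -> : (size (i :: s)).*2 = (2 + (size s).*2)%N by rewrite doubleS.
case: (unliftP ord0 i) => [j|] ->.
  exists (fun y : 'rV[R]_n => y ord0 j * f0 y), (fun y : 'rV[R]_n => y ord0 j * f1 y); split.
  - by apply: polyfun_mul => //; apply: polyfun_leq (polyfun_coord R j).
  - by apply: polyfun_mul => //; apply: polyfun_leq (polyfun_coord R j).
  - by move=> x x1; rewrite /lmono big_cons -/(lmono s x) sE // !mxE; ring.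
exists (fun y : 'rV[R]_n => (1 + (-1) * \sum_j y ord0 j ^+ 2) * f1 y), f0; split.
- apply: polyfun_mul => //; apply: polyfun_add; first exact: polyfun_const.
  apply: polyfun_scale; apply: polyfun_sum => j _.
  by apply: (@polyfun_leq _ _ (2 * 1)) => //; apply: polyfun_exp; exact: polyfun_coord.
- by apply: polyfun_leq p0; rewrite leq_addl.
move=> x x1; rewrite /lmono big_cons -/(lmono s x) sE //.
have -> : \sum_j row_tail x ord0 j ^+ 2 = 1 - x ord0 ord0 ^+ 2.
  by rewrite -x1 dot_row_tail addrAC subrr add0r; apply: eq_bigr => j _; rewrite expr2.
by ring.
Qed.

Lemma polyfun_sphere_split d (f : 'rV[R]_n.+1 -> R) : polyfun d f ->
  exists f0 f1 : 'rV[R]_n -> R,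
  [/\ polyfun d.*2 f0, polyfun d.*2 f1 & forall x, dot x x = 1 ->
    f x = f0 (row_tail x) + x ord0 ord0 * f1 (row_tail x)].
Proof.
move=> /polyfun_lmono_decomp[r [rd fE]].
suff [f0 [f1 [p0 p1 rE]]] : exists f0 f1 : 'rV[R]_n -> R,
  [/\ polyfun d.*2 f0, polyfun d.*2 f1 & forall x, dot x x = 1 ->
    \sum_(q <- r) q.1 * lmono q.2 x = f0 (row_tail x) + x ord0 ord0 * f1 (row_tail x)].
  by exists f0, f1; split => // x x1; rewrite fE rE.
elim: r rd {fE} => [|[c s] r IH] /=.
  move=> _; exists (fun=> 0), (fun=> 0); split; [exact: polyfun_const|exact: polyfun_const|].
  by move=> x _; rewrite big_nil mulr0 addr0.
move=> /andP[sd /IH[f0 [f1 [p0 p1 rE]]]].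
have [h0 [h1 [q0 q1 sE]]] := lmono_sphere_split s.
have sd2 : ((size s).*2 <= d.*2)%N by rewrite leq_double.
exists (fun y => c * h0 y + f0 y), (fun y => c * h1 y + f1 y); split.
- by apply: polyfun_add => //; apply: polyfun_scale; exact: polyfun_leq q0.
- by apply: polyfun_add => //; apply: polyfun_scale; exact: polyfun_leq q1.
- by move=> x x1; rewrite big_cons /= rE // sE //; ring.
Qed.

Definition sphere_monomial d (j : bool * {ffun 'I_n -> 'I_d.+1}) (x : 'rV[R]_n.+1) : R :=
  x ord0 ord0 ^+ j.1 * \prod_i x ord0 (lift ord0 i) ^+ j.2 i.

Lemma continuous_sphere_monomial d j : continuous (@sphere_monomial d j).
Proof.
apply: continuous_mul; first by apply: continuous_expr; exact: coord_continuous.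
by apply: continuous_prod => i _; apply: continuous_expr; exact: coord_continuous.
Qed.

Lemma sphere_monomial_span d (f : 'rV[R]_n.+1 -> R) : polyfun d f ->
  exists c : bool * {ffun 'I_n -> 'I_d.*2.+1} -> R,
  forall x, dot x x = 1 -> f x = \sum_j c j * sphere_monomial j x.
Proof.
move=> /polyfun_sphere_split[f0 [f1 [/polyfun_box[c0 E0] /polyfun_box[c1 E1] fE]]].
exists (fun j => if j.1 then c1 j.2 else c0 j.2) => x x1; rewrite fE // E0 E1.
pose F (b : bool) al := (if b then c1 al else c0 al) * sphere_monomial (b, al) x.
rewrite (eq_bigr (fun p => F p.1 p.2)) => [|[b al]] //.
rewrite -(pair_bigA _ F) /= big_bool addrC mulr_sumr; congr (_ + _).
  apply: eq_bigr => al _; rewrite /F /sphere_monomial /= expr1 mulrCA.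
  by congr (_ * (_ * _)); apply: eq_bigr => i _; rewrite mxE.
apply: eq_bigr => al _; rewrite /F /sphere_monomial /= expr0 mul1r; congr (_ * _).
by apply: eq_bigr => i _; rewrite mxE.
Qed.

End SphereMonomials.

Lemma Theta_upper_degree (R : realType) (n : nat) (sigma : probability (borelRn R n) R) t theta :
  (0 < n)%N -> (0 < t)%N -> invariant_sphere_probability sigma ->
  0 <= theta -> theta < 1 ->
  (Theta sigma t theta <=
    (((2 * 3 ^ n.-1 + 2)%:R * t%:R ^+ n.-1) `^ (1 - theta))%:E)%E.
Proof.
case: n sigma => // n sigma _ t0 inv th0 th1 /=.
have [xi [w [[xi1 w0 w1] wE]]] := tchakaloff inv.1 (ltn0Sn n)
  (@continuous_sphere_monomial R n t.*2).
apply: le_trans (Theta_le_card xi1 w0 w1 _ th0 th1) _.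
  move=> f /sphere_monomial_span[c fE].
  rewrite (smean_eq _ fE) smean_sum => [|j]; last first.
    by apply: continuous_mul; [exact: continuous_const|exact: continuous_sphere_monomial].
  under eq_bigr => i _ do rewrite fE // mulr_sumr.
  rewrite exchange_big; apply: eq_bigr => j _ /=; rewrite smeanZ; last first.
    exact: continuous_sphere_monomial.
  by rewrite -wE mulr_sumr; apply: eq_bigr => i _; rewrite mulrCA.
rewrite lee_fin; apply: ge0_ler_powR; rewrite ?subr_ge0 ?nnegrE ?mulr_ge0 ?exprn_ge0 ?ler0n ?(ltW th1) //.
rewrite -natrX -natrM ler_nat card_ord card_prod card_bool card_ffun !card_ord.
(* With n now the dimension minus 1, there are 2 (2 t + 1)^n + 2 nodes; 2 t + 1 <= 3 t and 1 <= t^n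
   give the constant. *)
rewrite -addn2 mulnDl -mulnA -expnMn leq_add // ?leq_mul2l /=.
  by have [->|n0] := posnP n; rewrite ?expn0 ?leq_exp2r //; lia.
by rewrite leq_pmulr // expn_gt0 t0.
Qed.

(** * Lower bound in the degree by the Christoffel function *)

Section Christoffel.
Variables (R : realType) (n : nat) (sigma : probability (borelRn R n) R).
Hypothesis sigma_inv : invariant_sphere_probability sigma.
Hypothesis n_gt0 : (0 < n)%N.

(* A cubature rule has a node of positive weight, and a rotation moves that
   node to any prescribed point. *)
Lemma smean_eq0 d (q : 'rV[R]_n -> R) : polyfun d q ->
  (forall x, dot x x = 1 -> 0 <= q x) -> smean sigma q = 0 ->
  forall x, dot x x = 1 -> q x = 0.
Proof.
move=> pq q0 Iq x x1; have [C C0 /(_ n n_gt0)[Om [y [/andP[Om0 _] yk _]]]] :=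
  gaussian_design_growth R d.
have c0 : 0 < #|Om|%:R * (gmom d.*2)%:R :> R by rewrite mulr_gt0 // ltr0n ?gmom_gt0.
have [xi [w [xi1 w0 w1 wxi]]] := cubature_of_design sigma_inv n_gt0 c0 yk.
have [i wi] : exists i, 0 < w i.
  apply/existsP; apply: contraT => /existsPn w_le0; move/eqP: w1.
  rewrite big1 ?(eq_sym 0) ?oner_eq0 // => i _; apply/eqP.
  by rewrite eq_le w0 andbT leNgt w_le0.
have [Q [QQ xiQ]] := householder (xi1 i) x1.
have dd : (d <= d.*2.+1)%N by rewrite -addnn; lia.
have := wxi d _ dd (polyfun_mulmx Q pq).
rewrite (smean_rotation (f := q) sigma_inv.2 QQ); last exact: continuous_polyfun pq.
rewrite Iq => /eqP; rewrite psumr_eq0 => [/allP/(_ i)|j _]; last first.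
  by rewrite mulr_ge0 // q0 // dot_orthogonal.
rewrite mem_index_enum xiQ => /(_ isT)/implyP/(_ isT).
by rewrite mulf_eq0 (gt_eqF wi) => /eqP.
Qed.

Variables (k D : nat) (L : 'I_D -> 'rV[R]_n -> R) (y : 'I_D -> 'rV[R]_n).
Hypothesis L_poly : forall a, polyfun k (L a).
Hypothesis y1 : forall a, dot (y a) (y a) = 1.
Hypothesis L_diag : forall a, L a (y a) != 0.
Hypothesis L_offdiag : forall a b, a != b -> L a (y b) = 0.

Let G : 'M[R]_D := \matrix_(a, b) smean sigma (fun x => L a x * L b x).

Let polyfunLL a b : polyfun (k + k) (fun x => L a x * L b x).
Proof. exact: polyfun_mul. Qed.

Let polyfunL (v : 'I_D -> R) : polyfun k (fun x => \sum_a v a * L a x).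
Proof. by apply: polyfun_sum => a _; exact: polyfun_scale. Qed.

Let smean_sqr (v : 'rV[R]_D) :
  smean sigma (fun x => (\sum_a v ord0 a * L a x) ^+ 2) = (v *m G *m v^T) ord0 ord0.
Proof.
have cLL a b : continuous (fun x => v ord0 a * v ord0 b * (L a x * L b x)).
  by apply: (continuous_polyfun (d := (k + k)%N)); exact: polyfun_scale.
transitivity (smean sigma (fun x => \sum_b \sum_a v ord0 a * v ord0 b * (L a x * L b x))).
  congr (smean sigma _); apply/funext => x; rewrite expr2 mulr_sumr.
  by apply: eq_bigr => b _; rewrite mulr_suml; apply: eq_bigr => a _; ring.
rewrite smean_sum => [|b]; last by apply: continuous_sum => a _; exact: cLL.
rewrite mxE; apply: eq_bigr => b _; rewrite smean_sum // !mxE mulr_suml.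
apply: eq_bigr => a _; rewrite smeanZ; last exact: continuous_polyfun (polyfunLL a b).
by rewrite mxE; ring.
Qed.

(** A kernel vector gives a combination of the [L a] with mean square 0; it vanishes on the sphere
    by [smean_eq0], and evaluation at the [y b] kills its coefficients. *)
Let G_unit : G \in unitmx.
Proof.
rewrite -row_free_unit; apply: inj_row_free => v vG.
have := smean_sqr v; rewrite vG mul0mx mxE => f0.
have pf := polyfun_mul (polyfunL (v ord0)) (polyfunL (v ord0)).
apply/rowP => b; rewrite mxE.
have sq x : dot x x = 1 -> 0 <= (\sum_a v ord0 a * L a x) * \sum_a v ord0 a * L a x.
  by move=> _; rewrite -expr2 sqr_ge0.
have := smean_eq0 pf sq f0 (y1 b).
have -> : \sum_a v ord0 a * L a (y b) = v ord0 b * L b (y b).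
  by rewrite (bigD1 b) //= big1 ?addr0 // => a ab; rewrite L_offdiag ?mulr0.
move=> /eqP fb; apply/eqP; move: fb.
by rewrite mulf_eq0 orbb mulf_eq0 (negPf (L_diag b)) orbF.
Qed.

Let row_L x : 'rV[R]_D := \row_a L a x.
Let u x : 'rV[R]_D := row_L x *m invmx G.
(** The reproducing kernel of the span of the [L a] in L^2(sigma); the inverse Gram matrix replaces
    an orthonormal basis. *)
Let K x z := \sum_a u x ord0 a * L a z.

Let smean_K_sqr x : smean sigma (fun z => K x z ^+ 2) = K x x.
Proof.
rewrite smean_sqr mulmxKV // mxE; apply: eq_bigr => a _.
by rewrite !mxE mulrC.
Qed.

Let KE x : K x x = \sum_a \sum_b invmx G b a * (L b x * L a x).
Proof.
apply: eq_bigr => a _; rewrite mxE mulr_suml; apply: eq_bigr => b _.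
by rewrite mxE; ring.
Qed.

Let K_poly : polyfun (k + k) (fun x => K x x).
Proof.
apply: polyfun_ext (fun x => esym (KE x)) _.
by apply: polyfun_sum => a _; apply: polyfun_sum => b _; exact: polyfun_scale.
Qed.

Let smean_K : smean sigma (fun x => K x x) = D%:R.
Proof.
have c a b : continuous (fun x => invmx G b a * (L b x * L a x)).
  by apply: (continuous_polyfun (d := (k + k)%N)); exact: polyfun_scale.
rewrite (funext KE) smean_sum => [|a]; last by apply: continuous_sum => b _; exact: c.
have <- : \tr (G *m invmx G) = D%:R by rewrite mulmxV // mxtrace1.
rewrite /mxtrace.
apply: eq_bigr => a _; rewrite smean_sum // mxE; apply: eq_bigr => b _.
rewrite smeanZ; last exact: continuous_polyfun (polyfunLL b a).
rewrite mxE mulrC; congr (_ * _); congr (smean sigma _).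
by apply/funext => x; rewrite mulrC.
Qed.

(* The diagonal [K x x] of the reproducing kernel has mean [D]. *)
Lemma christoffel_test : (0 < D)%N -> exists x0 (q : 'rV[R]_n -> R),
  [/\ dot x0 x0 = 1, polyfun (k + k) q, forall x, 0 <= q x, q x0 = 1 &
      smean sigma q <= D%:R^-1].
Proof.
move=> D0; have DR : 0 < D%:R :> R by rewrite ltr0n.
(* Otherwise D - K x x is positive on the sphere and has mean 0, against [smean_eq0]. *)
have [x0 [x01 Kx0]] : exists x0, dot x0 x0 = 1 /\ D%:R <= K x0 x0.
  apply: contrapT => noK; have K_lt x : dot x x = 1 -> K x x < D%:R.
    by move=> x1; rewrite ltNge; apply/negP => Kx; apply: noK; exists x.
  have pq : polyfun (k + k) (fun x => D%:R + (-1) * K x x).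
    by apply: polyfun_add; [exact: polyfun_const|exact: polyfun_scale].
  have nonneg x : dot x x = 1 -> 0 <= D%:R + (-1) * K x x.
    by move=> x1; rewrite mulN1r subr_ge0 ltW // K_lt.
  have cK := continuous_polyfun K_poly.
  have mean0 : smean sigma (fun x => D%:R + (-1) * K x x) = 0.
    rewrite smeanD; first last.
    - by apply: (continuous_polyfun (d := (k + k)%N)); exact: polyfun_scale.
    - exact: continuous_const.
    by rewrite smeanZ // smean_K (smean_cst _ sigma_inv.1) mulN1r subrr.
  have := smean_eq0 pq nonneg mean0 (y1 (Ordinal D0)).
  have := K_lt _ (y1 (Ordinal D0)); rewrite mulN1r -subr_gt0 => /gt_eqF/eqP; exact.
have K0 : 0 < K x0 x0 := lt_le_trans DR Kx0.
(* By the reproducing property K x0 z ^ 2 has mean K x0 x0, so the normalised square has mean 1 / K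
   x0 x0 <= 1 / D. *)
exists x0, (fun z => (K x0 x0)^-1 ^+ 2 * K x0 z ^+ 2); split => //.
- apply: polyfun_scale; have pK := polyfunL (u x0 ord0).
  by apply: polyfun_ext (polyfun_mul pK pK) => x; rewrite -expr2.
- by move=> x; rewrite mulr_ge0 ?sqr_ge0.
- by rewrite -exprMn mulVf ?expr1n // gt_eqF.
rewrite smeanZ; last first.
  by apply: continuous_expr; exact: continuous_polyfun (polyfunL _).
rewrite smean_K_sqr expr2 -mulrA mulVf ?gt_eqF // mulr1.
by rewrite lef_pV2 ?posrE.
Qed.

(** The span of the [L a] need not be rotation invariant, so K x x may vary; one good point x0
    suffices, since rotating the test polynomial moves x0 to any given xi. *)
Lemma Theta_ge_dim t theta : (0 < D)%N -> (k + k <= t)%N -> theta < 1 ->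
  (((D%:R : R) `^ (1 - theta))%:E <= Theta sigma t theta)%E.
Proof.
move=> D0 kt th1; apply: Theta_ge => [||xi xi1]; [by rewrite ltr0n|exact: ltW|].
have [x0 [q [x01 pq q0 q1 qD]]] := christoffel_test D0.
have [Q [QQ xiQ]] := householder xi1 x01.
exists (fun x => q (x *m Q)); split => //.
- by apply: polyfun_leq kt _; exact: polyfun_mulmx.
- by rewrite xiQ.
by rewrite (smean_rotation (f := q) sigma_inv.2 QQ) //; exact: continuous_polyfun pq.
Qed.

End Christoffel.

Section GridPolynomials.
Variables (R : realType) (n h : nat).

(** Scaled to at most 1 / (n + 1), so that n squares sum to at most 1 and a grid point of R^n lifts
    to the sphere in R^(n + 1). *)
Let node (i : 'I_h.+1) : R := i%:R / (h.+1 * n.+1)%:R.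

Let node_inj : injective node.
Proof.
move=> i j; have H0 : (h.+1 * n.+1)%:R^-1 != 0 :> R by rewrite invr_eq0 pnatr_eq0.
by move=> /(mulIf H0)/eqP; rewrite eqr_nat => /eqP/val_inj.
Qed.

Let node_ge0 i : 0 <= node i.
Proof. by rewrite divr_ge0 ?ler0n. Qed.

Let node_le i : node i <= n.+1%:R^-1.
Proof.
rewrite ler_pdivrMr ?ltr0n // natrM mulrCA mulVf ?pnatr_eq0 // mulr1 ler_nat.
by rewrite ltnW.
Qed.

Let node_sqr_sum (al : {ffun 'I_n -> 'I_h.+1}) : \sum_j node (al j) ^+ 2 <= 1.
Proof.
apply: (@le_trans _ _ (\sum_(j < n) n.+1%:R^-1)).
  apply: ler_sum => j _; apply: le_trans (node_le (al j)).
  rewrite expr2 ler_piMr // (le_trans (node_le _)) //.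
  by rewrite invf_le1 ?ler1n ?ltr0n.
rewrite sumr_const card_ord -[leLHS]mulr_natl ler_pdivrMr ?ltr0n //.
by rewrite mul1r ler_nat.
Qed.

Definition grid_point (al : {ffun 'I_n -> 'I_h.+1}) : 'rV[R]_n.+1 :=
  \row_i (if unlift ord0 i is Some j then node (al j)
          else Num.sqrt (1 - \sum_j node (al j) ^+ 2)).

(** An unnormalised tensor Lagrange polynomial: [lift (al j) c] runs over the node indices other
    than [al j]. *)
Definition grid_poly (al : {ffun 'I_n -> 'I_h.+1}) (x : 'rV[R]_n.+1) : R :=
  \prod_j \prod_(c < h) (x ord0 (lift ord0 j) - node (lift (al j) c)).

Lemma grid_point_tail al j : grid_point al ord0 (lift ord0 j) = node (al j).
Proof. by rewrite mxE liftK. Qed.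

Lemma dot_grid_point al : dot (grid_point al) (grid_point al) = 1.
Proof.
rewrite /dot big_ord_recl.
under eq_bigr do rewrite grid_point_tail.
rewrite mxE unlift_none -expr2 sqr_sqrtr ?subr_ge0 //.
by under [X in _ + X]eq_bigr do rewrite -expr2; rewrite subrK.
Qed.

Lemma grid_poly_diag al : grid_poly al (grid_point al) != 0.
Proof.
apply/prodf_neq0 => j _; apply/prodf_neq0 => c _.
rewrite grid_point_tail subr_eq0 (inj_eq node_inj) ; exact: neq_lift.
Qed.

Lemma grid_poly_offdiag al be : al != be -> grid_poly al (grid_point be) = 0.
Proof.
move=> ab; have [j jab] : exists j, al j != be j.
  apply/existsP; apply: contraNT ab => /existsPn H.
  by apply/eqP/ffunP => j; apply/eqP; have := H j; rewrite negbK.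
apply/eqP/prodf_eq0; exists j => //; have := unlift_some jab => -[c bc _].
by apply/prodf_eq0; exists c => //; rewrite grid_point_tail bc subrr.
Qed.

Lemma polyfun_grid_poly al : polyfun (n * h) (grid_poly al).
Proof.
have szI m : size (index_enum 'I_m) = m.
  by rewrite -[index_enum _]/(index_enum _) -[RHS]card_ord cardT enumT; unlock index_enum.
have P j : polyfun h (fun x : 'rV[R]_n.+1 =>
    \prod_(c < h) (x ord0 (lift ord0 j) - node (lift (al j) c))).
  have := @polyfun_prod R n.+1 _ (index_enum 'I_h) 1
    (fun c x => x ord0 (lift ord0 j) - node (lift (al j) c)).
  rewrite szI muln1; apply => c.
  by apply: polyfun_add; [exact: polyfun_coord|exact: polyfun_const].
by have := polyfun_prod (index_enum 'I_n) P; rewrite szI.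
Qed.

End GridPolynomials.

Lemma Theta_lower_degree (R : realType) (n : nat) (sigma : probability (borelRn R n) R) t theta :
  (0 < n)%N -> invariant_sphere_probability sigma -> theta < 1 ->
  (((((2 * n)%:R^-1 ^+ n.-1 * t%:R ^+ n.-1) `^ (1 - theta) : R))%:E <= Theta sigma t theta)%E.
Proof.
(* The dimension is now n + 1. The kernel has degree n h and is squared, so 2 n h <= t is required;
   h + 1 > t / (2 (n + 1)) turns the count (h + 1)^n into the bound. *)
case: n sigma => // n sigma _ inv th1 /=; pose h := (t./2 %/ n.+1)%N.
pose A := {ffun 'I_n -> 'I_h.+1}; pose D := #|{: A}|.
have DE : D = (h.+1 ^ n)%N by rewrite /D card_ffun !card_ord.
have D0 : (0 < D)%N by rewrite DE expn_gt0.
have deg : (n * h + n * h <= t)%N.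
  have : (h * n.+1 <= t./2)%N by exact: leq_trunc_div.
  have := odd_double_half t; lia.
have := Theta_ge_dim inv (ltn0Sn n) (L := fun i => grid_poly (R := R) (enum_val i : A))
  (y := fun i => grid_point R (enum_val i : A)) _ _ _ _ D0 deg th1.
move=> H; apply: le_trans (H _ _ _ _).
- rewrite lee_fin; apply: ge0_ler_powR;
    rewrite ?subr_ge0 ?nnegrE ?mulr_ge0 ?exprn_ge0 ?invr_ge0 ?ler0n ?(ltW th1) //.
  rewrite [#|_|]DE -exprMn natrX lerXn2r ?nnegrE ?mulr_ge0 ?invr_ge0 ?ler0n //.
  rewrite mulrC ler_pdivrMr ?ltr0n // -natrM ler_nat.
  have : (t./2 < h.+1 * n.+1)%N by rewrite ltn_ceil.
  have := odd_double_half t; case: (odd t) => /=; nia.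
- by move=> a; exact: polyfun_grid_poly.
- by move=> a; exact: dot_grid_point.
- by move=> a; exact: grid_poly_diag.
- by move=> a b ab; apply: grid_poly_offdiag; rewrite (inj_eq enum_val_inj).
Qed.
(* In the upper bound of the second part the exponent is a truncated
   subtraction: it is 2 * floor(t/2) - 1 for t >= 2, and 0 for t = 1. *)
Theorem theorem1p2 (R : realType) :
  [/\
    forall (n : nat) (sigma : probability (borelRn R n) R) (theta : R),
      (1 <= n)%N -> invariant_sphere_probability sigma ->
      0 <= theta -> theta < 1 ->
      Theta sigma 3 theta = (((2 * n)%:R : R) `^ (1 - theta))%:E /\
      (forall nu : probability (borelRn R n) R, cubature sigma 3 nu ->
         (theta_norm theta nu = (((2 * n)%:R : R) `^ (1 - theta))%:E <->
          exists u : 'I_n -> 'rV[R]_n,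
            orthogonal_unit_basis u /\ uniform_on (plus_minus u) nu)),
    forall t : nat, (1 <= t)%N ->
      exists c C : R, [/\ 0 < c, 0 < C &
        forall (n : nat) (sigma : probability (borelRn R n) R) (theta : R),
          (1 <= n)%N -> invariant_sphere_probability sigma ->
          0 <= theta -> theta < 1 ->
          (((c * n%:R ^+ t./2) `^ (1 - theta))%:E
             <= Theta sigma t theta)%E /\
          (Theta sigma t theta
             <= ((C * n%:R ^+ (2 * t./2 - 1)) `^ (1 - theta))%:E)%E] &
    forall n : nat, (1 <= n)%N ->
      exists c C : R, [/\ 0 < c, 0 < C &
        forall (sigma : probability (borelRn R n) R) (t : nat) (theta : R),
          invariant_sphere_probability sigma -> (1 <= t)%N ->
          0 <= theta -> theta < 1 ->
          (((c * t%:R ^+ (n - 1)) `^ (1 - theta))%:E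
             <= Theta sigma t theta)%E /\
          (Theta sigma t theta
             <= ((C * t%:R ^+ (n - 1)) `^ (1 - theta))%:E)%E]].
Proof.
split.
- move=> n sigma theta n0 inv th0 th1; split => [|nu cub].
    by apply/eqP; rewrite eq_le cross_polytope_upper // cross_polytope_lower.
  exact: tight_cubature_strength3 cub.
- by move=> t _; exact: Theta_growth_dimension.
move=> n n0; exists ((2 * n)%:R^-1 ^+ n.-1), (2 * 3 ^ n.-1 + 2)%:R; split.
- by rewrite exprn_gt0 // invr_gt0 ltr0n muln_gt0.
- by rewrite ltr0n addn_gt0 orbT.
move=> sigma t theta inv t0 th0 th1; rewrite subn1; split.
  exact: Theta_lower_degree.
exact: Theta_upper_degree.
Qed.
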